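(* Consider the weighted recursive graph with out-degree $m\in\mathbb{N}$, where the vertex-weight distribution has unbounded support, belongs to the Gumbel maximum domain of attraction, and satisfies $\mathbb{E}[W]=1$. Let $I_n:=\inf\{i\in[n]:\mathcal{Z}_n(i)\ge\mathcal{Z}_n(j)\text{ for all }j\in[n]\}$. The following hold as $n\to\infty$. (SV) If the vertex-weights satisfy sub-case (SV), then $$\Big(\max_{i\in[n]}\frac{\mathcal{Z}_n(i)}{mb_n\log n},\frac{\log I_n}{\log n}\Big)\overset{\mathbb{P}}{\longrightarrow}(1,0).$$ (RV) If the vertex-weights satisfy sub-case (RV), let $\gamma:=1/(\tau+1)$. Then $$\Big(\max_{i\in[n]}\frac{\mathcal{Z}_n(i)}{m(1-\gamma)b_{n^\gamma}\log n},\frac{\log I_n}{\log n}\Big)\longrightarrow(1,\gamma)\qquad\text{almost surely}.$$ (RaV) If the vertex-weights satisfy sub-case (RaV), let $t_n:=\exp(-\tau\log n/\log(b_n))$. Then $$\Big(\max_{i\in[n]}\frac{\mathcal{Z}_n(i)}{mb_{t_nn}\log(1/t_n)},\frac{\log I_n}{\log n}\Big)\overset{\mathbb{P}}{\longrightarrow}(1,1).$$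
   Context: Weighted recursive graph (WRG): Let $m\in\mathbb{N}=\{1,2,\dots\}$ and let $W_1,W_2,\dots$ (the vertex-weights) be i.i.d. copies of a non-negative random variable $W$ with $\mathbb{P}(W>0)=1$; set $S_n=\sum_{i=1}^nW_i$. $\mathcal{G}_1$ consists of a single vertex $1$ with weight $W_1$. For $n\ge1$, $\mathcal{G}_{n+1}$ is obtained from $\mathcal{G}_n$ by introducing a new vertex $n+1$ with weight $W_{n+1}$ and $m$ half-edges; conditionally on $\mathcal{G}_n$ (including its vertex-weights), each half-edge is connected independently to some $i\in[n]=\{1,\dots,n\}$ with probability $W_i/S_n$. Edges are directed from new to old vertices. $\mathcal{Z}_n(i)$ denotes the in-degree of vertex $i$ in $\mathcal{G}_n$. Belonging to the Gumbel maximum domain of attraction means: there are sequences $a_n>0$, $b_n\in\mathbb{R}$ such that $(\max_{i\in[n]}W_i-b_n)/a_n$ converges in distribution to the law with distribution function $\exp(-\mathrm{e}^{-x})$, $x\in\mathbb{R}$. Sub-cases: (SV): such sequences satisfy $b_n\sim\ell(\log n)$, where $\ell$ is an increasing function that is slowly varying at infinity ($\lim_{x\to\infty}\ell(cx)/\ell(x)=1$ for all $c>0$). (RV): there exist $a,c_1,\tau>0$ and $b\in\mathbb{R}$ such that $\mathbb{P}(W\ge x)\sim ax^b\mathrm{e}^{-(x/c_1)^\tau}$ as $x\to\infty$. In this case, with $c_2:=c_1/\tau$, one takes, also for non-integer index $r$, $a_r=c_2(\log r)^{1/\tau-1}$ and $b_r=c_1(\log r)^{1/\tau}+a_r((b/\tau)\log\log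 r+b\log c_1+\log a)$. (RaV): there exist $a,c_1>0$, $b\in\mathbb{R}$ and $\tau>1$ such that $\mathbb{P}(W\ge x)\sim a(\log x)^b\mathrm{e}^{-(\log(x)/c_1)^\tau}$ as $x\to\infty$. In this case, with $c_2:=c_1/\tau$, one takes, also for non-integer index $r$, $b_r=\exp\big(c_1(\log r)^{1/\tau}+c_2(\log r)^{1/\tau-1}((b/\tau)\log\log r+b\log c_1+\log a)\big)$ and $a_r=c_2(\log r)^{1/\tau-1}b_r$. *)

(* Defs.v *)
From HB Require Import structures.
From mathcomp Require Import all_boot all_order all_algebra.
From mathcomp Require Import all_classical all_reals all_analysis.
Set Implicit Arguments.
Unset Strict Implicit.
Unset Printing Implicit Defensive.
Import Order.TTheory GRing.Theory Num.Theory.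
Import numFieldNormedType.Exports.
Local Open Scope classical_set_scope.
Local Open Scope ring_scope.

(** * Probabilistic notions *)

Section probability_notions.
Context {R : realType} {d : measure_display} {T : measurableType d}.
Variable P : probability T R.

Definition equal_in_law (X Y : {RV P >-> R}) : Prop :=
  forall B : set R, measurable B -> P (X @^-1` B) = P (Y @^-1` B).

(* The variables [X i], [i] in [D], are mutually independent: product rule over
   all finite subfamilies. *)
Definition mutually_independent (D : set nat) (X : nat -> {RV P >-> R}) : Prop :=
  forall (s : seq nat) (B : nat -> set R), uniq s ->
    (forall i, i \in s -> D i) -> (forall i, measurable (B i)) ->
    P (\bigcap_(i in [set` s]) (X i @^-1` B i)) =
    (\prod_(i <- s) P (X i @^-1` B i))%E.

(* [f] is a version of the conditional probability of the event [E] given the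
   sub-sigma-algebra [G]. *)
Definition is_cond_prob (G : set (set T)) (E : set T) (f : T -> R) : Prop :=
  (forall B : set R, measurable B -> G (f @^-1` B)) /\
  (forall A : set T, G A -> P (A `&` E) = (\int[P]_(w in A) (f w)%:E)%E).

(* Convergence in distribution to the law with distribution function [F]. *)
Definition cvg_in_distribution (X : nat -> T -> R) (F : R -> R) : Prop :=
  forall x : R, {for x, continuous F} ->
    P [set w | X n w <= x] @[n --> \oo] --> (F x)%:E.

Definition cvg_in_probability {V : normedModType R}
    (X : nat -> T -> V) (l : V) : Prop :=
  forall e : R, 0 < e -> P [set w | e < `|X n w - l|] @[n --> \oo] --> 0%E.

Definition cvg_almost_surely {V : normedModType R}
    (X : nat -> T -> V) (l : V) : Prop :=
  {ae P, forall w, X n w @[n --> \oo] --> l}.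

(* Topological support of the law of [W]. *)
Definition law_support (W : {RV P >-> R}) : set R :=
  [set x | forall U : set R, open U -> U x -> (0 < P (W @^-1` U))%E].

Definition tail (W : {RV P >-> R}) (x : R) : R := fine (P [set w | x <= W w]).

End probability_notions.

(* Maximum over [1, ..., n] (for n >= 1). *)
Definition max_upto {R : realType} (n : nat) (F : nat -> R) : R :=
  \big[Num.max/F 1%N]_(1 <= i < n.+1) F i.

(** * The weighted recursive graph *)

(* Vertices are labelled by 1, 2, ...; index 0 is never used. [weight i] is the
   weight of vertex [i] and, for k >= 2, [target k j] is the endpoint of the j-th
   half-edge of vertex [k], so that the graph with n vertices is determined by
   [weight i], 1 <= i <= n, and [target k j], 2 <= k <= n. *)
Section weighted_recursive_graph.
Context {R : realType} {d : measure_display} {T : measurableType d}.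
Variables (P : probability T R) (m : nat).
Variable weight : nat -> {RV P >-> R}.
Variable target : nat -> 'I_m -> {RV P >-> nat}.

Definition total_weight (n : nat) (w : T) : R :=
  \sum_(1 <= i < n.+1) weight i w.

(* Sigma-algebra generated by the weights of the vertices 1, ..., n and the
   edges sent out by the vertices 2, ..., k. In particular [history n n] is the
   sigma-algebra generated by the weighted graph with n vertices. *)
Definition history (n k : nat) : set (set T) :=
  <<s [set A | exists (i : nat) (B : set R),
          [/\ (1 <= i <= n)%N, measurable B & A = weight i @^-1` B]] `|`
      [set A | exists (l : nat) (j : 'I_m) (v : nat),
          (2 <= l <= k)%N /\ A = target l j @^-1` [set v]] >>.

Record weighted_recursive_graph (W : {RV P >-> R}) : Prop := {
  weight_law : forall i, (1 <= i)%N -> equal_in_law (weight i) W;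
  weight_indep : mutually_independent [set i | (1 <= i)%N] weight;
  (* the weight of a new vertex is drawn independently of the present graph and
     of the way the new vertex connects to it *)
  new_weight_indep : forall n, (1 <= n)%N -> forall (A : set T) (B : set R),
    history n n.+1 A -> measurable B ->
    P (A `&` weight n.+1 @^-1` B) = (P A * P (weight n.+1 @^-1` B))%E;
  target_range : forall n, (1 <= n)%N -> forall (j : 'I_m) (w : T),
    (1 <= target n.+1 j w <= n)%N;
  (* conditionally on the graph with n vertices, the m half-edges of vertex
     n + 1 are independent, each attaching to i with probability W_i / S_n *)
  target_law : forall n, (1 <= n)%N -> forall v : 'I_m -> nat,
    (forall j, (1 <= v j <= n)%N) ->
    is_cond_prob P (history n n) [set w | forall j, target n.+1 j w = v j]
      (fun w => \prod_(j < m) (weight (v j) w / total_weight n w))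
}.

(* Multiple edges are counted with multiplicity. *)
Definition indegree (n i : nat) (w : T) : nat :=
  \sum_(2 <= k < n.+1) \sum_(j < m) (target k j w == i).

(* Smallest label of a vertex of maximal in-degree: [iota 1 n] lists 1, ..., n in
   increasing order. *)
Definition max_degree_label (n : nat) (w : T) : nat :=
  head 0%N [seq i <- iota 1 n |
    all (fun j => (indegree n j w <= indegree n i w)%N) (iota 1 n)].

End weighted_recursive_graph.

(** * The Gumbel maximum domain of attraction and its sub-cases *)

Section gumbel.
Context {R : realType} {d : measure_display} {T : measurableType d}.
Variable P : probability T R.

Definition gumbel_cdf (x : R) : R := expR (- expR (- x)).

Definition gumbel_norming (weight : nat -> {RV P >-> R}) (a b : nat -> R) : Prop :=
  (forall n, (1 <= n)%N -> 0 < a n) /\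
  cvg_in_distribution P
    (fun n w => (max_upto n (fun i => weight i w) - b n) / a n) gumbel_cdf.

Definition in_gumbel_mda (weight : nat -> {RV P >-> R}) : Prop :=
  exists a b : nat -> R, gumbel_norming weight a b.

Definition asymp_equiv {I : Type} (F : set_system I) (f g : I -> R) : Prop :=
  f i / g i @[i --> F] --> (1 : R).

Definition slowly_varying (l : R -> R) : Prop :=
  forall c : R, 0 < c -> l (c * x) / l x @[x --> +oo] --> (1 : R).

(* Sub-case (SV) for norming sequences with centering [b]. *)
Definition case_SV (b : nat -> R) : Prop :=
  exists l : R -> R,
    [/\ {in > 0 &, {homo l : x y / x <= y}}, slowly_varying l &
        asymp_equiv \oo b (fun n => l (ln n%:R))].

Definition case_RV (W : {RV P >-> R}) (a c1 tau b : R) : Prop :=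
  [/\ 0 < a, 0 < c1, 0 < tau &
      asymp_equiv +oo (tail W)
        (fun x => a * x `^ b * expR (- (x / c1) `^ tau))].

Definition case_RaV (W : {RV P >-> R}) (a c1 tau b : R) : Prop :=
  [/\ 0 < a, 0 < c1, 1 < tau &
      asymp_equiv +oo (tail W)
        (fun x => a * ln x `^ b * expR (- (ln x / c1) `^ tau))].

End gumbel.

(* Norming sequences of sub-cases (RV) and (RaV), for a real index [r]. *)
Section norming.
Context {R : realType}.
Variables a c1 tau b : R.
Let c2 : R := c1 / tau.

Definition RV_scale (r : R) : R := c2 * ln r `^ (tau^-1 - 1).

Definition RV_center (r : R) : R :=
  c1 * ln r `^ tau^-1
  + RV_scale r * (b / tau * ln (ln r) + b * ln c1 + ln a).

Definition RaV_center (r : R) : R :=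
  expR (c1 * ln r `^ tau^-1
        + c2 * ln r `^ (tau^-1 - 1) * (b / tau * ln (ln r) + b * ln c1 + ln a)).

End norming.

(* Main.v *)
Require Import Defs.
From mathcomp Require Import all_boot all_order all_algebra.
From mathcomp Require Import all_classical all_reals all_analysis.
From mathcomp Require Import measurable_realfun ring lra zify.
Import Order.TTheory GRing.Theory Num.Theory.
Import numFieldNormedType.Exports.
Local Open Scope classical_set_scope.
Local Open Scope ring_scope.

(** The theorem rests on one approximation, valid uniformly over all vertices:
    the in-degree of vertex [i] in the graph with [n] vertices is close to
    [m * W_i * log (n / i)]. Each half-edge sent out by vertex [k + 1] reaches
    [i] with conditional probability [W_i / S_k], so the compensator of the
    in-degree is [m * W_i] times the sum of [1 / S_k] over [i <= k < n]. The
    Laplace transform of a binomial variable is at most that of the Poisson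
    variable of the same mean, hence the exponential of [theta] times the
    in-degree, minus [exp theta - 1] times the compensator, is a
    supermartingale. Markov's inequality and a union bound over the vertices
    then give [in_degree_concentration], with an additive error of small order
    compared to the maximal in-degree.

    The sum of the [1 / S_k] is close to [log (n / i)] because [S_k / k] tends
    to 1. Belonging to the Gumbel domain of attraction makes the quantiles of
    [W] grow more slowly than any power, so [W] has a second moment and the
    strong law follows from Chebyshev's inequality along the squares
    ([total_weight_equiv]). The random error made for small [k] is multiplied by
    [W_i] only, and is absorbed because the largest weight is negligible with
    respect to the largest product [W_i * log (n / i)].

    It follows ([argmax_in_degree]) that the maximal in-degree and its location
    can be read off from the independent scores [W_i * log (n / i)], as soon as
    their maximum is known to first order and the scores of indices at a wrong
    logarithmic scale are smaller by a constant factor. This reduction is carried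
    out simultaneously for events that hold eventually almost surely and for
    events of probability tending to 1.

    The scores are then a balance between a large weight, which favours many
    candidates and so a large index, and a large [log (n / i)]. In the slowly
    varying case the maximal weight among the first [n ^ s] vertices is already
    as large as among all [n], so [s] is pushed to 0. For stretched exponential
    tails the largest weight of index about [n ^ s] is
    [c1 * (s * log n) ^ (1 / tau)], and [s ^ (1 / tau) * (1 - s)] is maximal at
    [s = 1 / (tau + 1)]; the tails are light enough for the Borel--Cantelli lemma.
    For log-normal-type tails the largest weight of index about [n * exp (- K * u)]
    is [B * exp (- u)], where [B = exp (c1 * (log n) ^ (1 / tau))] and
    [K = (tau / c1) * (log n) ^ (1 - 1 / tau)], so the score is
    [B * K * u * exp (- u)]; the maximum is attained at [u = 1], that is at the
    index [n * exp (- K)], which is [n ^ (1 - o(1))]. *)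

Set Implicit Arguments.
Unset Strict Implicit.
Unset Printing Implicit Defensive.

(** * Events that hold eventually *)

Section eventual_events.
Context {R : realType} {d : measure_display} {T : measurableType d}.
Variable P : probability T R.
Implicit Types A B : nat -> set T.

Definition eventually_as A : Prop :=
  {ae P, forall w, \forall n \near \oo, A n w}.

(** Covering the complements by measurable events makes the notion stable under
    supersets, measurable or not. *)
Definition with_high_prob A : Prop :=
  exists B, [/\ forall n, measurable (B n), forall n, ~` A n `<=` B n &
    P (B n) @[n --> \oo] --> 0%E].

(** Common interface of the two notions, through which one deterministic
    argument serves both modes of convergence. *)
Record event_mode (E : (nat -> set T) -> Prop) : Prop := {
  mode_setT : E (fun=> setT);
  modeI : forall A B, E A -> E B -> E (fun n => A n `&` B n);
  modeS : forall A B, (\forall n \near \oo, A n `<=` B n) -> E A -> E B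
}.

Lemma eventually_as_mode : event_mode eventually_as.
Proof.
split.
- by apply: aeW => w; exact: nearW.
- by move=> A B; apply: filterS2 => w; apply: filterS2.
- by move=> A B AB; apply: filterS => w; move: AB; apply: filterS2 => n; apply.
Qed.

Lemma with_high_prob_mode : event_mode with_high_prob.
Proof.
split.
- exists (fun=> set0); split => //; first by move=> n w /=.
  by rewrite measure0; exact: cvg_cst.
- move=> A A' [B [mB AB B0]] [B' [mB' AB' B0']].
  exists (fun n => B n `|` B' n); split.
  + by move=> n; exact: measurableU.
  + by move=> n; rewrite setCI; exact: setUSS.
  + apply: (@squeeze_cvge _ _ _ _ (cst 0%E) _ (fun n => P (B n) + P (B' n))%E).
    * by apply: nearW => n; rewrite measure_ge0 measureU2.
    * exact: cvg_cst.
    * by rewrite -(adde0 0%E); apply: cvgeD.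
- move=> A A' AA' [B [mB AB B0]].
  have [N _ NA] := AA'.
  exists (fun n => if (N <= n)%N then B n else setT); split.
  + by move=> n; case: ifP.
  + move=> n; case: ifPn => // Nn; apply: subset_trans (AB n).
    by apply: subsetC; exact: NA.
  + apply: cvg_trans B0; apply: near_eq_cvg.
    by exists N => // n /= ->.
Qed.

Lemma with_high_probP A : (forall n, measurable (A n)) ->
  with_high_prob A -> P (~` A n) @[n --> \oo] --> 0%E.
Proof.
move=> mA [B [mB AB B0]].
apply: (@squeeze_cvge _ _ _ _ (cst 0%E) _ (fun n => P (B n))) => //.
- apply: nearW => n; rewrite measure_ge0 /= le_measure ?inE//.
  exact: measurableC.
- exact: cvg_cst.
Qed.

Lemma eventually_as_with_high_prob A : (forall n, measurable (A n)) ->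
  eventually_as A -> with_high_prob A.
Proof.
move=> mA aeA; exists (fun n => ~` A n).
have mC n : measurable (~` A n) by exact: measurableC.
split => //; first by move=> n w.
have mU n : measurable (\bigcup_(k >= n) ~` A k) by exact: bigcup_measurable.
have U0 : P (\bigcup_(k >= n) ~` A k) @[n --> \oo] --> 0%E; last first.
  apply: (@squeeze_cvge _ _ _ _ (cst 0%E) _ _ _ _ _ U0).
    apply: nearW => n; rewrite measure_ge0 /= le_measure ?inE//.
    by move=> w Aw; exists n => /=.
  exact: cvg_cst.
have <- : P (lim_sup_set (fun n => ~` A n)) = 0%E.
    apply: measure_negligible.
      by apply: bigcap_measurable => // k _; exact: bigcup_measurable.
    apply: negligibleS aeA => w lw /= [N _ NA].
    by have [k /= Nk] := lw N I; apply; exact: NA.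
  apply: lim_sup_set_cvg => //.
  by rewrite (le_lt_trans (probability_le1 _ _)) ?ltry.
Qed.

(** Borel--Cantelli, with summability given by a telescoping majorant. *)
Lemma borel_cantelli_telescope A B (f : nat -> R) :
  (forall n, measurable (B n)) -> (forall n, ~` A n `<=` B n) ->
  (forall n, 0 <= f n) ->
  (\forall n \near \oo, (P (B n) <= (f n - f n.+1)%:E)%E) ->
  eventually_as A.
Proof.
move=> mB AB f0 [N _ PB].
pose B' n := B (N + n)%N.
have mB' n : measurable (B' n) by exact: mB.
have S0 : P (lim_sup_set B') = 0%E.
  apply: lim_sup_set_cvg0 => //.
  apply: (@le_lt_trans _ _ (f N)%:E); last exact: ltry.
  apply: lime_le; first by apply: is_cvg_nneseries => n _ _; exact: measure_ge0.
  apply: nearW => n.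
  have -> : (f N)%:E = (f (N + n)%N)%:E + (f N - f (N + n)%N)%:E :> \bar R.
    by rewrite -EFinD addrC subrK.
  rewrite -[leLHS]add0e leeD// ?lee_fin//.
  elim: n => [|n IH]; first by rewrite big_nil addn0 subrr.
  rewrite big_nat_recr//= -(subrK (f (N + n)%N) (f N)) -addrA EFinD leeD//.
  by rewrite addnS; apply: PB => /=; rewrite leq_addr.
have mS : measurable (lim_sup_set B').
  by apply: bigcap_measurable => // k _; exact: bigcup_measurable.
exists (lim_sup_set B'); split => // w /= nA n _.
apply: contrapT => nB; apply: nA; exists (N + n)%N => // k /= Nk.
apply: contrapT => nAk; apply: nB; exists (k - N)%N => /=; first lia.
rewrite /B' subnKC; first exact: AB.
by rewrite (leq_trans _ Nk)// leq_addr.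
Qed.

Lemma borel_cantelli_square A B (C : R) :
  (forall n, measurable (B n)) -> (forall n, ~` A n `<=` B n) ->
  (\forall n \near \oo, (P (B n) <= (C / n%:R ^+ 2)%:E)%E) ->
  eventually_as A.
Proof.
move=> mB AB PB.
(* [1 / n ^ 2 <= 1 / (n - 1) - 1 / n] *)
pose f n : R := if n is k.+2 then `|C| / k.+1%:R else 0.
apply: (@borel_cantelli_telescope A B f) => //.
  by move=> [|[|n]] //=; rewrite divr_ge0.
apply: filterS2 PB (nbhs_infty_ge 2) => -[|[|n]] //= + _ => /le_trans; apply.
rewrite lee_fin.
rewrite (@le_trans _ _ (`|C| / n.+2%:R ^+ 2))//.
  by rewrite ler_wpM2r ?invr_ge0 ?exprn_ge0// ler_norm.
rewrite -mulrBr ler_wpM2l//.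
have n0 : 0 < n%:R + 1 :> R by rewrite ltr_pwDr.
rewrite -[n.+2%:R]natr1 -[n.+1%:R]natr1.
have -> : (n%:R + 1)^-1 - (n%:R + 1 + 1)^-1 = ((n%:R + 1) * (n%:R + 1 + 1))^-1 :> R.
  by field; rewrite !gt_eqF// ltr_pwDr// ltW.
rewrite lef_pV2 ?posrE ?mulr_gt0 ?exprn_gt0 ?ltr_pwDr ?(ltW n0)//.
by rewrite expr2 ler_wpM2r ?lerDl// addr_ge0// ltW.
Qed.

Lemma borel_cantelli_powR A B (C a : R) : 0 < a ->
  (forall n, measurable (B n)) -> (forall n, ~` A n `<=` B n) ->
  (\forall n \near \oo, (P (B n) <= (C * n%:R `^ (- (1 + a)))%:E)%E) ->
  eventually_as A.
Proof.
move=> a0 mB AB PB.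
(* [a * n ^ (- (1 + a)) <= (n - 1) ^ (- a) - n ^ (- a)] *)
pose f n : R := if n is k.+2 then `|C| / a * k.+1%:R `^ (- a) else 0.
apply: (@borel_cantelli_telescope A B f) => //.
  by move=> [|[|n]] //=; rewrite mulr_ge0 ?powR_ge0// divr_ge0// ltW.
apply: filterS2 PB (nbhs_infty_ge 2) => -[|[|n]] //= + _ => /le_trans; apply.
rewrite lee_fin.
rewrite (@le_trans _ _ (`|C| * n.+2%:R `^ (- (1 + a))))//.
  by rewrite ler_wpM2r ?powR_ge0// ler_norm.
rewrite -mulrBr -mulrA ler_wpM2l// -ler_pdivrMl ?invr_gt0// invrK.
(* [(x / y) ^ a = exp (- a * ln (1 - 1 / x)) >= 1 + a / x] when [y = x - 1] *)
set x : R := n.+2%:R; set y : R := n.+1%:R.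
have y0 : 0 < y by rewrite ltr0n.
have x0 : 0 < x by rewrite ltr0n.
have xE : x = y + 1 by rewrite /x /y natr1.
clearbody x y.
have -> : y `^ (- a) = x `^ (- a) * expR (a * - ln (y / x)).
  rewrite /powR !gt_eqF// -expRD ln_div ?posrE//.
  by congr expR; ring.
have le1 : a / x <= expR (a * - ln (y / x)) - 1.
  rewrite lerBrDl; apply: le_trans (expR_ge1Dx _).
  rewrite lerD2l ler_wpM2l ?(ltW a0)// lerNr.
  have -> : y / x = 1 + - x^-1 by rewrite xE; field; rewrite -xE gt_eqF.
  apply: le_ln1Dx; rewrite ltrN2 invf_lt1// xE ltrDr//.
rewrite opprD powRD; last by rewrite (gt_eqF x0) implybT.
rewrite powR_inv1 ?(ltW x0)// (mulrC x^-1) mulrCA -[X in _ <= _ - X]mulr1.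
by rewrite -mulrBr ler_wpM2l// powR_ge0.
Qed.

End eventual_events.

(** * Integrals against a random variable, and independence *)

Section integral_product.
Context {R : realType} {d : measure_display} {T : measurableType d}.
Variable P : probability T R.
Import HBNNSimple.

Lemma ge0_integral_simple_comp (g h : T -> R) (phi : {nnsfun R >-> R}) :
  measurable_fun setT g -> measurable_fun setT h -> (forall w, 0 <= h w) ->
  (\int[P]_w (phi (g w) * h w)%:E = \sum_(y \in range phi)
     y%:E * \int[P]_(w in g @^-1` (phi @^-1` [set y])) (h w)%:E)%E.
Proof.
move=> mg mh h0.
have mphi (y : R) : measurable (phi @^-1` [set y]) by exact: measurable_sfunP.
have mB (y : R) : measurable (g @^-1` (phi @^-1` [set y])).
  by rewrite -[X in measurable X]setTI; exact: mg.
have mind (y : R) : measurable_fun setT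
    ((EFin \o h) \* (EFin \o \1_(g @^-1` (phi @^-1` [set y]))))%E.
  apply: emeasurable_funM; first exact/measurable_EFinP.
  by apply/measurable_EFinP; exact: measurable_indic.
transitivity (\int[P]_w (\sum_(y \in range phi)
    y%:E * ((h w)%:E * (\1_(g @^-1` (phi @^-1` [set y])) w)%:E)))%E.
  apply: eq_integral => w _; rewrite fimfunE EFinM muleC -fsumEFin//.
  rewrite ge0_mule_fsumr; last by move=> y; exact: nnfun_muleindic_ge0.
  apply: eq_fsbigr => y _.
  by rewrite EFinM muleCA !muleA.
rewrite ge0_integral_fsum//.
- apply: eq_fsbigr => y; rewrite inE => -[z zT yE].
  rewrite ge0_integralZl//.
  + congr (_ * _)%E; rewrite [RHS]integral_mkcond.
    apply: eq_integral => w _.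
    by rewrite epatch_indic.
  + exact: mind.
  + by move=> w _; rewrite mule_ge0// lee_fin.
  + by rewrite lee_fin -yE.
- by move=> y; apply: measurable_funeM; exact: mind.
- move=> y w _; rewrite muleCA; apply: mule_ge0; first by rewrite lee_fin.
  by rewrite -EFinM; exact: (nnfun_muleindic_ge0 phi y (g w)).
Qed.

(** By approximation with simple functions of [g]. It serves to replace an
    indicator by its conditional probability given an observable [g], and an
    independent factor by its mean. *)
Lemma ge0_integral_comp_eq (g h f : T -> R) :
  measurable_fun setT g -> measurable_fun setT h -> measurable_fun setT f ->
  (forall w, 0 <= g w) -> (forall w, 0 <= h w) -> (forall w, 0 <= f w) ->
  (forall B, measurable B ->
    (\int[P]_(w in g @^-1` B) (h w)%:E = \int[P]_(w in g @^-1` B) (f w)%:E)%E) ->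
  (\int[P]_w (g w * h w)%:E = \int[P]_w (g w * f w)%:E)%E.
Proof.
move=> mg mh mf g0 h0 f0 hf.
have mD : measurable (`[0, +oo[%classic : set R) by exact: measurable_itv.
have mI : measurable_fun (`[0, +oo[%classic : set R) (EFin : R -> \bar R).
  exact: measurable_funTS.
pose phi := nnsfun_approx mD mI.
have phi_cvg w : (phi n (g w))%:E @[n --> \oo] --> (g w)%:E.
  apply: (@cvg_nnsfun_approx _ _ _ _ mD _ mI).
    by move=> x /=; rewrite in_itv /= andbT lee_fin.
  by rewrite /= in_itv /= g0.
have key (k : T -> R) : measurable_fun setT k -> (forall w, 0 <= k w) ->
    (\int[P]_w (phi n (g w) * k w)%:E)%E @[n --> \oo] -->
    (\int[P]_w (g w * k w)%:E)%E.
  move=> mk k0.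
  have E1 w : (g w * k w)%:E = lim ((phi n (g w) * k w)%:E @[n --> \oo]).
    apply/esym/cvg_lim => //; under eq_fun do rewrite EFinM.
    rewrite EFinM; apply: cvgeZr => //; exact: phi_cvg.
  rewrite (eq_integral _ _ (fun w _ => E1 w)).
  apply: cvg_monotone_convergence => //.
  - move=> n; apply/measurable_EFinP; apply: measurable_funM => //.
    exact: measurableT_comp.
  - by move=> n w _; rewrite lee_fin mulr_ge0.
  - move=> w _ a b ab; rewrite lee_fin ler_wpM2r//.
    exact/lefP/nd_nnsfun_approx.
apply/(cvg_unique _ (key h mh h0)) => //.
suff -> : (fun n => (\int[P]_w (phi n (g w) * h w)%:E)%E) =
          (fun n => (\int[P]_w (phi n (g w) * f w)%:E)%E) by exact: key.
apply/funext => n; rewrite !ge0_integral_simple_comp//.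
apply: eq_fsbigr => y _; congr (_ * _)%E; apply: hf.
exact: measurable_sfunP.
Qed.

Lemma equal_in_law_integral (X Y : {RV P >-> R}) (f : R -> R) :
  equal_in_law X Y -> measurable_fun setT f -> (forall x, 0 <= f x) ->
  (\int[P]_w (f (X w))%:E = \int[P]_w (f (Y w))%:E)%E.
Proof.
move=> XY mf f0.
have E (Z : {RV P >-> R}) :
    (\int[P]_w (f (Z w))%:E = \int[distribution P Z]_x (f x)%:E)%E.
  by rewrite ge0_integral_distribution//; exact/measurable_EFinP.
rewrite !E; apply: eq_measure_integral => A mA _; exact: XY.
Qed.

Lemma independent_ge0_integralM (X Y : T -> R) :
  measurable_fun setT X -> measurable_fun setT Y ->
  (forall A B, measurable A -> measurable B ->
    P (X @^-1` A `&` Y @^-1` B) = (P (X @^-1` A) * P (Y @^-1` B))%E) ->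
  (forall w, 0 <= X w) -> (forall w, 0 <= Y w) ->
  (\int[P]_w (X w)%:E < +oo)%E ->
  (\int[P]_w (X w * Y w)%:E = \int[P]_w (X w)%:E * \int[P]_w (Y w)%:E)%E.
Proof.
move=> mX mY indep X0 Y0 Xfin.
have mXB (Z : T -> R) (B : set R) : measurable_fun setT Z -> measurable B ->
    measurable (Z @^-1` B).
  by move=> mZ mB; rewrite -[X in measurable X]setTI; exact: mZ.
have XB B : measurable B ->
    (\int[P]_(w in Y @^-1` B) (X w)%:E = P (Y @^-1` B) * \int[P]_w (X w)%:E)%E.
  move=> mB; set p := P (Y @^-1` B).
  have pfin : p \is a fin_num by apply: fin_num_measure; exact: mXB.
  have p0 : 0 <= fine p by apply: fine_ge0; exact: measure_ge0.
  transitivity (\int[P]_w (X w * \1_(Y @^-1` B) w)%:E)%E.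
    rewrite integral_mkcond; apply: eq_integral => w _.
    by rewrite EFinM epatch_indic.
  rewrite (@ge0_integral_comp_eq _ _ (cst (fine p)))//.
  - under eq_integral do rewrite /= mulrC EFinM.
    by rewrite ge0_integralZl//= ?fineK//; [exact/measurable_EFinP|move=> x _; rewrite lee_fin].
  - by apply: measurable_indic; exact: mXB.
  - move=> A mA; rewrite integral_indic//; [|exact: mXB|exact: mXB].
    rewrite [RHS](@integral_cst _ _ _ P _ (mXB X A mX mA) (fine p)%:E).
    by rewrite fineK// muleC -[RHS]indep// setIC.
pose e := fine (\int[P]_w (X w)%:E)%E.
have eE : (e%:E = \int[P]_w (X w)%:E)%E.
  by rewrite fineK// ge0_fin_numE//; apply: integral_ge0 => w _; rewrite lee_fin.
have e0 : 0 <= e by apply: fine_ge0; apply: integral_ge0 => w _; rewrite lee_fin.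
under eq_integral do rewrite mulrC.
rewrite (@ge0_integral_comp_eq _ _ (cst e))//.
- under eq_integral do rewrite /= EFinM muleC.
  by rewrite ge0_integralZl//= -?eE ?lee_fin//; [exact/measurable_EFinP|move=> x _; rewrite lee_fin].
- move=> B mB; rewrite XB//.
  by rewrite [RHS](@integral_cst _ _ _ P _ (mXB Y B mY mB) e%:E) -eE muleC.
Qed.

End integral_product.

(** * The strong law of large numbers *)

Section strong_law.
Context {R : realType} {d : measure_display} {T : measurableType d}.
Variable P : probability T R.

Lemma measurable_ge_fun (g : T -> R) (c : R) :
  measurable_fun setT g -> measurable [set w | c <= g w].
Proof.
move=> mg; have -> : [set w | c <= g w] = g @^-1` `[c, +oo[.
  by apply/seteqP; split => w /=; rewrite in_itv /= andbT.
by rewrite -[X in measurable X]setTI; apply: mg => //; exact: measurable_itv.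
Qed.

Lemma measurable_gt_fun (g : T -> R) (c : R) :
  measurable_fun setT g -> measurable [set w | c < g w].
Proof.
move=> mg; have -> : [set w | c < g w] = g @^-1` `]c, +oo[.
  by apply/seteqP; split => w /=; rewrite in_itv /= andbT.
by rewrite -[X in measurable X]setTI; apply: mg => //; exact: measurable_itv.
Qed.

Lemma integral_cst_probability (c : R) : (\int[P]_w c%:E = c%:E)%E.
Proof. by have := expectation_cst P c; rewrite unlock. Qed.

Lemma markov_inequality (g : T -> R) (c M : R) : 0 < c ->
  measurable_fun setT g -> (forall w, 0 <= g w) ->
  (\int[P]_w (g w)%:E <= M%:E)%E -> (P [set w | (c <= g w)%R] <= (M / c)%:E)%E.
Proof.
move=> c0 mg g0 gM; have mA := measurable_ge_fun c mg.
rewrite EFinM muleC -lee_pdivrMl ?invr_gt0// invrK; apply: le_trans gM.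
rewrite -(@integral_cst _ _ _ P _ mA c%:E) integral_mkcond.
apply: ge0_le_integral => //.
- by move=> w _; apply: erestrict_ge0 => {}w _; rewrite lee_fin ltW.
- by apply/(measurable_restrictT _ mA).1; exact: measurable_cst.
- exact/measurable_EFinP.
- move=> w _; rewrite /patch; case: ifP => [|_]; rewrite ?inE lee_fin//.
Qed.

Lemma ge0_integral_sumR (I : Type) (s : seq I) (f : I -> T -> R) :
  (forall i, measurable_fun setT (f i)) -> (forall i w, 0 <= f i w) ->
  (\int[P]_w (\sum_(i <- s) f i w)%:E =
   \sum_(i <- s) \int[P]_w (f i w)%:E)%E.
Proof.
move=> mf f0; under eq_integral do rewrite -sumEFin.
rewrite (ge0_integral_sum P measurableT (f := fun i w => (f i w)%:E))//.
- by move=> i; exact/measurable_EFinP.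
- by move=> i w _; rewrite lee_fin.
Qed.

Variables (X : nat -> T -> R) (v : R).
Hypotheses (mX : forall i, measurable_fun setT (X i))
  (X0 : forall i w, 0 <= X i w)
  (X1 : forall i, (1 <= i)%N -> (\int[P]_w (X i w)%:E = 1)%E)
  (X2 : forall i, (1 <= i)%N -> (\int[P]_w (X i w * X i w)%:E <= v%:E)%E)
  (X11 : forall i j, (1 <= i)%N -> (1 <= j)%N -> i != j ->
     (\int[P]_w (X i w * X j w)%:E = 1)%E).

Let S (n : nat) (w : T) : R := \sum_(1 <= i < n.+1) X i w.

Let mS n : measurable_fun setT (S n).
Proof. by apply: measurable_sum => i; exact: mX. Qed.

Let S0 n w : 0 <= S n w. Proof. by apply: sumr_ge0 => i _. Qed.

Let v0 : 0 <= v.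
Proof.
rewrite -lee_fin; apply: le_trans (X2 (leqnn 1)); apply: integral_ge0 => w _.
by rewrite lee_fin mulr_ge0.
Qed.

Lemma integral_partial_sum n : (\int[P]_w (S n w)%:E = n%:R%:E)%E.
Proof.
rewrite ge0_integral_sumR// (eq_big_nat _ _ (F2 := fun=> 1%E)).
  by rewrite sumEFin big_const_nat subn1 /= iter_addr addr0.
by move=> i /andP[i1 _]; exact: X1.
Qed.

Lemma integral_partial_sum_sqr n :
  (\int[P]_w (S n w * S n w)%:E <= (n%:R * v + n%:R * n%:R)%:E)%E.
Proof.
have E w : S n w * S n w = \sum_(1 <= i < n.+1) \sum_(1 <= j < n.+1) X i w * X j w.
  by rewrite /S mulr_suml; apply: eq_bigr => i _; rewrite mulr_sumr.
under eq_integral do rewrite E.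
rewrite ge0_integral_sumR; last 2 first.
- by move=> i; apply: measurable_sum => j; exact: measurable_funM.
- by move=> i w; apply: sumr_ge0 => j _; exact: mulr_ge0.
have -> : n%:R * v + n%:R * n%:R = \sum_(1 <= i < n.+1) (v + n%:R) :> R.
  by rewrite big_const_nat subn1 /= iter_addr addr0 mulrnDl -[v *+ n]mulr_natl -[n%:R *+ n]mulr_natl.
rewrite -sumEFin big_nat [leRHS]big_nat; apply: lee_sum => i /andP[i1 iN].
rewrite ge0_integral_sumR; [|by move=> j; exact: measurable_funM|by move=> *; exact: mulr_ge0].
rewrite (bigD1_seq i) ?iota_uniq ?mem_index_iota ?i1//= EFinD leeD ?X2//.
rewrite (@le_trans _ _ (\sum_(1 <= j < n.+1) 1)%E)//.
  rewrite big_mkcond /= big_nat [leRHS]big_nat; apply: lee_sum => j /andP[j1 _].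
  by case: ifPn => // ji; rewrite X11// eq_sym.
by rewrite sumEFin big_const_nat subn1 /= iter_addr addr0.
Qed.

Lemma variance_partial_sum n :
  (\int[P]_w ((S n w - n%:R) ^+ 2)%:E <= (n%:R * v)%:E)%E.
Proof.
have m2 : measurable_fun setT (fun w => (S n w - n%:R) ^+ 2).
  by apply: measurable_funX; apply: measurable_funB.
(* both sides are shifted by the cross term, which keeps the integrands
   nonnegative *)
have E : (\int[P]_w ((S n w - n%:R) ^+ 2)%:E + (n%:R * n%:R *+ 2)%:E =
          \int[P]_w (S n w * S n w)%:E + (n%:R * n%:R)%:E)%E.
  { have -> : (n%:R * n%:R *+ 2)%:E = (\int[P]_w (n%:R *+ 2 * S n w)%:E)%E.
    under eq_integral do rewrite EFinM.
    rewrite ge0_integralZl//.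
    - by rewrite integral_partial_sum -EFinM; congr EFin; ring.
    - exact/measurable_EFinP.
    - by move=> w _; rewrite lee_fin.
  have -> : (n%:R * n%:R)%:E = (\int[P]_w (n%:R * n%:R)%:E)%E :> \bar R.
    by rewrite integral_cst_probability.
  rewrite -!ge0_integralD//.
  - by apply: eq_integral => w _; rewrite -!EFinD; congr EFin; ring.
  all: try by move=> w _; rewrite lee_fin ?sqr_ge0// ?mulr_ge0// mulrn_wge0.
  all: by apply/measurable_EFinP => //; apply: measurable_funM. }
rewrite -(@leeD2rE _ (n%:R * n%:R *+ 2)%:E)// E.
apply: le_trans (leeD2r _ (integral_partial_sum_sqr n)) _.
by rewrite -!EFinD lee_fin mulr2n addrA.
Qed.

Lemma chebyshev_partial_sum (e : R) n : 0 < e -> (0 < n)%N ->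
  (P [set w | (e * n%:R <= `|S n w - n%:R|)%R] <= (v / e ^+ 2 / n%:R)%:E)%E.
Proof.
move=> e0 n0; have en0 : 0 < e * n%:R by rewrite mulr_gt0 ?ltr0n.
have -> : [set w | e * n%:R <= `|S n w - n%:R|] =
          [set w | (e * n%:R) ^+ 2 <= (S n w - n%:R) ^+ 2].
  suff E w : (e * n%:R <= `|S n w - n%:R|) = ((e * n%:R) ^+ 2 <= (S n w - n%:R) ^+ 2).
    by apply/seteqP; split => w /=; rewrite E.
  by rewrite -[in RHS](real_normK (num_real (S n w - _))) ler_sqr ?nnegrE// ltW.
have -> : v / e ^+ 2 / n%:R = n%:R * v / (e * n%:R) ^+ 2.
  by field; rewrite (gt_eqF e0) pnatr_eq0 -lt0n n0.
apply: markov_inequality (variance_partial_sum n).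
- by rewrite exprn_gt0.
- by apply: measurable_funX; apply: measurable_funB.
- by move=> w; exact: sqr_ge0.
Qed.

Lemma nat_sqrt_exists (n : nat) : exists k, (k ^ 2 <= n < k.+1 ^ 2)%N.
Proof.
elim: n => [|n [k /andP[kn nk]]]; first by exists 0%N.
have [nk1|nk1] := ltnP n.+1 (k.+1 ^ 2); first by exists k; rewrite nk1 (leqW kn).
exists k.+1; rewrite nk1 /=.
by rewrite (leq_ltn_trans nk) // ltn_exp2r.
Qed.

(** Chebyshev's bound is summable along the squares, and the partial sums are
    monotone in between. *)
Lemma strong_law_eps (e : R) : 0 < e -> e < 1 ->
  eventually_as P (fun n => [set w | (1 - e) ^+ 3 * n%:R <= S n w <= (1 + e) ^+ 3 * n%:R]).
Proof.
move=> e0 e1.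
(* one factor [1 +- e] is Chebyshev's, the other two compare the squares of
   consecutive integers *)
have sq : eventually_as P
    (fun k => [set w | `|S (k ^ 2)%N w - (k ^ 2)%:R| < e * (k ^ 2)%:R]).
  apply: (@borel_cantelli_square _ _ _ P _
    (fun k => [set w | e * (k ^ 2)%:R <= `|S (k ^ 2)%N w - (k ^ 2)%:R|])
    (v / e ^+ 2)).
  - move=> k; apply: measurable_ge_fun.
    by apply: measurableT_comp => //; apply: measurable_funB.
  - by move=> k w /= /negP; rewrite -leNgt.
  - exists 1%N => // k /= k1; rewrite -natrX; apply: chebyshev_partial_sum => //.
    by rewrite expn_gt0 k1.
apply: filterS sq => w [K _ HK].
have [N0 _ HN0] := nbhs_infty_ger (e^-1).
exists (maxn 1 (maxn K N0) ^ 2)%N => // n /= Kn.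
have [k /andP[kn nk]] := nat_sqrt_exists n.
have Kk : (maxn 1 (maxn K N0) <= k)%N.
  by rewrite -ltnS -(ltn_exp2r _ _ (ltn0Sn 1)) (leq_ltn_trans Kn).
move: Kk; rewrite !geq_max => /and3P[k1 Kk N0k].
have k0 : 0 < k%:R :> R by rewrite ltr0n.
have ke : 1 <= e * k%:R by rewrite -ler_pdivrMl// mulr1; exact: HN0.
have /ltr_normlP[_] := HK k.+1 (leqW Kk).
have /ltr_normlP[+ _] := HK k Kk.
have lo : S (k ^ 2)%N w <= S n w.
  by rewrite /S [leRHS](big_cat_nat _ (n := (k ^ 2).+1))//= lerDl sumr_ge0.
have hi : S n w <= S (k.+1 ^ 2)%N w.
  by rewrite /S [leRHS](big_cat_nat _ (n := n.+1)) ?ltnS ?(ltnW nk)//= lerDl sumr_ge0.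
have kn' : k%:R ^+ 2 <= n%:R :> R by rewrite -natrX ler_nat.
have nk' : n%:R <= (k%:R + 1) ^+ 2 :> R by rewrite natr1 -natrX ler_nat ltnW.
rewrite !natrX -natr1; set s1 := S _ w in lo *; set s2 := S _ w in hi * => h1 h2.
have k1e : k%:R + 1 <= (1 + e) * k%:R :> R by lra.
have k1e' : (1 - e) * (k%:R + 1) <= k%:R :> R by lra.
have sqhi : (k%:R + 1) ^+ 2 <= (1 + e) ^+ 2 * n%:R :> R.
  apply: (@le_trans _ _ (((1 + e) * k%:R) ^+ 2)).
    by rewrite lerXn2r ?nnegrE// ?mulr_ge0//; lra.
  by rewrite exprMn ler_wpM2l// sqr_ge0.
have sqlo : (1 - e) ^+ 2 * n%:R <= k%:R ^+ 2 :> R.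
  apply: (@le_trans _ _ (((1 - e) * (k%:R + 1)) ^+ 2)).
    by rewrite exprMn ler_wpM2l// sqr_ge0.
  by rewrite lerXn2r ?nnegrE// mulr_ge0//; lra.
apply/andP; split.
  apply: le_trans lo; apply: (@le_trans _ _ ((1 - e) * k%:R ^+ 2)); last by lra.
  by rewrite exprS -mulrA ler_wpM2l//; lra.
apply: le_trans hi _; apply: (@le_trans _ _ ((1 + e) * (k%:R + 1) ^+ 2)); first by lra.
by rewrite [X in _ <= X * _]exprS -mulrA ler_wpM2l//; lra.
Qed.

Theorem strong_law : {ae P, forall w, forall e : R, 0 < e ->
  \forall n \near \oo, `|S n w - n%:R| <= e * n%:R}.
Proof.
have /ae_foralln := fun q : nat => @strong_law_eps (q.+2%:R^-1)
  ltac:(by rewrite invr_gt0) ltac:(by rewrite invf_lt1// ltr1n).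
apply: filterS => w Hw e e0.
have [q _ /(_ q (leqnn q)) /= qe] := nbhs_infty_ger (7 * e^-1).
apply: filterS (Hw q) => n /= /andP[lo hi].
set f : R := q.+2%:R^-1 in lo hi.
have q2 : 0 < q.+2%:R :> R by rewrite ltr0n.
have f0 : 0 < f by rewrite invr_gt0.
have f1 : f < 1 by rewrite invf_lt1// ltr1n.
have fe : 7 * f <= e.
  rewrite ler_pdivrMr// -ler_pdivrMl// mulrC (le_trans qe)// ler_nat; lia.
have h1 : (1 + f) ^+ 3 <= 1 + 7 * f.
  rewrite !exprS expr0 mulr1.
  have : f * f <= f by rewrite ger_pMr// ltW.
  have : f * (f * f) <= f by rewrite ger_pMr// mulr_ile1// ltW.
  lra.
have h2 : 1 - 7 * f <= (1 - f) ^+ 3.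
  rewrite !exprS expr0 mulr1.
  have : f * (f * f) <= f by rewrite ger_pMr// mulr_ile1// ltW.
  have : 0 <= f * f by rewrite mulr_ge0// ltW.
  lra.
have n0 : 0 <= n%:R :> R by [].
rewrite ler_norml; apply/andP; split.
  have : (1 - 7 * f) * n%:R <= (1 - f) ^+ 3 * n%:R by rewrite ler_wpM2r.
  have : 7 * f * n%:R <= e * n%:R by rewrite ler_wpM2r.
  lra.
have : (1 + f) ^+ 3 * n%:R <= (1 + 7 * f) * n%:R by rewrite ler_wpM2r.
have : 7 * f * n%:R <= e * n%:R by rewrite ler_wpM2r.
lra.
Qed.

End strong_law.

(** * Concentration of the in-degrees *)

Lemma measurable_invr (R : realType) : measurable_fun setT (fun x : R => x^-1).
Proof.
have E (x : R) : x^-1 = (x * x) `^ (-1) * x.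
  have x2 : 0 <= x * x by rewrite -expr2 sqr_ge0.
  rewrite powR_inv1//.
  have [->|x0] := eqVneq x 0; first by rewrite invr0 mulr0.
  by rewrite invfM mulfVK.
under eq_fun do rewrite E.
apply: measurable_funM => //.
apply: (measurableT_comp (measurable_powR _)).
exact: measurable_funM.
Qed.

Lemma ae_weight_ge0 {R : realType} {d : measure_display} {T : measurableType d}
    (P : probability T R) (weight : nat -> {RV P >-> R}) (W : {RV P >-> R}) :
  (forall i, (1 <= i)%N -> equal_in_law (weight i) W) -> (forall w, 0 <= W w) ->
  {ae P, forall w, forall i, (1 <= i)%N -> 0 <= weight i w}.
Proof.
move=> law W0; suff h i : {ae P, forall w, (1 <= i)%N -> 0 <= weight i w}.
  exact: ae_foralln h.
case: (posnP i) => [->|i0]; first exact: aeW.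
exists (weight i @^-1` `]-oo, 0[); split.
- by rewrite -[X in measurable X]setTI; apply: measurable_funP => //; exact: measurable_itv.
- rewrite (law i i0); last exact: measurable_itv.
  rewrite (_ : _ @^-1` _ = set0) ?measure0//.
  by apply/seteqP; split => w //=; rewrite in_itv /= ltNge W0.
- by move=> w /= /not_implyP[_ /negP]; rewrite -ltNge in_itv.
Qed.

Section in_degrees.
Context {R : realType} {d : measure_display} {T : measurableType d}.
Variables (P : probability T R) (m : nat).
Variables (weight : nat -> {RV P >-> R}) (target : nat -> 'I_m -> {RV P >-> nat}).
Variable W : {RV P >-> R}.
Hypothesis wrg : weighted_recursive_graph weight target W.
Hypothesis W_ge0 : forall w, 0 <= W w.

Definition history_generators (n k : nat) : set (set T) :=
  [set A | exists (i : nat) (B : set R),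
          [/\ (1 <= i <= n)%N, measurable B & A = weight i @^-1` B]] `|`
      [set A | exists (l : nat) (j : 'I_m) (v : nat),
          (2 <= l <= k)%N /\ A = target l j @^-1` [set v]].

(** The history as the measurable structure of a type, so that measurability with
    respect to it is [measurable_fun]. *)
Definition history_type n k := g_sigma_algebraType (history_generators n k).

Lemma history_weight n k i : (1 <= i <= n)%N ->
  measurable_fun [set: history_type n k] (weight i).
Proof.
move=> ni _ B mB; rewrite setTI; apply: sub_sigma_algebra; left.
by exists i, B.
Qed.

Lemma history_target n k l (j : 'I_m) (v : nat) : (2 <= l <= k)%N ->
  measurable_fun [set: history_type n k] (fun w => (target l j w == v)%:R : R).
Proof.
move=> lk; pose A : set (history_type n k) := target l j @^-1` [set v].
have mA : measurable A by apply: sub_sigma_algebra; right; exists l, j, v.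
have -> : (fun w => (target l j w == v)%:R : R) = \1_A.
  apply/funext => w; rewrite indicE; suff -> : (w \in A) = (target l j w == v) by [].
  by apply/idP/idP; rewrite inE => /eqP.
exact: measurable_indic.
Qed.

Lemma history_measurable n k (A : set T) : history weight target n k A -> measurable A.
Proof.
apply: smallest_sub; first exact: sigma_algebra_measurable.
move=> B [[i [C [_ mC ->]]]|[l [j [v [_ ->]]]]];
  by rewrite -[X in measurable X]setTI; exact: measurable_funP.
Qed.

(** [m * weight i * inv_weight_sum i n] is the compensator of the in-degree of
    vertex [i]: the sum of the conditional means of its increments. *)
Definition inv_weight_sum (i n : nat) (w : T) : R :=
  \sum_(i <= k < n) (total_weight weight k w)^-1.

Let weight_ge0 := ae_weight_ge0 (weight_law wrg) W_ge0.

Lemma history_measurable_fun n k (g : T -> R) :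
  measurable_fun [set: history_type n k] g -> measurable_fun [set: T] g.
Proof.
move=> mg _ B mB; rewrite setTI; apply: (@history_measurable n k).
by have := mg measurableT B mB; rewrite setTI.
Qed.

Lemma indegreeS n i w : (1 <= n)%N ->
  indegree target n.+1 i w =
  (indegree target n i w + \sum_(j < m) (target n.+1 j w == i))%N.
Proof. by move=> n1; rewrite /indegree big_nat_recr. Qed.

Lemma indegree_self i w : indegree target i i w = 0%N.
Proof.
rewrite /indegree big_nat big1// => k /andP[k2 ki]; rewrite big1// => j _.
case: k k2 ki => // k k1 ki; have /andP[_] := target_range wrg k1 j w.
by move=> tk; rewrite (_ : (_ == _) = false)//; apply/eqP => ti; lia.
Qed.

(** Conditionally on the present graph, the number of new half-edges that reach
    a given vertex is binomial, so its Laplace transform is at most that of a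
    Poisson variable with the same mean. *)
Lemma laplace_new_edges (theta : R) n i (g : T -> R) : (1 <= i <= n)%N ->
  measurable_fun [set: history_type n n] g -> (forall w, 0 <= g w) ->
  (\int[P]_w (g w * expR (theta * (\sum_(j < m) (target n.+1 j w == i))%:R))%:E <=
   \int[P]_w (g w * expR ((expR theta - 1) *
      (m%:R * weight i w / total_weight weight n w)))%:E)%E.
Proof.
move=> /andP[i1 iN] mg g0.
have n1 : (1 <= n)%N by rewrite (leq_trans i1).
have mgT := history_measurable_fun mg.
pose F (v : {ffun 'I_m -> 'I_n}) w :=
  \prod_(j < m) (weight (v j).+1 w / total_weight weight n w).
pose E (v : {ffun 'I_m -> 'I_n}) : set T :=
  [set w | forall j, target n.+1 j w = (v j).+1].
pose c (v : {ffun 'I_m -> 'I_n}) :=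
  expR (theta * (\sum_(j < m) ((v j).+1 == i))%:R).
have law v : is_cond_prob P (history weight target n n) (E v) (F v).
  by apply: (target_law wrg n1) => j; rewrite /= ltn_ord.
have mE v : measurable (E v).
  rewrite (_ : E v = \bigcap_(j in setT) (target n.+1 j @^-1` [set (v j).+1])).
    apply: fin_bigcap_measurable; first exact: finite_finset.
    by move=> j _; rewrite -[X in measurable X]setTI; exact: measurable_funP.
  by apply/seteqP; split => w /= h j; [move=> _|]; exact: h.
have mF v : measurable_fun [set: T] (F v).
  by move=> _ B mB; rewrite setTI; apply: (@history_measurable n n); exact: (law v).1.
have F0 v : {ae P, forall w, 0 <= F v w}.
  apply: filterS weight_ge0 => w W0; apply: prodr_ge0 => j _.
  rewrite divr_ge0 ?W0// /total_weight big_nat sumr_ge0// => k /andP[k1 _].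
  exact: W0.
(* the new half-edges select exactly one of the finitely many configurations
   [v], on which the exponential is the constant [c v] *)
have expE w : expR (theta * (\sum_(j < m) (target n.+1 j w == i))%:R) =
    \sum_v c v * \1_(E v) w.
  have lt j : ((target n.+1 j w).-1 < n)%N.
    by have /andP[] := target_range wrg n1 j w; case: (target _ _ _).
  pose v0 := [ffun j => Ordinal (lt j)].
  have v0E j : (v0 j).+1 = target n.+1 j w.
    by rewrite ffunE /= prednK//; have /andP[] := target_range wrg n1 j w.
  rewrite (bigD1 v0)//= [X in _ = _ + X]big1 ?addr0; last first.
    move=> v vv0; rewrite indicE memNset ?mulr0// => /= Ev.
    move/eqP: vv0; apply; apply/ffunP => j; apply/val_inj/succn_inj.
    by rewrite v0E -Ev.
  rewrite indicE mem_set ?mulr1; last by move=> j /=; rewrite v0E.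
  by congr (expR (_ * _%:R)); apply: eq_bigr => j _; rewrite v0E.
have -> : (\int[P]_w (g w * expR (theta * (\sum_(j < m) (target n.+1 j w == i))%:R))%:E =
    \int[P]_w (\sum_v (g w * c v) * \1_(E v) w)%:E)%E.
  apply: eq_integral => w _; rewrite expE mulr_sumr.
  by congr EFin; apply: eq_bigr => v _; rewrite mulrA.
have c0 v : 0 <= c v by exact: expR_ge0.
rewrite ge0_integral_sumR; last 2 first.
- by move=> v; do 2?apply: measurable_funM => //; exact: measurable_indic.
- by move=> v w; rewrite !mulr_ge0// indicE.
(* the absolute value makes the conditional probability nonnegative everywhere,
   and not only almost everywhere *)
have step v : (\int[P]_w ((g w * c v) * \1_(E v) w)%:E =
               \int[P]_w ((g w * c v) * `|F v w|)%:E)%E.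
  have m1 : measurable_fun [set: T] (fun w => g w * c v) by exact: measurable_funM.
  have m2 : measurable_fun [set: T] (\1_(E v) : T -> R) by exact: measurable_indic.
  have m3 : measurable_fun [set: T] (fun w => `|F v w|) by exact: measurableT_comp.
  have gc0 w : 0 <= g w * c v by rewrite mulr_ge0.
  apply: ge0_integral_comp_eq => //.
  - move=> B mB.
    have hB : history weight target n n ((fun w => g w * c v) @^-1` B).
      have /(_ measurableT B mB) : measurable_fun [set: history_type n n]
        (fun w => g w * c v) by exact: measurable_funM.
      by rewrite setTI.
    have mB' := history_measurable hB.
    transitivity (P ((fun w => g w * c v) @^-1` B `&` E v)).
      by rewrite integral_indic// setIC.
    rewrite (law v).2//.
    apply: ae_eq_integral => //.
    + by apply/measurable_EFinP; exact: measurable_funTS.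
    + by apply/measurable_EFinP; apply: measurable_funTS; exact: measurableT_comp.
    + by apply: filterS (F0 v) => w Fw _; rewrite ger0_norm.
rewrite (eq_bigr _ (fun v _ => step v)) -ge0_integral_sumR; last 2 first.
- by move=> v; do 2?apply: measurable_funM => //; exact: measurableT_comp.
- by move=> v w; rewrite !mulr_ge0.
apply: ae_ge0_le_integral => //.
- by move=> w _; rewrite lee_fin sumr_ge0// => v _; rewrite !mulr_ge0.
- apply/measurable_EFinP; apply: measurable_sum => v.
  by do 2?apply: measurable_funM => //; exact: measurableT_comp.
- by move=> w _; rewrite lee_fin mulr_ge0// expR_ge0.
- apply/measurable_EFinP; apply: measurable_funM => //.
  apply: measurableT_comp => //; apply: measurable_funM => //.
  apply: measurable_funM; first exact: measurable_funM.
  apply: (measurableT_comp (@measurable_invr R)).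
  by apply: measurable_sum.
apply: filterS weight_ge0 => w W0 _; rewrite lee_fin.
have S0 : 0 <= total_weight weight n w.
  by rewrite /total_weight big_nat sumr_ge0// => k /andP[k1 _]; exact: W0.
rewrite (eq_bigr (fun v => g w * (c v * F v w))); last first.
  move=> v _; rewrite -mulrA ger0_norm//; apply: prodr_ge0 => j _.
  by rewrite divr_ge0// W0.
rewrite -mulr_sumr ler_wpM2l//.
set S := total_weight weight n w in S0 *.
pose q (u : 'I_n) := expR (theta * (u.+1 == i)%:R) * (weight u.+1 w / S).
have -> : \sum_v c v * F v w = (\sum_(u < n) q u) ^+ m.
  rewrite -[in RHS](card_ord m) -prodr_const bigA_distr_bigA /=.
  apply: eq_bigr => v _; rewrite big_split /=; congr (_ * _).
  by rewrite /c -expR_sum -mulr_sumr natr_sum.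
have q0 u : 0 <= q u by rewrite /q mulr_ge0 ?expR_ge0// divr_ge0// W0.
have -> : (expR theta - 1) * (m%:R * weight i w / S) =
    m%:R * ((expR theta - 1) * (weight i w / S)) by ring.
rewrite expRM_natl lerXn2r ?nnegrE ?expR_ge0 ?sumr_ge0//.
have [S00|SN0] := eqVneq S 0.
  by rewrite S00 invr0 !mulr0 expR0 big1 ?ler01// => u _; rewrite /q S00 invr0 !mulr0.
apply: le_trans (expR_ge1Dx _).
have i0 : (i.-1 < n)%N by rewrite prednK.
rewrite (bigD1 (Ordinal i0))//= /q /= prednK// eqxx mulr1.
rewrite (eq_bigr (fun u : 'I_n => weight u.+1 w / S)); last first.
  move=> u ui; rewrite (_ : (u.+1 == i) = false) ?mulr0 ?expR0 ?mul1r//.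
  by apply/negP => /eqP ue; move/negP: ui; apply; apply/eqP/val_inj; rewrite /= -ue.
have SE : S = weight i w + \sum_(u < n | u != Ordinal i0) weight u.+1 w.
  rewrite /S /total_weight big_add1 /= big_mkord (bigD1 (Ordinal i0))//=.
  by rewrite prednK.
have : 1 = weight i w / S + \sum_(u < n | u != Ordinal i0) weight u.+1 w / S.
  by rewrite -mulr_suml -mulrDl -SE divff.
lra.
Qed.

End in_degrees.

Section union_bound.
Context {R : realType} {d : measure_display} {T : measurableType d}.
Variable P : probability T R.

Lemma union_bound (A : nat -> set T) (u : nat -> R) n :
  (forall i, measurable (A i)) ->
  (forall i, (i < n)%N -> (P (A i) <= (u i)%:E)%E) ->
  (P (\big[setU/set0]_(i < n) A i) <= (\sum_(i < n) u i)%:E)%E.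
Proof.
move=> mA Au; apply: le_trans (Boole_inequality P (fun i _ => mA i)) _.
by rewrite -sumEFin; apply: lee_sum => i _; exact: Au.
Qed.

End union_bound.

Section concentration.
Context {R : realType} {d : measure_display} {T : measurableType d}.
Variables (P : probability T R) (m : nat).
Variables (weight : nat -> {RV P >-> R}) (target : nat -> 'I_m -> {RV P >-> nat}).
Variable W : {RV P >-> R}.
Hypothesis wrg : weighted_recursive_graph weight target W.
Hypothesis W_ge0 : forall w, 0 <= W w.

Definition centered_degree (theta : R) i n w : R :=
  theta * (indegree target n i w)%:R -
  (expR theta - 1) * (m%:R * weight i w * inv_weight_sum weight i n w).

Lemma history_measurable_sum n k (a b : nat) (h : nat -> T -> R) :
  (forall i, (a <= i < b)%N -> measurable_fun [set: history_type weight target n k] (h i)) ->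
  measurable_fun [set: history_type weight target n k] (fun w => \sum_(a <= i < b) h i w).
Proof.
move=> mh; under eq_fun do rewrite big_nat_cond big_mkcond /=.
apply: measurable_sum => i; rewrite andbT.
case: (boolP (a <= i < b)%N) => [|_]; first exact: mh.
exact: measurable_cst.
Qed.

(** For [k = n.-1] this is the centered in-degree at time [n]; for [k = n] the
    compensator is taken one step ahead, which the history at time [n] already
    determines. *)
Lemma history_centered_degree theta i n k : (1 <= i <= n)%N -> (n <= k.+1)%N ->
  (k <= n)%N ->
  measurable_fun [set: history_type weight target n n] (fun w =>
    theta * (indegree target n i w)%:R -
    (expR theta - 1) * (m%:R * weight i w * inv_weight_sum weight i k.+1 w)).
Proof.
move=> iN nk kn; apply: measurable_funB.
  apply: measurable_funM; first exact: measurable_cst.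
  under eq_fun do rewrite /indegree natr_sum.
  apply: history_measurable_sum => l l2.
  under eq_fun do rewrite natr_sum.
  by apply: measurable_sum => j; exact: history_target.
apply: measurable_funM; first exact: measurable_cst.
apply: measurable_funM.
  by apply: measurable_funM; [exact: measurable_cst|exact: history_weight].
apply: history_measurable_sum => l lk.
apply: (measurableT_comp (@measurable_invr R)).
by apply: history_measurable_sum => j jl; apply: history_weight; lia.
Qed.

Lemma measurable_centered_degree theta i n : (1 <= i <= n)%N ->
  measurable_fun setT (centered_degree theta i n).
Proof.
move=> iN; have n0 : (0 < n)%N by lia.
have := @history_centered_degree theta i n n.-1 iN.
rewrite prednK// => /(_ (leqnn n) (leq_pred n)).
exact: history_measurable_fun.
Qed.

(** The exponential of the centered in-degree is a supermartingale, by
    [laplace_new_edges], and starts from 1 when vertex [i] arrives. *)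
Lemma laplace_centered_degree theta i n : (1 <= i <= n)%N ->
  (\int[P]_w (expR (centered_degree theta i n w))%:E <= 1)%E.
Proof.
elim: n => [|n IH] iN; first by exfalso; lia.
have [->|iSn] := eqVneq i n.+1.
  under eq_integral => w _.
    rewrite /centered_degree (indegree_self wrg) /inv_weight_sum big_geq// !mulr0 subrr expR0.
    over.
  by rewrite integral_cst_probability.
have {}iN : (1 <= i <= n)%N by lia.
apply: le_trans (IH iN).
pose g w := expR (theta * (indegree target n i w)%:R -
  (expR theta - 1) * (m%:R * weight i w * inv_weight_sum weight i n.+1 w)).
have -> : (\int[P]_w (expR (centered_degree theta i n.+1 w))%:E =
  \int[P]_w (g w * expR (theta * (\sum_(j < m) (target n.+1 j w == i))%:R))%:E)%E.
  apply: eq_integral => w _; rewrite /g -expRD; congr (EFin (expR _)).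
  rewrite /centered_degree indegreeS; last by lia.
  by rewrite natrD; ring.
have -> : (\int[P]_w (expR (centered_degree theta i n w))%:E =
  \int[P]_w (g w * expR ((expR theta - 1) *
      (m%:R * weight i w / total_weight weight n w)))%:E)%E.
  apply: eq_integral => w _; rewrite /g -expRD; congr (EFin (expR _)).
  rewrite /centered_degree /inv_weight_sum big_nat_recr/=; last by lia.
  by ring.
apply: (laplace_new_edges wrg W_ge0) => //.
- apply: (measurableT_comp (@measurable_expR R)).
  by apply: history_centered_degree.
- by move=> w; exact: expR_ge0.
Qed.

Lemma centered_degree_tail theta i n x : (1 <= i <= n)%N ->
  (P [set w | (x <= centered_degree theta i n w)%R] <= (expR (- x))%:E)%E.
Proof.
move=> iN.
have -> : [set w | x <= centered_degree theta i n w] =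
          [set w | expR x <= expR (centered_degree theta i n w)].
  by apply/seteqP; split => w /=; rewrite ler_expR.
rewrite expRN -[(_)^-1]mul1r; apply: markov_inequality.
- exact: expR_gt0.
- apply: (measurableT_comp (@measurable_expR R)).
  exact: measurable_centered_degree.
- by move=> w; exact: expR_ge0.
- exact: laplace_centered_degree.
Qed.

Variable v : nat -> R.
Hypothesis v_large : forall A : R, \forall n \near \oo, A * ln n%:R <= v n.

(** As [v] dominates the logarithm, each of the [n] vertices contributes at most
    [n ^ (- 3)] to the union bound. *)
Lemma centered_degree_small theta delta : 0 < delta ->
  eventually_as P (fun n => [set w | forall i, (1 <= i <= n)%N ->
     centered_degree theta i n w < delta * v n]).
Proof.
move=> d0.
pose B n := \big[setU/set0]_(i < n)
  [set w | (i.+1 <= n)%N /\ delta * v n <= centered_degree theta i.+1 n w].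
have mA n i : measurable [set w | (i.+1 <= n)%N /\ delta * v n <= centered_degree theta i.+1 n w].
  have [lt|ge] := boolP (i.+1 <= n)%N.
    rewrite (_ : mkset _ = [set w | delta * v n <= centered_degree theta i.+1 n w]).
      by apply: measurable_ge_fun; exact: measurable_centered_degree.
    by apply/seteqP; split => w /=; [case|move=> h; split].
  by rewrite (_ : mkset _ = set0)//; apply/seteqP; split => w //= [].
apply: (@borel_cantelli_square _ _ _ P _ B 1).
- by move=> n; apply: bigsetU_measurable => i _; exact: mA.
- move=> n w /= nA; apply: contrapT => nB; apply: nA => i iN.
  rewrite ltNge; apply/negP => h; apply: nB.
  have i0 : (i.-1 < n)%N by lia.
  rewrite /B (bigD1 (Ordinal i0))//=; left; split => //.
  by rewrite prednK//; lia.
- near=> n.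
  have n1 : (1 <= n)%N by near: n; exact: nbhs_infty_ge.
  have vn : 3 / delta * ln n%:R <= v n by near: n; exact: v_large.
  have n0 : 0 < n%:R :> R by rewrite ltr0n.
  apply: le_trans (@union_bound _ _ _ P _ (fun=> expR (- (delta * v n))) n (mA n) _) _.
    move=> i iN; apply: le_trans (centered_degree_tail theta _ (i := i.+1) (n := n) _); last by lia.
    by apply: le_measure; rewrite ?inE//; [exact: measurable_ge_fun (measurable_centered_degree _ _)|move=> w []].
  rewrite lee_fin sumr_const card_ord -[_ *+ n]mulr_natr.
  apply: (@le_trans _ _ (expR (- (3 * ln n%:R)) * n%:R)).
    rewrite ler_wpM2r ?ler0n// ler_expR lerN2.
    have := ler_wpM2l (ltW d0) vn.
    rewrite [X in X <= _](_ : _ = 3 * ln n%:R)//.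
    by field; rewrite gt_eqF.
  rewrite expRN mulrC expRM_natl lnK ?posrE//.
  rewrite [X in X <= _](_ : _ = 1 / n%:R ^+ 2)//.
  by field; rewrite gt_eqF.
Unshelve. all: by end_near. Qed.

(** The upper and the lower bound come from small positive and negative values of
    [theta], for which [(exp theta - 1) / theta] is close to 1. *)
Lemma in_degree_concentration delta : 0 < delta -> delta <= 1 ->
  eventually_as P (fun n => [set w | forall i, (1 <= i <= n)%N ->
    (1 - delta) * (m%:R * weight i w * inv_weight_sum weight i n w) - delta * v n
      <= (indegree target n i w)%:R <=
    (1 + delta) * (m%:R * weight i w * inv_weight_sum weight i n w) + delta * v n]).
Proof.
move=> d0 d1.
have d20 : 0 < delta / 2 by rewrite divr_gt0.
have up := centered_degree_small (delta / 2) (mulr_gt0 d20 d0).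
have lo := centered_degree_small (- delta) (mulr_gt0 d0 d0).
have W0 : eventually_as P (fun n => [set w | forall i, (1 <= i)%N -> 0 <= weight i w]).
  by apply: filterS (ae_weight_ge0 (weight_law wrg) W_ge0) => w Ww; exact: nearW.
apply: (modeS (eventually_as_mode P) _ (modeI (eventually_as_mode P) W0
  (modeI (eventually_as_mode P) up lo))).
apply: nearW => n w /= [Ww [Uw Lw]] i iN.
have {}Uw := Uw i iN; have {}Lw := Lw i iN.
set Z := (indegree target n i w)%:R.
set H := m%:R * weight i w * inv_weight_sum weight i n w.
have H0 : 0 <= H.
  rewrite /H !mulr_ge0 ?Ww//; first by lia.
  rewrite /inv_weight_sum sumr_ge0// => k _; rewrite invr_ge0.
  by rewrite /total_weight big_nat sumr_ge0// => j /andP[j1 _]; exact: Ww.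
move: Uw Lw; rewrite /centered_degree -/Z -/H; set x := v n => Uw Lw.
apply/andP; split.
  (* exp (- delta) <= 1 / (1 + delta) *)
  have e1 : expR (- delta) * (1 + delta) <= 1.
    rewrite -[leRHS](expRxMexpNx_1 delta) mulrC ler_wpM2r ?expR_ge0//.
    exact: expR_ge1Dx.
  have e2 : (1 - delta) * delta <= 1 - expR (- delta).
    rewrite -(ler_pM2r (_ : 0 < 1 + delta)); last by lra.
    apply: (@le_trans _ _ delta); last by lra.
    have := mulr_ge0 (ltW d0) (sqr_ge0 delta); nra.
  have := ler_wpM2r H0 e2.
  rewrite -(ler_pM2l d0) => ?; nra.
have e1 : expR (delta / 2) * (1 - delta / 2) <= 1.
  rewrite -[leRHS](expRxMexpNx_1 (delta / 2)) ler_wpM2l ?expR_ge0//.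
  exact: expR_ge1Dx.
have e2 : expR (delta / 2) - 1 <= (1 + delta) * (delta / 2).
  rewrite -(ler_pM2r (_ : 0 < 1 - delta / 2)); last by lra.
  apply: (@le_trans _ _ (delta / 2)); first by lra.
  nra.
have := ler_wpM2r H0 e2.
rewrite -(ler_pM2l d20) => ?; nra.
Qed.

End concentration.

(** * From weights to in-degrees *)

Section deterministic.
Context {R : realType}.

Lemma ln_succ_bounds (n : nat) : (1 <= n)%N ->
  (n%:R + 1)^-1 <= ln (n%:R + 1) - ln (n%:R : R) <= n%:R^-1.
Proof.
move=> n1; have n0 : 0 < n%:R :> R by rewrite ltr0n.
have n10 : 0 < n%:R + 1 :> R by rewrite ltr_wpDr.
rewrite -ln_div ?posrE//; apply/andP; split.
  rewrite -[leRHS]opprK lerNr -lnV ?posrE ?divr_gt0// invf_div.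
  have -> : n%:R / (n%:R + 1) = 1 + - (n%:R + 1)^-1 :> R by field; rewrite gt_eqF.
  apply: le_ln1Dx; rewrite ltrN2 invf_lt1// ltrDr//.
have -> : (n%:R + 1) / n%:R = 1 + n%:R^-1 :> R by field; rewrite gt_eqF.
by apply: le_ln1Dx; rewrite (lt_trans (ltrN10 _))// invr_gt0.
Qed.

(** Sums of [1 / S k] behave like logarithms when [S k] is asymptotic to [k]. The
    induction runs along potentials in which the finitely many initial terms
    enter through [minn n K]. *)
Lemma sum_inv_log_bounds (S : nat -> R) (delta : R) : 0 < delta -> delta <= 1 ->
  (forall n, 0 <= S n) ->
  (forall e : R, 0 < e -> \forall n \near \oo, `|S n - n%:R| <= e * n%:R) ->
  exists C, forall i n, (1 <= i <= n)%N ->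
    (1 - delta) * ln (n%:R / i%:R) - C <= \sum_(i <= k < n) (S k)^-1
      <= (1 + delta) * ln (n%:R / i%:R) + C.
Proof.
move=> d0 d1 S0 HS.
have [K _ HK] := HS (delta / 2) (divr_gt0 d0 (ltr0Sn _ 1)).
pose A n : R := \sum_(0 <= k < minn n K) (S k)^-1.
pose B n : R := ln (minn n (maxn K 1))%:R.
have A0 n : 0 <= A n by apply: sumr_ge0 => k _; rewrite invr_ge0.
have AK n : A n <= \sum_(0 <= k < K) (S k)^-1.
  rewrite /A [leRHS](big_cat_nat _ (n := minn n K)) ?geq_minr//=.
  by rewrite lerDl sumr_ge0// => k _; rewrite invr_ge0.
have B0 n : (1 <= n)%N -> 0 <= B n.
  by move=> n1; rewrite ln_ge0// ler1n leq_min n1 leq_max orbT.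
have BK n : (1 <= n)%N -> B n <= ln (maxn K 1)%:R.
  move=> n1; rewrite /B ler_ln ?posrE ?ltr0n ?ler_nat ?geq_minr ?leq_max ?orbT//.
  by rewrite leq_min n1 leq_max orbT.
have up i n : (1 <= i <= n)%N -> \sum_(i <= k < n) (S k)^-1 <=
    (1 + delta) * (ln n%:R - n%:R^-1 - (ln i%:R - i%:R^-1)) + A n - A i.
  move=> /andP[i1]; elim: n => [|n IH]; first by rewrite leqn0 => /eqP i0; rewrite i0 in i1.
  rewrite leq_eqVlt => /predU1P[<-|]; first by rewrite big_geq// subrr mulr0 add0r subrr.
  rewrite ltnS => iN; rewrite big_nat_recr//=.
  have n1 := leq_trans i1 iN.
  have n0 : 0 < n%:R :> R by rewrite ltr0n.
  have /andP[l1 l2] := ln_succ_bounds n1.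
  have {}IH := IH iN.
  suff : (S n)^-1 <= (1 + delta) * (ln (n%:R + 1) - ln n%:R - (n%:R + 1)^-1 + n%:R^-1)
                     + A n.+1 - A n.
    by rewrite -natr1; move: IH; nra.
  have nn : (n%:R + 1)^-1 <= n%:R^-1 :> R by rewrite lef_pV2 ?posrE ?lerDl// ltr_wpDr.
  have [nK|Kn] := ltnP n K.
    rewrite /A (minn_idPl nK) (minn_idPl (ltnW nK)) big_nat_recr//=.
    have : 0 <= (1 + delta) * (ln (n%:R + 1) - ln n%:R - (n%:R + 1)^-1 + n%:R^-1).
      have ni : 0 <= n%:R^-1 :> R by rewrite invr_ge0.
      by rewrite mulr_ge0//; lra.
    lra.
  rewrite /A (minn_idPr Kn) (minn_idPr (leqW Kn)) addrK.
  have /ler_normlP[Sn _] := HK n Kn.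
  have Sn' : (1 - delta / 2) * n%:R <= S n by lra.
  have d2 : 0 < 1 - delta / 2 by lra.
  apply: (@le_trans _ _ (((1 - delta / 2) * n%:R)^-1)).
    by rewrite lef_pV2 ?posrE ?mulr_gt0// (lt_le_trans _ Sn')// mulr_gt0.
  rewrite invfM; apply: (@le_trans _ _ ((1 + delta) * n%:R^-1)).
    rewrite ler_wpM2r ?invr_ge0 ?ler0n// -div1r ler_pdivrMr//; nra.
  by rewrite ler_wpM2l//; lra.
have lo i n : (1 <= i <= n)%N ->
    (1 - delta) * (ln n%:R - ln i%:R) - (B n - B i) <= \sum_(i <= k < n) (S k)^-1.
  move=> /andP[i1]; elim: n => [|n IH]; first by rewrite leqn0 => /eqP i0; rewrite i0 in i1.
  rewrite leq_eqVlt => /predU1P[<-|]; first by rewrite big_geq// !subrr mulr0 subr0.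
  rewrite ltnS => iN; rewrite big_nat_recr//=.
  have n1 := leq_trans i1 iN.
  have n0 : 0 < n%:R :> R by rewrite ltr0n.
  have /andP[l1 l2] := ln_succ_bounds n1.
  have l0 : 0 <= ln (n%:R + 1) - ln n%:R :> R.
    by apply: le_trans l1; rewrite invr_ge0 addr_ge0.
  have {}IH := IH iN.
  suff : (1 - delta) * (ln (n%:R + 1) - ln n%:R) - (B n.+1 - B n) <= (S n)^-1.
    by rewrite -natr1; move: IH; nra.
  have Si : 0 <= (S n)^-1 by rewrite invr_ge0.
  have [nK|Kn] := ltnP n (maxn K 1).
    rewrite /B (minn_idPl nK) (minn_idPl (ltnW nK)) -natr1; nra.
  rewrite /B (minn_idPr Kn) (minn_idPr (leqW Kn)) subrr subr0.
  have Kn' : (K <= n)%N by rewrite (leq_trans _ Kn)// leq_max leqnn.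
  have /ler_normlP[Sn' Sn] := HK n Kn'.
  have Spos : 0 < S n by have := mulr_gt0 d0 n0; nra.
  apply: (@le_trans _ _ ((1 - delta) * n%:R^-1)).
    by rewrite ler_wpM2l//; lra.
  rewrite -[leRHS]div1r ler_pdivlMr// mulrAC ler_pdivrMr// mul1r.
  have := mulr_ge0 (ltW d0) (ltW n0); nra.
exists (2 + \sum_(0 <= k < K) (S k)^-1 + ln (maxn K 1)%:R) => i n iN.
have /andP[i1 iN'] := iN.
have i0 : 0 < i%:R :> R by rewrite ltr0n.
have n1 := leq_trans i1 iN'.
have n0 : 0 < n%:R :> R by rewrite ltr0n.
rewrite ln_div ?posrE//.
have := up i n iN; have := lo i n iN.
have := A0 i; have := AK n; have := B0 i i1; have := BK n n1.
have := B0 n n1; have := A0 n.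
have : 0 <= n%:R^-1 :> R by rewrite invr_ge0.
have : i%:R^-1 <= 1 :> R by rewrite invf_le1// ler1n.
set s := \sum_(i <= k < n) _; set a := \sum_(0 <= k < K) _.
set x := n%:R^-1; set y := i%:R^-1 => *.
have : delta * (y - x) <= 1 by nra.
by move=> ?; apply/andP; split; nra.
Qed.

Lemma max_upto_ge n (F : nat -> R) i : (1 <= i <= n)%N -> F i <= max_upto n F.
Proof.
move=> iN; rewrite /max_upto; apply: le_bigmax_seq => //.
by rewrite mem_index_iota ltnS.
Qed.

Lemma max_upto_attained n (F : nat -> R) : (1 <= n)%N ->
  exists2 i, (1 <= i <= n)%N & max_upto n F = F i.
Proof.
move=> n1; rewrite /max_upto big_nat.
elim/big_ind : _ => [|x y [i iN ->] [j jN ->]|i /andP[i1 iN]].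
- by exists 1%N => //; rewrite n1.
- by rewrite maxEle; case: ifP => _; [exists j|exists i].
- by exists i => //; rewrite i1 -ltnS.
Qed.

Lemma first_argmax (n : nat) (Z : nat -> nat) : (1 <= n)%N ->
  let I := head 0%N [seq i <- iota 1 n | all (fun j => (Z j <= Z i)%N) (iota 1 n)] in
  (1 <= I <= n)%N /\ forall j, (1 <= j <= n)%N -> (Z j <= Z I)%N.
Proof.
move=> n1 I; pose s := [seq i <- iota 1 n | all (fun j => (Z j <= Z i)%N) (iota 1 n)].
have inE' j : (j \in iota 1 n) = (1 <= j <= n)%N by rewrite mem_iota add1n ltnS.
have Is : I \in s.
  rewrite /I -/s; suff : has (fun i => all (fun j => (Z j <= Z i)%N) (iota 1 n)) (iota 1 n).
    by rewrite has_filter -/s; case: (s) => //= a l _; rewrite mem_head.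
  pose f (i : 'I_n) := Z i.+1.
  have i0 : 'I_n by exact: (Ordinal n1).
  case: (arg_maxnP (P := xpredT) f (i0 := i0)) => // i _ fi.
  apply/hasP; exists i.+1; first by rewrite inE' /= ltn_ord.
  apply/allP => j; rewrite inE' => /andP[j1 jn].
  have jn' : (j.-1 < n)%N by rewrite prednK.
  by have := fi (Ordinal jn') isT; rewrite /f /= prednK.
move: Is; rewrite mem_filter => /andP[/allP h]; rewrite inE' => In; split => //.
by move=> j; rewrite -inE' => /h.
Qed.

(** An index where [X] is nearly maximal has a larger [Z] than all indices at a
    wrong logarithmic scale, because the errors are small compared to the gap
    [eta]. *)
Lemma argmax_transfer (n : nat) (Z : nat -> nat) (X : nat -> R)
    (M v D kappa eps eta delta : R) :
  (1 <= n)%N -> 0 < M -> 0 < v -> 0 < delta -> 10 * delta <= eps ->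
  10 * delta <= eta -> 10 * delta <= 1 ->
  (forall i, (1 <= i <= n)%N -> (1 - delta) * (M * X i) - delta * (M * v)
     <= (Z i)%:R <= (1 + delta) * (M * X i) + delta * (M * v)) ->
  (forall i, (1 <= i <= n)%N -> X i <= (1 + delta) * v) ->
  (exists2 i, (1 <= i <= n)%N & (1 - delta) * v <= X i) ->
  (forall i, (1 <= i <= n)%N -> eps <= `|ln i%:R / ln n%:R - kappa| ->
     X i <= (1 - eta) * v) ->
  `|M * v / D - 1| <= delta ->
  let I := head 0%N [seq i <- iota 1 n | all (fun j => (Z j <= Z i)%N) (iota 1 n)] in
  `|max_upto n (fun i => (Z i)%:R / D) - 1| <= eps /\
  `|ln I%:R / ln n%:R - kappa| <= eps.
Proof.
move=> n1 M0 v0 d0 de dh d1 HZ Hb [i0 i0N Hc] Hd HD I.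
have [IN Imax] := first_argmax Z n1.
have Mv0 : 0 < M * v by exact: mulr_gt0.
have lo : ((1 - delta) * (1 - delta) - delta) * (M * v) <= (Z i0)%:R.
  have /andP[h _] := HZ i0 i0N; apply: le_trans h.
  have : (1 - delta) * M * ((1 - delta) * v) <= (1 - delta) * M * X i0.
    by rewrite ler_wpM2l// mulr_ge0//; lra.
  lra.
have hi i : (1 <= i <= n)%N ->
    (Z i)%:R <= ((1 + delta) * (1 + delta) + delta) * (M * v).
  move=> iN; have /andP[_ h] := HZ i iN; apply: le_trans h _.
  have : (1 + delta) * M * X i <= (1 + delta) * M * ((1 + delta) * v).
    by rewrite ler_wpM2l ?Hb// mulr_ge0//; lra.
  lra.
have Dr : 1 - delta <= M * v / D <= 1 + delta.
  by move: HD; rewrite ler_norml => /andP[? ?]; lra.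
have Di0 : 0 < D^-1.
  rewrite -(pmulr_rgt0 _ Mv0); have /andP[h _] := Dr; apply: lt_le_trans h; lra.
have [/andP[r1 r2]] := (Dr, isT).
split.
  rewrite ler_norml; apply/andP; split.
    rewrite lerBrDl; apply: le_trans (max_upto_ge (fun i => (Z i)%:R / D) i0N).
    apply: (@le_trans _ _ (((1 - delta) * (1 - delta) - delta) * (M * v) / D)).
      rewrite -mulrA; apply: (@le_trans _ _ (((1 - delta) * (1 - delta) - delta) * (1 - delta))).
        nra.
      by rewrite ler_wpM2l//; nra.
    by rewrite ler_wpM2r// ltW.
  have [j jN ->] := max_upto_attained (fun i => (Z i)%:R / D) n1.
  rewrite lerBlDl.
  apply: (@le_trans _ _ (((1 + delta) * (1 + delta) + delta) * (M * v) / D)).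
    by rewrite ler_wpM2r ?hi// ltW.
  rewrite -mulrA; apply: (@le_trans _ _ (((1 + delta) * (1 + delta) + delta) * (1 + delta))).
    by rewrite ler_wpM2l//; nra.
  nra.
rewrite leNgt; apply/negP => /ltW far.
have eta0 : 0 < eta by clear -dh d0; lra.
have XI := Hd I IN far.
have ZI : (Z i0)%:R <= (Z I)%:R :> R by rewrite ler_nat; exact: Imax.
have /andP[_ h] := HZ I IN.
have : (1 + delta) * M * X I <= (1 + delta) * M * ((1 - eta) * v).
  by rewrite ler_wpM2l// mulr_ge0 ?addr_ge0 ?(ltW d0) ?(ltW M0).
have : 0 < (eta - 5 * delta) * (M * v).
  by rewrite mulr_gt0//; clear -dh d0; lra.
have : 0 <= delta * eta * (M * v) by rewrite !mulr_ge0 ?(ltW d0) ?(ltW eta0) ?(ltW M0) ?(ltW v0).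
have : 0 <= delta * delta * (M * v) by rewrite !mulr_ge0 ?(ltW d0) ?(ltW M0) ?(ltW v0).
move=> s1 s2 s3 s4; clear -s1 s2 s3 s4 lo ZI h; lra.
Qed.

End deterministic.

Lemma measurable_indegree {R : realType} {d : measure_display}
    {T : measurableType d} (P : probability T R) (m : nat)
    (target : nat -> 'I_m -> {RV P >-> nat}) n i :
  measurable_fun setT (fun w => (indegree target n i w)%:R : R).
Proof.
under eq_fun do rewrite /indegree natr_sum.
apply: measurable_sum => k; under eq_fun do rewrite natr_sum.
apply: measurable_sum => j.
rewrite (_ : (fun _ => _) = \1_(target k j @^-1` [set i])).
  by apply: measurable_indic; rewrite -[X in measurable X]setTI; exact: measurable_funP.
apply/funext => w; rewrite indicE.
suff -> : (w \in target k j @^-1` [set i]) = (target k j w == i) by [].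
by apply/idP/idP; rewrite inE => /eqP.
Qed.

Section reduction.
Context {R : realType} {d : measure_display} {T : measurableType d}.
Variables (P : probability T R) (m : nat).
Variables (weight : nat -> {RV P >-> R}) (target : nat -> 'I_m -> {RV P >-> nat}).
Variable W : {RV P >-> R}.
Hypothesis m_ge1 : (1 <= m)%N.
Hypothesis wrg : weighted_recursive_graph weight target W.
Hypothesis W_ge0 : forall w, 0 <= W w.
Hypothesis total_weight_law : {ae P, forall w, forall e : R, 0 < e ->
  \forall n \near \oo, `|total_weight weight n w - n%:R| <= e * n%:R}.

(** When the total weight grows like [n], the compensator of the in-degree of
    vertex [i] is about [m * degree_score n i]. *)
Definition degree_score (n i : nat) (w : T) : R :=
  weight i w * ln (n%:R / i%:R).

Variables (v w_ : nat -> R).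
Hypothesis v_large : forall A : R, \forall n \near \oo, A * ln n%:R <= v n.
Hypothesis w_small : forall e : R, 0 < e -> \forall n \near \oo, w_ n <= e * v n.

(** The random constants in the harmonic sums are absorbed by [v] because the
    weights are of smaller order. *)
Lemma in_degree_score delta : 0 < delta -> delta <= 1 ->
  eventually_as P (fun n => [set w | forall i, (1 <= i <= n)%N ->
    weight i w <= w_ n ->
    (1 - delta) * (m%:R * degree_score n i w) - delta * (m%:R * v n)
      <= (indegree target n i w)%:R <=
    (1 + delta) * (m%:R * degree_score n i w) + delta * (m%:R * v n)]).
Proof.
move=> d0 d1.
have m1 : 1 <= m%:R :> R by rewrite ler1n.
pose e := delta / 8.
have e0 : 0 < e by rewrite /e divr_gt0.
have e1 : e <= 1 by rewrite /e; lra.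
have conc := in_degree_concentration wrg W_ge0 v_large e0 e1.
near=> w.
have W0 : forall i, (1 <= i)%N -> 0 <= weight i w.
  by near: w; exact: (ae_weight_ge0 (weight_law wrg) W_ge0).
have S0 n : 0 <= total_weight weight n w.
  by rewrite /total_weight big_nat sumr_ge0// => j /andP[j1 _]; exact: W0.
have HS : forall e : R, 0 < e ->
    \forall n \near \oo, `|total_weight weight n w - n%:R| <= e * n%:R.
  by near: w.
have [C HC] := sum_inv_log_bounds e0 e1 S0 HS.
have cw : \forall n \near \oo, forall i, (1 <= i <= n)%N ->
    (1 - e) * (m%:R * weight i w * inv_weight_sum weight i n w) - e * v n
      <= (indegree target n i w)%:R <=
    (1 + e) * (m%:R * weight i w * inv_weight_sum weight i n w) + e * v n.
  by near: w.
have C1 : 0 < `|C| + 1 by rewrite ltr_pwDr.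
near=> n => i iN wi.
have v0 : 0 <= v n.
  have n1 : (1 <= n)%N by near: n; exact: nbhs_infty_ge.
  have : 1 * ln n%:R <= v n by near: n; exact: v_large.
  by apply: le_trans; rewrite mul1r ln_ge0// ler1n.
have wv : w_ n <= e / (`|C| + 1) * v n.
  by near: n; apply: w_small; rewrite divr_gt0.
have /(_ i iN)/andP[lo hi] : forall i, (1 <= i <= n)%N ->
    (1 - e) * (m%:R * weight i w * inv_weight_sum weight i n w) - e * v n
      <= (indegree target n i w)%:R <=
    (1 + e) * (m%:R * weight i w * inv_weight_sum weight i n w) + e * v n.
  by near: n.
have /andP[Hlo Hhi] := HC i n iN.
have /andP[i1 iN'] := iN.
have Wi0 := W0 i i1.
have CW : C * weight i w <= e * v n.
  apply: (@le_trans _ _ ((`|C| + 1) * w_ n)).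
    apply: (@le_trans _ _ ((`|C| + 1) * weight i w)).
      by rewrite ler_wpM2r// (le_trans (ler_norm C))// lerDl.
    by rewrite ler_wpM2l// ltW.
  have := ler_wpM2l (ltW C1) wv.
  by rewrite [X in _ <= X -> _](_ : _ = e * v n)//; field; rewrite gt_eqF.
move: lo hi; rewrite /degree_score; set L := ln _ in Hlo Hhi *.
set H := inv_weight_sum _ _ _ _ in Hlo Hhi *.
set Z := (indegree _ _ _ _)%:R; set x := weight i w in Wi0 CW *.
have L0 : 0 <= L.
  rewrite /L ln_ge0// ler_pdivlMr ?ltr0n// mul1r ler_nat//.
have hi' : x * H <= x * ((1 + e) * L + C) by rewrite ler_wpM2l.
have lo' : x * ((1 - e) * L - C) <= x * H by rewrite ler_wpM2l.
have xL : 0 <= x * L by rewrite mulr_ge0.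
have mp : 0 < m%:R :> R by apply: lt_le_trans m1.
have vm : v n <= m%:R * v n by rewrite ler_peMl.
have d8 : delta = 8 * e by rewrite /e; field.
have eL : 0 <= e * (x * L) by rewrite mulr_ge0// ltW.
have ev : 0 <= e * v n by rewrite mulr_ge0// ltW.
have eeL : e * (e * (x * L)) <= e * (x * L) by rewrite ler_piMl.
have eev : e * (e * v n) <= e * v n by rewrite ler_piMl.
move=> lo hi; rewrite d8; apply/andP; split.
  apply: le_trans lo.
  have h1 : (1 - 8 * e) * (x * L) - 7 * (e * v n) <= (1 - e) * (x * H).
    apply: (@le_trans _ _ ((1 - e) * (x * ((1 - e) * L - C)))); last first.
      by rewrite ler_wpM2l// subr_ge0.
    have : (1 - e) * (C * x) <= (1 - e) * (e * v n) by rewrite ler_wpM2l// subr_ge0.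
    have : 0 <= e * (e * (x * L)) by rewrite mulr_ge0// ltW.
    have : 0 <= e * (e * v n) by rewrite mulr_ge0// ltW.
    move=> p1 p2 p3; clear -p1 p2 p3 eL ev; lra.
  have p1 := ler_wpM2l (ltW mp) h1; have p2 := ler_wpM2l (ltW e0) vm.
  clear -p1 p2; lra.
apply: le_trans hi _.
have h1 : (1 + e) * (x * H) <= (1 + 8 * e) * (x * L) + 7 * (e * v n).
  apply: (@le_trans _ _ ((1 + e) * (x * ((1 + e) * L + C)))).
    by rewrite ler_wpM2l// addr_ge0// ltW.
  have p1 : (1 + e) * (C * x) <= (1 + e) * (e * v n) by rewrite ler_wpM2l// addr_ge0// ltW.
  clear -p1 eL ev eeL eev; lra.
have p1 := ler_wpM2l (ltW mp) h1; have p2 := ler_wpM2l (ltW e0) vm.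
clear -p1 p2; lra.
Unshelve. all: by end_near. Qed.

Lemma measurable_in_degree_score delta n :
  measurable [set w | forall i, (1 <= i <= n)%N ->
    weight i w <= w_ n ->
    (1 - delta) * (m%:R * degree_score n i w) - delta * (m%:R * v n)
      <= (indegree target n i w)%:R <=
    (1 + delta) * (m%:R * degree_score n i w) + delta * (m%:R * v n)].
Proof.
have mZ := @measurable_indegree _ _ _ P m target n.
have mX i : measurable_fun setT (degree_score n i).
  by apply: measurable_funM => //; exact: measurable_cst.
rewrite (_ : mkset _ = \bigcap_i [set w | (1 <= i <= n)%N ->
    weight i w <= w_ n ->
    (1 - delta) * (m%:R * degree_score n i w) - delta * (m%:R * v n)
      <= (indegree target n i w)%:R <=
    (1 + delta) * (m%:R * degree_score n i w) + delta * (m%:R * v n)]); last first.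
  by apply/seteqP; split => w /= h i; [move=> _|]; exact: h.
apply: bigcapT_measurable => i.
have [iN|niN] := boolP (1 <= i <= n)%N; last first.
  by rewrite (_ : mkset _ = setT)//; apply/seteqP; split => w.
rewrite (_ : mkset _ = [set w | w_ n < weight i w] `|`
  ([set w | (1 - delta) * (m%:R * degree_score n i w) - delta * (m%:R * v n)
     <= (indegree target n i w)%:R] `&`
   [set w | (indegree target n i w)%:R <=
    (1 + delta) * (m%:R * degree_score n i w) + delta * (m%:R * v n)])); last first.
  apply/seteqP; split => w /=.
    move=> h; have [wi|] := leP (weight i w) (w_ n); last by left.
    by right; apply/andP/h.
  by move=> [h _|[h1 h2] _ _]; [rewrite leNgt h|rewrite h1 h2].
apply: measurableU; first exact: measurable_gt_fun.
apply: measurableI.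
  rewrite (_ : mkset _ = [set w | 0 <= (indegree target n i w)%:R -
    ((1 - delta) * (m%:R * degree_score n i w) - delta * (m%:R * v n))]).
    apply: measurable_ge_fun; apply: measurable_funB => //.
    apply: measurable_funB; last exact: measurable_cst.
    by do 2?apply: measurable_funM => //; exact: measurable_cst.
  by apply/seteqP; split => w /=; rewrite subr_ge0.
rewrite (_ : mkset _ = [set w | 0 <=
    (1 + delta) * (m%:R * degree_score n i w) + delta * (m%:R * v n)
     - (indegree target n i w)%:R]).
  apply: measurable_ge_fun; apply: measurable_funB => //.
  apply: measurable_funD; last exact: measurable_cst.
  by do 2?apply: measurable_funM => //; exact: measurable_cst.
by apply/seteqP; split => w /=; rewrite subr_ge0.
Qed.

Variables (E : (nat -> set T) -> Prop) (D : nat -> R) (kappa : R).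
Hypothesis modeE : event_mode E.
Hypothesis E_as : forall A, (forall n, measurable (A n)) -> eventually_as P A -> E A.
Hypothesis v_gt0 : \forall n \near \oo, 0 < v n.
Hypothesis norm_equiv : forall e : R, 0 < e -> \forall n \near \oo, `|m%:R * v n / D n - 1| <= e.
Hypothesis weight_bound : E (fun n => [set w | forall i, (1 <= i <= n)%N -> weight i w <= w_ n]).
Hypothesis score_le : forall e : R, 0 < e -> E (fun n => [set w | forall i, (1 <= i <= n)%N ->
  degree_score n i w <= (1 + e) * v n]).
Hypothesis score_ge : forall e : R, 0 < e -> E (fun n => [set w | exists2 i, (1 <= i <= n)%N &
  (1 - e) * v n <= degree_score n i w]).
Hypothesis score_far : forall e : R, 0 < e -> exists2 eta : R, 0 < eta &
  E (fun n => [set w | forall i, (1 <= i <= n)%N ->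
    e <= `|ln i%:R / ln n%:R - kappa| -> degree_score n i w <= (1 - eta) * v n]).

(** The common reduction of the three cases to the independent scores. Each case
    supplies its own scale [v], bound [w_] on the weights and exponent [kappa]. *)
Theorem argmax_in_degree (e : R) : 0 < e ->
  E (fun n => [set w |
    `|max_upto n (fun i => (indegree target n i w)%:R / D n) - 1| <= e /\
    `|ln (max_degree_label target n w)%:R / ln n%:R - kappa| <= e]).
Proof.
move=> e0; have [eta eta0 far] := score_far e0.
pose delta := Num.min (Num.min e eta) 1 / 10.
have d0 : 0 < delta by rewrite divr_gt0// !lt_min e0 eta0 ltr01.
have [de dh d1] : [/\ 10 * delta <= e, 10 * delta <= eta & 10 * delta <= 1].
  by rewrite /delta mulrC divfK//; split; rewrite ?ge_min ?lexx ?orbT.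
have d1' : delta <= 1 by lra.
have app := E_as (measurable_in_degree_score delta) (in_degree_score d0 d1').
apply: (modeS modeE _ (modeI modeE app (modeI modeE weight_bound
  (modeI modeE (score_le d0) (modeI modeE (score_ge d0) far))))).
near=> n => w /= [A [B [C [G F]]]].
apply: (@argmax_transfer _ n (fun i => indegree target n i w)
  (fun i => degree_score n i w) m%:R (v n) (D n) kappa e eta delta) => //.
- by near: n; exact: nbhs_infty_ge.
- by rewrite ltr0n.
- by near: n.
- by move=> i iN; apply: A => //; exact: B.
- by near: n; exact: norm_equiv.
Unshelve. all: by end_near. Qed.

End reduction.

Section conclusion.
Context {R : realType} {d : measure_display} {T : measurableType d}.
Variables (P : probability T R) (m : nat).
Variables (target : nat -> 'I_m -> {RV P >-> nat}) (D : nat -> R) (kappa : R).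

Let good e n : set T := [set w |
    `|max_upto n (fun i => (indegree target n i w)%:R / D n) - 1| <= e /\
    `|ln (max_degree_label target n w)%:R / ln n%:R - kappa| <= e].

Let pair n w : R * R := (max_upto n (fun i => (indegree target n i w)%:R / D n),
  ln (max_degree_label target n w)%:R / ln n%:R).

Lemma pair_normE e n w : (`|pair n w - (1, kappa)| <= e) <-> good e n w.
Proof.
by rewrite prod_normE /= ge_max /good /=; split => [/andP//|[-> ->]].
Qed.

(** The vector of in-degrees takes countably many values, so the events that it
    determines are countable unions of its level sets. *)
Lemma measurable_in_degree_vector (n : nat) (A : set T) :
  (forall w w', (forall i, (1 <= i <= n)%N -> indegree target n i w = indegree target n i w') ->
     A w -> A w') -> measurable A.
Proof.
move=> sat.
have mZ i (z : nat) : measurable [set w | indegree target n i w = z].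
  have mf := @measurable_indegree _ _ _ P m target n i.
  rewrite (_ : mkset _ = (fun w => (indegree target n i w)%:R : R) @^-1` [set z%:R]).
    by rewrite -[X in measurable X]setTI; apply: mf.
  apply/seteqP; split => w /=; first by move=> ->.
  by move=> /eqP; rewrite eqr_nat => /eqP.
pose F (s : seq nat) : set T :=
  (if `[< exists2 w, A w & forall i, (1 <= i <= n)%N -> indegree target n i w = nth 0%N s i >]
   then [set w | forall i, (1 <= i <= n)%N -> indegree target n i w = nth 0%N s i] else set0).
rewrite (_ : A = \bigcup_s F s).
  apply: countable_bigcupT_measurable => [|s]; first exact: countableP.
  rewrite /F; case: ifP => // _.
  rewrite (_ : mkset _ = \bigcap_(i in [set i | (1 <= i <= n)%N])
    [set w | indegree target n i w = nth 0%N s i])//.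
  by apply: bigcap_measurableType => i _.
apply/seteqP; split => w /=.
  move=> Aw; pose s := mkseq (fun i => indegree target n i w) n.+1.
  have sE i : (1 <= i <= n)%N -> indegree target n i w = nth 0%N s i.
    by move=> /andP[_ iN]; rewrite nth_mkseq.
  exists s => //; rewrite /F; case: ifPn => //= /asboolP; apply.
  by exists w.
move=> [s _]; rewrite /F; case: ifPn => //= /asboolP[w' Aw' w's] ws.
by apply: sat Aw' => i iN; rewrite w's// ws.
Qed.

Lemma measurable_good e n : measurable (good e n).
Proof.
apply: (@measurable_in_degree_vector n) => w w' Zww'.
suff -> : good e n w = good e n w' by [].
rewrite /good /=.
have -> : max_upto n (fun i => (indegree target n i w)%:R / D n) =
          max_upto n (fun i => (indegree target n i w')%:R / D n) :> R.
  case: n Zww' => [|n] Zww'.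
    by rewrite /max_upto !big_geq// /indegree !big_geq.
  rewrite /max_upto (Zww' 1%N)//; apply: eq_big_nat => i iN.
  by rewrite Zww'.
suff -> : max_degree_label target n w = max_degree_label target n w' by [].
rewrite /max_degree_label; congr head; apply: eq_in_filter => i.
rewrite mem_iota add1n ltnS => iN; apply: eq_in_all => j.
by rewrite mem_iota add1n ltnS => jN; rewrite !Zww'.
Qed.

Lemma with_high_prob_cvg : (forall e, 0 < e -> with_high_prob P (good e)) ->
  cvg_in_probability P pair (1, kappa).
Proof.
move=> H e e0; have /with_high_probP := H e e0.
move=> /(_ (measurable_good e)); apply: cvg_trans.
apply: near_eq_cvg; apply: nearW => n; congr (P _).
apply/seteqP; split => w /=.
  by move=> nb; rewrite ltNge; apply/negP => /pair_normE.
by rewrite ltNge => /negP nb g; apply: nb; exact/pair_normE.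
Qed.

Lemma eventually_as_cvg : (forall e, 0 < e -> eventually_as P (good e)) ->
  cvg_almost_surely P pair (1, kappa).
Proof.
move=> H.
have /ae_foralln := fun q : nat => H q.+1%:R^-1 ltac:(by rewrite invr_gt0).
apply: filterS => w Hw; apply/cvgrPdist_le => e e0.
have [q _ /(_ q (leqnn q)) qe] := nbhs_infty_ger (e^-1).
apply: filterS (Hw q) => n /pair_normE h; rewrite distrC (le_trans h)//.
rewrite -[leRHS]invrK lef_pV2 ?posrE ?invr_gt0//.
by rewrite (le_trans qe)// ler_nat.
Qed.

End conclusion.

(** * Extremes of independent weights *)

Section iid.
Context {R : realType} {d : measure_display} {T : measurableType d}.
Variables (P : probability T R).
Implicit Types A B : nat -> set T.

Lemma with_high_prob_eps A B : (forall n, measurable (B n)) ->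
  (forall n, ~` A n `<=` B n) ->
  (forall e : R, 0 < e -> \forall n \near \oo, (P (B n) <= e%:E)%E) ->
  with_high_prob P A.
Proof.
move=> mB AB PB; exists B; split => //.
apply/fine_cvgP; split.
  by apply: nearW => n; exact: fin_num_measure.
apply/cvgrPdist_le => e e0; apply: filterS (PB e e0) => n /= PBn.
rewrite sub0r normrN ger0_norm ?fine_ge0//.
by rewrite -lee_fin fineK//; exact: fin_num_measure.
Qed.

Lemma with_high_prob_comp A (N : nat -> nat) : N n @[n --> \oo] --> \oo ->
  with_high_prob P A -> with_high_prob P (A \o N).
Proof.
move=> Noo [B [mB AB B0]]; exists (B \o N).
split=> [n|n|]; [exact: mB|exact: AB|exact: (cvg_comp _ _ Noo B0)].
Qed.

Variables (weight : nat -> {RV P >-> R}) (W : {RV P >-> R}).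
Hypothesis law : forall i, (1 <= i)%N -> equal_in_law (weight i) W.
Hypothesis indep : mutually_independent [set i | (1 <= i)%N] weight.

Definition law_of (B : set R) : R := fine (P (W @^-1` B)).

Lemma preimage_measurable (X : {RV P >-> R}) (B : set R) : measurable B ->
  measurable (X @^-1` B).
Proof. by move=> mB; rewrite -[Y in measurable Y]setTI; exact: measurable_funP. Qed.

Lemma law_ofE (B : set R) : measurable B -> (law_of B)%:E = P (W @^-1` B).
Proof. by move=> mB; rewrite fineK//; apply: fin_num_measure; exact: preimage_measurable. Qed.

Lemma law_of_ge0 (B : set R) : 0 <= law_of B.
Proof. by apply: fine_ge0; exact: measure_ge0. Qed.

Lemma law_ofS (A B : set R) : measurable A -> measurable B -> A `<=` B ->
  law_of A <= law_of B.
Proof.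
move=> mA mB AB; rewrite -lee_fin !law_ofE//.
by apply: le_measure; rewrite ?inE; [exact: preimage_measurable..|move=> w; exact: AB].
Qed.

Lemma law_ofC (B : set R) : measurable B -> law_of (~` B) = 1 - law_of B.
Proof.
move=> mB; apply: EFin_inj; rewrite law_ofE; last exact: measurableC.
rewrite preimage_setC EFinB law_ofE//.
by rewrite probability_setC//; exact: preimage_measurable.
Qed.

Lemma law_of_le1 (B : set R) : measurable B -> law_of B <= 1.
Proof.
move=> mB; rewrite -subr_ge0 -law_ofC//; exact: law_of_ge0.
Qed.

Lemma weight_law_of i (B : set R) : (1 <= i)%N -> measurable B ->
  P (weight i @^-1` B) = (law_of B)%:E.
Proof. by move=> i1 mB; rewrite law_ofE//; exact: law. Qed.

Lemma measurable_all_weights (n : nat) (B : set R) : measurable B ->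
  measurable [set w | forall i, (1 <= i <= n)%N -> B (weight i w)].
Proof.
move=> mB; rewrite (_ : mkset _ = \bigcap_(i in [set i | (1 <= i <= n)%N]) (weight i @^-1` B)).
  by apply: bigcap_measurableType => i _; exact: preimage_measurable.
by [].
Qed.

Lemma prob_all_weights (n : nat) (B : set R) : measurable B ->
  P [set w | forall i, (1 <= i <= n)%N -> B (weight i w)] = ((law_of B) ^+ n)%:E.
Proof.
move=> mB.
have := @indep (iota 1 n) (fun=> B) (iota_uniq 1 n).
rewrite (_ : \bigcap_(i in _) _ = [set w | forall i, (1 <= i <= n)%N -> B (weight i w)]); last first.
  apply/seteqP; split => w /= h i.
    by move=> iN; apply: h => /=; rewrite mem_iota add1n ltnS.
  by rewrite /= mem_iota add1n ltnS => iN; exact: h.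
move=> -> //; last by move=> i; rewrite mem_iota => /andP[].
rewrite big_seq (eq_bigr (fun=> (law_of B)%:E)); last first.
  by move=> i; rewrite mem_iota => /andP[i1 _]; exact: weight_law_of.
rewrite -big_seq; elim: n => [|n IH]; first by rewrite big_nil expr0.
by rewrite -[n.+1]addn1 iotaD big_cat big_seq1 /= IH exprD expr1 EFinM.
Qed.

Definition law_cdf (y : R) : R := law_of `]-oo, y].

Lemma law_cdf_ge0 y : 0 <= law_cdf y. Proof. exact: law_of_ge0. Qed.

Lemma law_cdf_le1 y : law_cdf y <= 1.
Proof. by apply: law_of_le1; exact: measurable_itv. Qed.

Lemma law_cdf_nd x y : x <= y -> law_cdf x <= law_cdf y.
Proof.
move=> xy; apply: law_ofS; [exact: measurable_itv..|].
by move=> z /=; rewrite !in_itv /= => /le_trans; apply.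
Qed.

Lemma law_cdf_inv x y n : law_cdf x ^+ n < law_cdf y ^+ n -> x < y.
Proof.
move=> h; rewrite ltNge; apply/negP => yx; move: h; rewrite ltNge => /negP; apply.
by rewrite lerXn2r ?nnegrE ?law_cdf_ge0//; exact: law_cdf_nd.
Qed.

Lemma law_of_gt y : law_of `]y, +oo[ = 1 - law_cdf y.
Proof. by rewrite -law_ofC; [rewrite setCitvl|exact: measurable_itv]. Qed.

Lemma unbounded_law_cdf_lt1 : (forall w, 0 <= W w) -> ~ bounded_set (law_support W) ->
  forall y, law_cdf y < 1.
Proof.
move=> W0 unb y; rewrite lt_neqAle law_cdf_le1 andbT; apply/eqP => Fy; apply: unb.
have Py : P (W @^-1` `]y, +oo[) = 0%E.
  rewrite -law_ofE; last exact: measurable_itv.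
  by rewrite law_of_gt Fy subrr.
exists `|y|; split; first by rewrite num_real.
move=> M yM x /= xs; have [x0|x0] := ltP x 0.
  have := xs `]-oo, 0[%classic (@interval_open _ -oo%O (BLeft 0) isT isT) ltac:(by rewrite /= in_itv).
  rewrite (_ : _ @^-1` _ = set0) ?measure0 ?ltxx//.
  by apply/seteqP; split => w //=; rewrite in_itv /= ltNge W0.
rewrite ger0_norm// leNgt; apply/negP => Mx.
have yx : `]y, +oo[%classic x.
  by rewrite /= in_itv /= andbT (le_lt_trans (ler_norm y))// (lt_trans yM).
have := xs `]y, +oo[%classic (@interval_open _ (BRight y) +oo%O isT isT) yx.
by rewrite Py ltxx.
Qed.

End iid.

Section gumbel_quantiles.
Context {R : realType}.
Variables (F : R -> R) (a b : nat -> R).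
Hypotheses (F_ge0 : forall y, 0 <= F y) (F_le1 : forall y, F y <= 1)
  (F_lt1 : forall y, F y < 1)
  (F_inv : forall x y n, F x ^+ n < F y ^+ n -> x < y)
  (a_gt0 : forall n, (1 <= n)%N -> 0 < a n)
  (F_gumbel : forall x, F (a n * x + b n) ^+ n @[n --> \oo] --> gumbel_cdf x).

Lemma cvg_sub_gumbel (n : nat -> nat) x : n k @[k --> \oo] --> \oo ->
  F (a (n k) * x + b (n k)) ^+ n k @[k --> \oo] --> gumbel_cdf x.
Proof. by move=> noo; exact: (cvg_comp _ _ noo (F_gumbel (x := x))). Qed.

Lemma cvg_sub_gumbel_pow (n : nat -> nat) x (s : nat) : n k @[k --> \oo] --> \oo ->
  F (a (n k) * x + b (n k)) ^+ (n k * s) @[k --> \oo] --> expR (- (s%:R * expR (- x))).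
Proof.
move=> noo; rewrite -mulrN expRM_natl.
have -> : (fun k => F (a (n k) * x + b (n k)) ^+ (n k * s)) =
    (fun z => z ^+ s) \o (fun k => F (a (n k) * x + b (n k)) ^+ n k).
  by apply/funext => k /=; rewrite exprM.
exact: (continuous_cvg _ (@exprn_continuous R s _) (cvg_sub_gumbel (x := x) noo)).
Qed.

Lemma near_lt_of_cvg (u v : nat -> R) (l k : R) : u n @[n --> \oo] --> l ->
  v n @[n --> \oo] --> k -> l < k -> \forall n \near \oo, u n < v n.
Proof.
move=> ul vk lk; near=> n; apply: (@lt_trans _ _ ((l + k) / 2)).
  by near: n; apply: (cvgr_lt _ ul); rewrite midf_lt.
by near: n; apply: (cvgr_gt _ vk); rewrite midf_lt.
Unshelve. all: by end_near. Qed.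

(** Changing the index by a bounded factor moves the normalised quantiles by a
    bounded amount, by comparing powers of the distribution function. *)
Lemma gumbel_quantile_lt (N n : nat -> nat) (s : nat) x x' :
  N k @[k --> \oo] --> \oo -> n k @[k --> \oo] --> \oo ->
  (\forall k \near \oo, (N k <= n k * s)%N) ->
  s%:R * expR (- x') < expR (- x) ->
  \forall k \near \oo, a (N k) * x + b (N k) < a (n k) * x' + b (n k).
Proof.
move=> Noo noo Ns xx'.
have lt : gumbel_cdf x < expR (- (s%:R * expR (- x'))) by rewrite ltr_expR ltrN2.
have := near_lt_of_cvg (cvg_sub_gumbel (x := x) Noo) (cvg_sub_gumbel_pow (x := x') (s := s) noo) lt.
apply: filterS2 Ns => k Nk; move=> h; apply: (@F_inv _ _ (n k * s)).
by apply: le_lt_trans h; rewrite ler_wiXn2l ?F_ge0 ?F_le1.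
Qed.

Lemma gumbel_quantile_gt (N n : nat -> nat) (r : nat) x x' :
  N k @[k --> \oo] --> \oo -> n k @[k --> \oo] --> \oo ->
  (\forall k \near \oo, (n k * r <= N k)%N) ->
  expR (- x) < r%:R * expR (- x') ->
  \forall k \near \oo, a (n k) * x' + b (n k) < a (N k) * x + b (N k).
Proof.
move=> Noo noo Ns xx'.
have lt : expR (- (r%:R * expR (- x'))) < gumbel_cdf x by rewrite ltr_expR ltrN2.
have := near_lt_of_cvg (cvg_sub_gumbel_pow (x := x') (s := r) noo) (cvg_sub_gumbel (x := x) Noo) lt.
apply: filterS2 Ns => k Nk; move=> h; apply: (@F_inv _ _ (n k * r)).
by apply: lt_le_trans h _; rewrite ler_wiXn2l ?F_ge0 ?F_le1.
Qed.

Lemma gumbel_center_infty y : \forall n \near \oo, y < b n.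
Proof.
have F0 : F y ^+ n @[n --> \oo] --> 0.
  by apply: cvg_expr; rewrite ger0_norm.
have L : 0 < gumbel_cdf (0 : R) by exact: expR_gt0.
have := near_lt_of_cvg F0 (F_gumbel (x := 0)) L.
by apply: filterS => n; rewrite mulr0 add0r => /F_inv.
Qed.

(** The quantiles of index [n] and [n / r] are compared at two levels: this bounds
    [a n] by a multiple of [a (n / r)], and [b n] from below by about
    [a (n / r) * log r], with [r] as large as desired. *)
Lemma gumbel_scale_small (e : R) : 0 < e -> \forall n \near \oo, a n <= e * b n.
Proof.
move=> e0; pose c := 3 / e + 1 / 2.
have [r r1 rc] : exists2 r : nat, (1 <= r)%N & c <= ln r%:R.
  have [r _ /(_ r (leqnn r)) /= h] := nbhs_infty_ger (expR c).
  have r0 : 0 < r%:R :> R by apply: lt_le_trans h; exact: expR_gt0.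
  exists r; first by rewrite -(ltr0n R).
  by rewrite -ler_expR lnK// posrE.
have r0 : 0 < r%:R :> R by rewrite ltr0n.
have idoo : (fun k : nat => k) k @[k --> \oo] --> \oo by exact: cvg_id.
have noo : (k %/ r)%N @[k --> \oo] --> \oo.
  apply/cvgnyPge => A; exists (A * r)%N => // k /= Ak.
  by rewrite leq_divRL.
have lo : \forall k \near \oo, (k %/ r * r <= k)%N by apply: nearW => k; exact: leq_trunc_div.
have hi : \forall k \near \oo, (k <= k %/ r * (2 * r))%N.
  exists r => // k /= rk; have k1 : (1 <= k %/ r)%N by rewrite divn_gt0.
  rewrite {1}(divn_eq k r) mulnCA mul2n -addnn leq_add2l.
  by rewrite (leq_trans (ltnW (ltn_pmod k r1)))// leq_pmull.
have Q0 := gumbel_quantile_gt (x := 0) (x' := ln r%:R - 1 / 2) idoo noo lo _.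
have Q1 := gumbel_quantile_lt (x := 1) (x' := ln r%:R + 5 / 2) idoo noo hi _.
have B0 : \forall n \near \oo, 0 < b (n %/ r)%N := noo _ (gumbel_center_infty 0).
near=> n.
have nr1 : (1 <= n %/ r)%N by near: n; exists r => // k /= rk; rewrite divn_gt0.
have n1 : (1 <= n)%N by near: n; exact: nbhs_infty_ge.
have q0 : a (n %/ r)%N * (ln r%:R - 1 / 2) + b (n %/ r)%N < a n * 0 + b n.
  near: n; apply: Q0.
  have -> : r%:R * expR (- (ln r%:R - 1 / 2)) = expR (1 / 2) :> R.
    by rewrite opprB expRD expRN lnK ?posrE//; field; rewrite gt_eqF.
  by rewrite oppr0 expR0 expR_gt1 divr_gt0.
have q1 : a n * 1 + b n < a (n %/ r)%N * (ln r%:R + 5 / 2) + b (n %/ r)%N.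
  near: n; apply: Q1.
  have -> : (2 * r)%:R * expR (- (ln r%:R + 5 / 2)) = 2 * expR (- (5 / 2)) :> R.
    rewrite opprD expRD (expRN (ln _)) lnK ?posrE// natrM.
    by field; rewrite gt_eqF.
  have -> : - (1 : R) = - (5 / 2) + 3 / 2 by field.
  rewrite expRD mulrC ltr_pM2l ?expR_gt0//.
  by apply: lt_le_trans (expR_ge1Dx _); lra.
have b0 : 0 < b (n %/ r)%N.
  by near: n; exact: B0.
have a0 := a_gt0 nr1; have an0 := a_gt0 n1.
set A := a (n %/ r)%N in q0 q1 a0; set B := b (n %/ r)%N in q0 q1 b0.
have aA : a n <= 3 * A by clear -q0 q1; lra.
have : A * c <= A * ln r%:R by rewrite ler_wpM2l// ltW.
rewrite /c => h; have bn : A * (3 / e) <= b n.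
  by clearbody A B; clear -h q0 b0; lra.
have := ler_wpM2l (ltW e0) bn.
by rewrite [X in X <= _ -> _](_ : _ = 3 * A); [exact: le_trans|field; rewrite gt_eqF].
Unshelve. all: by end_near. Qed.

Lemma gumbel_center_double : \forall n \near \oo, b (2 * n)%N <= 5 / 4 * b n.
Proof.
have idoo : (fun k : nat => k) k @[k --> \oo] --> \oo by exact: cvg_id.
have n2oo : (2 * k)%N @[k --> \oo] --> \oo.
  by apply/cvgnyPge => A; exists A => // k /= Ak; lia.
have le2 : \forall k \near \oo, (2 * k <= k * 2)%N by apply: nearW => k; rewrite mulnC.
have Q := gumbel_quantile_lt (x := 0) (x' := 1) n2oo idoo le2 _.
near=> n.
have q : a (2 * n)%N * 0 + b (2 * n)%N < a n * 1 + b n.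
  near: n; apply: Q; rewrite oppr0 expR0 expRN -ltr_pdivlMr ?invr_gt0 ?expR_gt0// invrK mul1r.
  apply: le_lt_trans (expR_gt1Dx (oner_neq0 _)); lra.
have : a n <= 1 / 4 * b n by near: n; apply: gumbel_scale_small; rewrite divr_gt0.
lra.
Unshelve. all: by end_near. Qed.

(** Otherwise [F (b n) ^ n] would stay below [exp (- 2)], whereas it tends to
    [exp (- 1)]. *)
Lemma gumbel_tail : \forall n \near \oo, 1 - F (b n) <= 2 / n%:R.
Proof.
have lt : expR (- 2) < gumbel_cdf (0 : R).
  rewrite /gumbel_cdf oppr0 expR0 ltr_expR; lra.
apply: filterS2 (nbhs_infty_ge 1) (cvgr_gt _ (F_gumbel (x := 0)) _ lt) => n n1.
rewrite mulr0 add0r => h.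
have n0 : 0 < n%:R :> R by rewrite ltr0n.
rewrite ler_pdivlMr// leNgt; apply/negP => t2.
have : F (b n) ^+ n <= expR (- 2).
  apply: (@le_trans _ _ (expR (- (1 - F (b n))) ^+ n)).
    rewrite lerXn2r ?nnegrE ?expR_ge0//; apply: le_trans (expR_ge1Dx _); lra.
  by rewrite -expRM_natr ler_expR; lra.
by rewrite leNgt h.
Qed.

End gumbel_quantiles.

Section gumbel_weights.
Context {R : realType} {d : measure_display} {T : measurableType d}.
Variables (P : probability T R).
Variables (weight : nat -> {RV P >-> R}) (W : {RV P >-> R}).
Hypothesis law : forall i, (1 <= i)%N -> equal_in_law (weight i) W.
Hypothesis indep : mutually_independent [set i | (1 <= i)%N] weight.
Hypothesis W_ge0 : forall w, 0 <= W w.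
Hypothesis W_unbounded : ~ bounded_set (law_support W).

Let F := law_cdf W.

Lemma max_upto_le n (f : nat -> R) y : (1 <= n)%N ->
  (max_upto n f <= y) = `[< forall i, (1 <= i <= n)%N -> f i <= y >].
Proof.
move=> n1; apply/idP/asboolP => [h i iN|h].
  apply: le_trans h; rewrite /max_upto; apply: le_bigmax_seq => //.
  by rewrite mem_index_iota ltnS.
rewrite /max_upto big_nat; elim/big_ind : _ => [|x z xy zy|i /andP[i1 iN]].
- by apply: h; rewrite n1.
- by rewrite ge_max xy.
- by apply: h; rewrite i1 -ltnS.
Qed.

Lemma gumbel_norming_cdf a b : gumbel_norming weight a b ->
  forall x, F (a n * x + b n) ^+ n @[n --> \oo] --> gumbel_cdf x.
Proof.
move=> [a0 cd] x.
have cont : {for x, continuous (gumbel_cdf : R -> R)}.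
  apply: continuous_comp; last exact: continuous_expR.
  apply: continuousN; apply: continuous_comp; last exact: continuous_expR.
  by apply: continuousN.
have /fine_cvgP[_] := cd x cont; apply: cvg_trans; apply: near_eq_cvg.
exists 1%N => // n /= n1.
rewrite (_ : mkset _ = [set w | forall i, (1 <= i <= n)%N -> `]-oo, (a n * x + b n)]%classic (weight i w)]).
  by rewrite (prob_all_weights law indep)//; exact: measurable_itv.
have E w : ((max_upto n (fun i => weight i w) - b n) / a n <= x) =
    (max_upto n (fun i => weight i w) <= a n * x + b n).
  by rewrite ler_pdivrMr ?a0// lerBlDr mulrC.
apply/seteqP; split => w /=; rewrite E max_upto_le//.
  by move=> /asboolP h i iN; rewrite in_itv /= h.
by move=> h; apply/asboolP => i iN; have := h i iN; rewrite in_itv.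
Qed.

Variables (a b : nat -> R).
Hypothesis norming : gumbel_norming weight a b.

Let a_gt0 := norming.1.
Let F_gumbel := gumbel_norming_cdf norming.
Let F_ge0 : forall y, 0 <= F y := law_cdf_ge0 W.
Let F_le1 : forall y, F y <= 1 := law_cdf_le1 W.
Let F_lt1 : forall y, F y < 1 := unbounded_law_cdf_lt1 W_ge0 W_unbounded.
Let F_inv : forall x y n, F x ^+ n < F y ^+ n -> x < y.
Proof. move=> x y n; exact: law_cdf_inv. Qed.

Lemma center_infty y : \forall n \near \oo, y < b n.
Proof. exact: (gumbel_center_infty F_ge0 F_lt1 F_inv F_gumbel). Qed.

Lemma scale_small (e : R) : 0 < e -> \forall n \near \oo, a n <= e * b n.
Proof. exact: (gumbel_scale_small F_ge0 F_le1 F_lt1 F_inv a_gt0 F_gumbel). Qed.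

(** Along the indices [2 ^ k * n0] the centering grows by a factor at most 5 / 4 per
    step while the tail is halved, so the second moment is bounded by a geometric
    series of ratio [(5 / 4) ^ 2 / 2]. *)
Lemma gumbel_second_moment : exists v : R, (\int[P]_w (W w * W w)%:E <= v%:E)%E.
Proof.
have [n0 [n01 bn0 bd bt]] : exists n0 : nat, [/\ (1 <= n0)%N,
    forall n, (n0 <= n)%N -> 0 < b n,
    forall n, (n0 <= n)%N -> b (2 * n)%N <= 5 / 4 * b n &
    forall n, (n0 <= n)%N -> 1 - F (b n) <= 2 / n%:R].
  have [N1 _ h1] := center_infty 0.
  have [N2 _ h2] := gumbel_center_double F_ge0 F_le1 F_lt1 F_inv a_gt0 F_gumbel.
  have [N3 _ h3] := gumbel_tail F_ge0 F_gumbel.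
  exists (maxn 1 (maxn N1 (maxn N2 N3))); split => [|n|n|n]; rewrite ?leq_max// !geq_max.
  - by move=> /and4P[_ ? _ _]; exact: h1.
  - by move=> /and4P[_ _ ? _]; exact: h2.
  - by move=> /and4P[_ _ _ ?]; exact: h3.
pose c k := b (2 ^ k * n0)%N.
have ge k : (n0 <= 2 ^ k * n0)%N by rewrite leq_pmull// expn_gt0.
have c0 k : 0 < c k by apply: bn0.
have cq k : c k <= (5 / 4) ^+ k * c 0%N.
  elim: k => [|k IH]; first by rewrite expr0 mul1r.
  rewrite exprS -mulrA /c expnS -mulnA; apply: le_trans (bd _ (ge k)) _.
  by rewrite ler_wpM2l//; lra.
(* [(5 / 4) ^ 2 / 2] *)
pose q : R := 25 / 32.
pose A : R := c 0%N ^+ 2 * (25 / 16) * 2.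
have A0 : 0 <= A by rewrite /A !mulr_ge0// ltW.
have term k : c k.+1 ^+ 2 * (1 - F (c k)) <= A * q ^+ k.
  have n0k : 0 < (2 ^ k * n0)%:R :> R by rewrite ltr0n muln_gt0 expn_gt0.
  apply: (@le_trans _ _ (((5 / 4) ^+ k.+1 * c 0%N) ^+ 2 * (2 / 2 ^+ k))).
    apply: ler_pM; [exact: sqr_ge0|by rewrite subr_ge0|..].
      by rewrite lerXn2r ?nnegrE ?mulr_ge0 ?exprn_ge0 ?(ltW (c0 _))//; apply: divr_ge0.
    apply: le_trans (bt _ (ge k)) _; rewrite ler_wpM2l// lef_pV2 ?posrE ?exprn_gt0//.
    by rewrite natrM natrX ler_peMr ?exprn_ge0// ler1n.
  rewrite le_eqVlt; apply/orP; left; apply/eqP.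
  rewrite /A /q exprMn -exprM mulnC exprM exprS.
  rewrite (_ : (5 / 4) ^+ 2 = 2 * (25 / 32) :> R); last by field.
  rewrite exprMn; field.
  by rewrite expf_neq0.
exists (c 0%N ^+ 2 + A * (32 / 7)).
have mB k : measurable [set w | c k < W w] by exact: measurable_gt_fun.
pose f k w : \bar R := (c k.+1 ^+ 2 * \1_[set w | c k < W w] w)%:E.
have f0 k w : (0 <= f k w)%E by rewrite lee_fin; apply: mulr_ge0; [exact: sqr_ge0|rewrite indicE].
have mf k : measurable_fun setT (f k).
  apply/measurable_EFinP; apply: measurable_funM; first exact: measurable_cst.
  exact: measurable_indic.
have fint k : (\int[P]_w f k w = (c k.+1 ^+ 2 * (1 - F (c k)))%:E)%E.
  rewrite /f; under eq_integral do rewrite EFinM.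
  rewrite ge0_integralZl//.
  - rewrite integral_indic// setIT [RHS]EFinM; congr (_ * _)%E.
    rewrite -law_of_gt law_ofE; last exact: measurable_itv.
    by congr (P _); apply/seteqP; split => w /=; rewrite in_itv /= andbT.
  - by apply/measurable_EFinP; exact: measurable_indic.
  - by rewrite lee_fin sqr_ge0.
have sum_le : (\sum_(k <oo) \int[P]_w f k w <= (A * (32 / 7))%:E)%E.
  apply: lime_le; first by apply: is_cvg_nneseries => i _ _; exact: integral_ge0.
  apply: nearW => n.
  suff h : (\sum_(0 <= k < n) \int[P]_w f k w <= (A * (32 / 7) * (1 - q ^+ n))%:E)%E.
    have q1 : 1 - q ^+ n <= 1 by rewrite lerBlDr lerDl exprn_ge0// divr_ge0.
    have A32 : 0 <= A * (32 / 7) by rewrite mulr_ge0// divr_ge0.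
    by apply: le_trans h _; rewrite lee_fin ler_piMr.
  elim: n => [|n IH]; first by rewrite big_nil expr0 subrr mulr0.
  rewrite big_nat_recr//= fint.
  apply: (@le_trans _ _ ((A * (32 / 7) * (1 - q ^+ n))%:E + (A * q ^+ n)%:E)%E).
    by rewrite leeD// lee_fin.
  rewrite -EFinD lee_fin exprS le_eqVlt; apply/orP; left; apply/eqP.
  by rewrite {3}/q; field.
apply: (@le_trans _ _ (\int[P]_w ((c 0%N ^+ 2)%:E + \sum_(k <oo) f k w))%E); last first.
  rewrite ge0_integralD//.
  - rewrite integral_nneseries// EFinD leeD// integral_cst_probability//.
  - by move=> w _; rewrite lee_fin sqr_ge0.
  - by move=> w _; apply: nneseries_ge0.
  - by apply: ge0_emeasurable_sum.
apply: ge0_le_integral => //.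
- by move=> w _; rewrite lee_fin mulr_ge0.
- by apply/measurable_EFinP; exact: measurable_funM.
- by apply: emeasurable_funD => //; apply: ge0_emeasurable_sum.
move=> w _; have [Wc|Wc] := leP (W w) (c 0%N).
  rewrite -[leLHS]adde0 leeD//; last by apply: nneseries_ge0.
  by rewrite lee_fin expr2 ler_pM.
have exk : exists k, W w <= c k.
  have [N _ HN] := center_infty (W w).
  exists N; apply/ltW/HN => /=; rewrite (leq_trans (ltnW (ltn_expl N (isT : 1 < 2)%N)))//.
  by rewrite leq_pmulr.
case: (ex_minnP exk) => -[|k] Wk kmin; first by rewrite leNgt Wc in Wk.
have ck : c k < W w by rewrite ltNge; apply/negP => /kmin; rewrite ltnn.
apply: (@le_trans _ _ (f k w)).
  by rewrite /f indicE mem_set//= mulr1 lee_fin expr2 ler_pM.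
rewrite -[leLHS]add0e leeD ?lee_fin ?sqr_ge0//.
apply: le_trans (nneseries_lim_ge k.+1 _); last by move=> *.
by rewrite big_nat_recr//= leeDr// sume_ge0.
Qed.

Hypothesis W_mean : ('E_P[W] = 1)%E.

Lemma total_weight_equiv : {ae P, forall w, forall e : R, 0 < e ->
  \forall n \near \oo, `|total_weight weight n w - n%:R| <= e * n%:R}.
Proof.
have [v Hv] := gumbel_second_moment.
(* the weights are nonnegative almost everywhere only *)
pose X i w := `|weight i w|.
have mX i : measurable_fun setT (X i) by exact: measurableT_comp.
have X0 i w : 0 <= X i w by exact: normr_ge0.
have X1 i : (1 <= i)%N -> (\int[P]_w (X i w)%:E = 1)%E.
  move=> i1; rewrite (equal_in_law_integral (f := fun x => `|x|) (law i1))//.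
  rewrite -W_mean unlock; apply: eq_integral => w _.
  by rewrite ger0_norm.
have X2 i : (1 <= i)%N -> (\int[P]_w (X i w * X i w)%:E <= v%:E)%E.
  move=> i1; rewrite (equal_in_law_integral (f := fun x => `|x| * `|x|) (law i1)).
  - by under eq_integral do rewrite ger0_norm//.
  - by apply: measurable_funM.
  - by move=> x; exact: mulr_ge0.
have X11 i j : (1 <= i)%N -> (1 <= j)%N -> i != j -> (\int[P]_w (X i w * X j w)%:E = 1)%E.
  move=> i1 j1 ij; rewrite independent_ge0_integralM//.
  - by rewrite !X1// mule1.
  - move=> A B mA mB.
    have mn (C : set R) : measurable C -> measurable ((fun x : R => `|x|) @^-1` C).
      move=> mC; rewrite -[Y in measurable Y]setTI.
      by apply: (_ : measurable_fun setT (fun x : R => `|x|)) => //; exact: measurableT_comp.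
    have := @indep [:: i; j] (fun k => if k == i then (fun x : R => `|x|) @^-1` A else (fun x : R => `|x|) @^-1` B).
    rewrite /= inE ij => /(_ isT).
    rewrite !big_cons big_nil mule1 eqxx eq_sym (negbTE ij) => <-.
    + congr (P _); apply/seteqP; split => w /=.
        move=> [wA wB] k /=; rewrite !inE => /orP[/eqP->|/eqP->]; rewrite ?eqxx//.
        by rewrite eq_sym (negbTE ij).
      move=> h; split.
        by have := h i; rewrite /= !inE eqxx => /(_ isT).
      by have := h j; rewrite /= !inE eqxx orbT eq_sym (negbTE ij) => /(_ isT).
    + by move=> k; rewrite !inE => /orP[/eqP->|/eqP->].
    + by move=> k; case: ifP => _; exact: mn.
  - by rewrite X1// ltry.
apply: filterS2 (ae_weight_ge0 law W_ge0) (strong_law mX X0 X1 X2 X11) => w W0 H e e0.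
apply: filterS (H e e0) => n; rewrite (_ : \sum_(_ <= _ < _) _ = total_weight weight n w)//.
by rewrite /total_weight; apply: eq_big_nat => i /andP[i1 _]; rewrite /X ger0_norm// W0.
Qed.

End gumbel_weights.

(** * Slowly varying centering *)

Section logarithm_of_index.
Context {R : realType}.

Lemma ln_nat_cvgy : ln (n%:R : R) @[n --> \oo] --> +oo.
Proof.
apply/cvgryPge => A; have [N _ HN] := nbhs_infty_ger (expR A).
exists N => // n /= Nn; have := HN n Nn => h.
have n0 : 0 < n%:R :> R by apply: lt_le_trans h; exact: expR_gt0.
by rewrite -ler_expR lnK// posrE.
Qed.

Lemma near_ln_ge (A : R) : \forall n \near \oo, A <= ln n%:R.
Proof. by have /cvgryPge := ln_nat_cvgy; apply. Qed.

Definition root_index (s : R) (n : nat) : nat := Num.truncn (n%:R `^ s).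

Lemma root_index_le s n : (1 <= n)%N -> (root_index s n)%:R <= n%:R `^ s.
Proof. by move=> n1; rewrite /root_index truncn_le powR_ge0. Qed.

Lemma root_index_gt s n : n%:R `^ s < (root_index s n)%:R + 1.
Proof. by rewrite natr1; apply: real_truncnS_gt; exact: num_real. Qed.

Lemma root_index_infty s : 0 < s -> root_index s n @[n --> \oo] --> \oo.
Proof.
move=> s0; apply/cvgnyPge => A.
near=> n; have n1 : (1 <= n)%N by near: n; exact: nbhs_infty_ge.
have n0 : 0 < n%:R :> R by rewrite ltr0n.
rewrite /root_index truncn_ge_nat ?powR_ge0//.
apply: (@le_trans _ _ (expR A%:R)); first by apply: le_trans (expR_ge1Dx _); rewrite lerDr.
rewrite /powR gt_eqF// ler_expR mulrC -ler_pdivrMr//.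
by near: n; exact: near_ln_ge.
Unshelve. all: by end_near. Qed.

Lemma ln_root_index_le s n : (1 <= n)%N -> (1 <= root_index s n)%N ->
  ln (root_index s n)%:R <= s * ln n%:R.
Proof.
move=> n1 N1; rewrite -ln_powR ler_ln ?posrE ?ltr0n ?powR_gt0 ?ltr0n//.
exact: root_index_le.
Qed.

Lemma ln_root_index_ge s n : (1 <= n)%N -> (2 <= root_index s n)%N ->
  s / 2 * ln n%:R <= ln (root_index s n)%:R.
Proof.
move=> n1 N2; have n0 : 0 < n%:R :> R by rewrite ltr0n.
set N := root_index s n in N2 *.
have N0 : 0 < N%:R :> R by rewrite ltr0n (leq_trans _ N2).
have : ln (n%:R `^ s) <= ln (N%:R ^+ 2) :> R.
  rewrite ler_ln ?posrE ?powR_gt0 ?exprn_gt0//.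
  apply: le_trans (ltW (root_index_gt s n)) _.
  rewrite -/N natr1 -natrX ler_nat; nia.
by rewrite ln_powR lnXn// mulr2n; lra.
Qed.

Lemma ln_div_index n i : (1 <= i <= n)%N ->
  0 <= ln (n%:R / i%:R : R) /\ ln (n%:R / i%:R : R) = ln n%:R - ln i%:R.
Proof.
move=> /andP[i1 iN]; have i0 : 0 < i%:R :> R by rewrite ltr0n.
have n0 : 0 < n%:R :> R by rewrite ltr0n (leq_trans i1).
rewrite ln_div ?posrE//; split => //.
by rewrite subr_ge0 ler_ln ?posrE// ler_nat.
Qed.

End logarithm_of_index.

Section slowly_varying_case.
Context {R : realType} {d : measure_display} {T : measurableType d}.
Variables (P : probability T R) (m : nat).
Variables (weight : nat -> {RV P >-> R}) (target : nat -> 'I_m -> {RV P >-> nat}).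
Variable W : {RV P >-> R}.
Hypothesis m_ge1 : (1 <= m)%N.
Hypothesis wrg : weighted_recursive_graph weight target W.
Hypothesis W_ge0 : forall w, 0 <= W w.
Hypothesis W_unbounded : ~ bounded_set (law_support W).
Hypothesis W_mean : ('E_P[W] = 1)%E.
Variables (a b : nat -> R).
Hypothesis norming : gumbel_norming weight a b.

Let law := weight_law wrg.
Let indep := weight_indep wrg.
Let F := law_cdf W.
Let F_gumbel := gumbel_norming_cdf law indep norming.
Let b_infty := center_infty law indep W_ge0 W_unbounded norming.
Let a_small := scale_small law indep W_ge0 W_unbounded norming.

Lemma max_weight_le (e : R) : 0 < e ->
  with_high_prob P (fun n => [set w | forall i, (1 <= i <= n)%N ->
    weight i w <= (1 + e) * b n]).
Proof.
move=> e0.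
have mA n : measurable [set w | forall i, (1 <= i <= n)%N -> weight i w <= (1 + e) * b n].
  exact: (measurable_all_weights weight n (measurable_itv `]-oo, ((1 + e) * b n)])).
apply: (@with_high_prob_eps _ _ _ P _ (fun n => ~` [set w | forall i, (1 <= i <= n)%N -> weight i w <= (1 + e) * b n])) => //.
- by move=> n; exact: measurableC.
- by move=> n w.
move=> eta eta0.
(* 1 - exp (- exp (- x)) <= exp (- x) < eta *)
pose x := - ln (eta / 2).
have xE : expR (- x) = eta / 2 by rewrite opprK lnK// posrE divr_gt0.
have Lx : 1 - eta < gumbel_cdf x.
  rewrite /gumbel_cdf xE; apply: lt_le_trans (expR_ge1Dx _); lra.
have ax : \forall n \near \oo, a n * x <= e * b n.
  near=> n; have an : a n <= e / (`|x| + 1) * b n.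
    by near: n; apply: a_small; rewrite divr_gt0// ltr_pwDr.
  have x1 : 0 < `|x| + 1 by rewrite ltr_pwDr.
  have a0 : 0 < a n by apply: norming.1; near: n; exact: nbhs_infty_ge.
  apply: (@le_trans _ _ (a n * (`|x| + 1))).
    by rewrite ler_wpM2l ?(ltW a0)// (le_trans (ler_norm _))// lerDl.
  by rewrite mulrC -ler_pdivlMl// mulrC mulrAC.
apply: filterS2 ax (cvgr_gt _ (F_gumbel (x := x)) _ Lx) => n ax h.
have -> : P (~` [set w | forall i, (1 <= i <= n)%N -> weight i w <= (1 + e) * b n]) =
    (1 - F ((1 + e) * b n) ^+ n)%:E.
  rewrite probability_setC//.
  rewrite EFinB -(prob_all_weights law indep); last exact: measurable_itv.
  by congr (1 - P _)%E; apply/seteqP; split => w /= H i iN; have := H i iN; rewrite in_itv.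
rewrite lee_fin lerBlDr -lerBlDl (le_trans (ltW h))// lerXn2r ?nnegrE ?law_cdf_ge0//.
by apply: law_cdf_nd; lra.
Unshelve. all: by end_near. Qed.

Lemma max_weight_ge (e : R) : 0 < e ->
  with_high_prob P (fun n => [set w | exists2 i, (1 <= i <= n)%N &
    (1 - e) * b n <= weight i w]).
Proof.
move=> e0.
have mB n : measurable [set w | forall i, (1 <= i <= n)%N -> `]-oo, ((1 - e) * b n)]%classic (weight i w)].
  by apply: measurable_all_weights; exact: measurable_itv.
apply: (with_high_prob_eps mB).
- move=> n w /= nA i iN; rewrite in_itv /= leNgt; apply/negP => h; apply: nA.
  by exists i => //; exact: ltW.
move=> eta eta0.
(* exp (- y) <= 1 / (1 + y) < eta for y = 1 / eta = exp (- x) *)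
pose x := ln eta.
have Lx : gumbel_cdf x < eta.
  rewrite /gumbel_cdf !expRN lnK ?posrE// invf_plt ?posrE ?expR_gt0//.
  by apply: lt_le_trans (expR_ge1Dx _); rewrite ltrDr.
have ax : \forall n \near \oo, - (e * b n) <= a n * x.
  near=> n; have an : a n <= e / (`|x| + 1) * b n.
    by near: n; apply: a_small; rewrite divr_gt0// ltr_pwDr.
  have x1 : 0 < `|x| + 1 by rewrite ltr_pwDr.
  have a0 : 0 < a n by apply: norming.1; near: n; exact: nbhs_infty_ge.
  rewrite lerNl; apply: (@le_trans _ _ (a n * (`|x| + 1))).
    by rewrite -mulrN ler_wpM2l ?(ltW a0)// -normrN (le_trans (ler_norm _))// lerDl.
  by rewrite mulrC -ler_pdivlMl// mulrC mulrAC.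
apply: filterS2 ax (cvgr_lt _ (F_gumbel (x := x)) _ Lx) => n ax h.
rewrite (prob_all_weights law indep); last exact: measurable_itv.
rewrite lee_fin (le_trans _ (ltW h))// lerXn2r ?nnegrE ?law_cdf_ge0//.
by apply: law_cdf_nd; lra.
Unshelve. all: by end_near. Qed.

Hypothesis SV : case_SV b.

(** Slow variation in [log n] makes the weights of the first [n ^ s] vertices as
    large as those of all [n] vertices. *)
Lemma center_root_index (s e : R) : 0 < s -> 0 < e -> e < 1 ->
  \forall n \near \oo, (1 - e) ^+ 2 * b n <= (1 + e) * b (root_index s n).
Proof.
move=> s0 e0 e1; have [l [lmono lsv bl]] := SV.
have Noo := root_index_infty s0.
have blN := cvg_comp _ _ Noo bl.
have s20 : 0 < s / 2 by rewrite divr_gt0.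
have lln := cvg_comp _ _ (@ln_nat_cvgy R) (lsv _ s20).
near=> n.
have b0 : 0 < b n by near: n; exact: b_infty.
have bN0 : 0 < b (root_index s n) by near: n; exact: (Noo _ (b_infty 0)).
have n1 : (1 <= n)%N by near: n; exact: nbhs_infty_ge.
have N2 : (2 <= root_index s n)%N.
  by near: n; exact: (Noo _ (nbhs_infty_ge 2)).
have ln0 : 0 < ln n%:R :> R.
  by apply: (@lt_le_trans _ _ 1) => //; near: n; exact: near_ln_ge.
have /ler_normlP[r1 r2] : `|1 - b n / l (ln n%:R)| <= e.
  by near: n; move/cvgrPdist_le : bl; apply.
have /ler_normlP[r3 r4] : `|1 - b (root_index s n) / l (ln (root_index s n)%:R)| <= e.
  by near: n; move/cvgrPdist_le : blN; apply.
have /ler_normlP[r5 r6] : `|1 - l (s / 2 * ln n%:R) / l (ln n%:R)| <= e.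
  by near: n; move/cvgrPdist_le : lln; apply.
have l0 : 0 < l (ln n%:R).
  have : 0 < b n / l (ln n%:R) by lra.
  by rewrite pmulr_rgt0// invr_gt0.
have lN0 : 0 < l (ln (root_index s n)%:R).
  have : 0 < b (root_index s n) / l (ln (root_index s n)%:R) by lra.
  by rewrite pmulr_rgt0// invr_gt0.
have h1 : b n <= (1 + e) * l (ln n%:R) by rewrite -ler_pdivrMr//; lra.
have h2 : (1 - e) * l (ln (root_index s n)%:R) <= b (root_index s n).
  by rewrite -ler_pdivlMr//; lra.
have h3 : (1 - e) * l (ln n%:R) <= l (s / 2 * ln n%:R).
  by rewrite -ler_pdivlMr//; lra.
have h4 : l (s / 2 * ln n%:R) <= l (ln (root_index s n)%:R).
  apply: lmono; rewrite ?posrE ?mulr_gt0//.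
  - by rewrite ln_gt0// ltr1n.
  - exact: ln_root_index_ge.
have e10 : 0 < 1 - e by rewrite subr_gt0.
apply: (@le_trans _ _ ((1 - e) ^+ 2 * ((1 + e) * l (ln n%:R)))).
  by rewrite ler_wpM2l// sqr_ge0.
rewrite mulrCA ler_wpM2l//; first by rewrite addr_ge0// ltW.
rewrite expr2 -mulrA; apply: le_trans h2; rewrite ler_pM2l//.
exact: le_trans h4.
Unshelve. all: by end_near. Qed.

(** The largest weight among the first [n ^ s] vertices, with [s] small, is
    multiplied by at least [(1 - s) * log n] and is of the same order as the
    largest weight overall; vertices beyond [n ^ e] lose a factor [1 - e]. *)
Theorem slowly_varying_case :
  cvg_in_probability P
    (fun n w =>
       (max_upto n (fun i =>
          (indegree target n i w)%:R / (m%:R * b n * ln n%:R)),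
        ln (max_degree_label target n w)%:R / ln n%:R) : R * R)
    (1, 0).
Proof.
pose v n : R := b n * ln n%:R.
have b0 : \forall n \near \oo, 0 < b n by exact: b_infty.
have v0 : \forall n \near \oo, 0 < v n.
  near=> n; rewrite mulr_gt0//; first by near: n.
  by apply: (@lt_le_trans _ _ 1) => //; near: n; exact: near_ln_ge.
apply: with_high_prob_cvg; apply: (@argmax_in_degree _ _ _ P m weight target W m_ge1 wrg W_ge0
  (total_weight_equiv law indep W_ge0 W_unbounded norming W_mean) v (fun n => 2 * b n)).
- move=> A; near=> n; rewrite /v ler_wpM2r//.
    by rewrite ln_ge0// ler1n; near: n; exact: nbhs_infty_ge.
  by apply: ltW; near: n; exact: b_infty.
- move=> e e0; near=> n; rewrite /v (mulrC (b n)) mulrA ler_wpM2r//.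
    by apply: ltW; near: n.
  by rewrite -ler_pdivrMl//; near: n; exact: near_ln_ge.
- exact: with_high_prob_mode.
- exact: eventually_as_with_high_prob.
- exact: v0.
- move=> e e0; near=> n.
  have vn : 0 < v n by near: n.
  have m0 : 0 < m%:R :> R by rewrite ltr0n.
  by rewrite /v mulrA divff ?subrr ?normr0 ?(ltW e0)// -mulrA gt_eqF// mulr_gt0.
- apply: (modeS (with_high_prob_mode P) _ (max_weight_le ltr01)).
  by apply: nearW => n w /= h i iN; have := h i iN; lra.
- move=> e e0.
  apply: (modeS (with_high_prob_mode P) _ (max_weight_le e0)).
  near=> n => w /= h i iN; have [l0 lE] := @ln_div_index R n i iN.
  have bn : 0 < b n by near: n.
  have i1 : (1 <= i)%N by case/andP: iN.
  apply: le_trans (ler_wpM2r l0 (h i iN)) _.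
  rewrite /v -mulrA ler_wpM2l//; first by rewrite addr_ge0// ltW.
  by rewrite ler_wpM2l ?(ltW bn)// lE gerBl ln_ge0// ler1n.
- move=> e e0.
  pose s := Num.min e 1 / 8.
  have s0 : 0 < s by rewrite divr_gt0// lt_min e0 ltr01.
  have [s8 s81] : 8 * s <= e /\ 8 * s <= 1.
    by rewrite /s mulrC divfK//; rewrite !ge_min !lexx orbT.
  have s1 : s < 1 by lra.
  apply: (modeS (with_high_prob_mode P) _
    (with_high_prob_comp (root_index_infty s0) (max_weight_ge s0))).
  near=> n => w /= [i iN Wi].
  have n1 : (1 <= n)%N by near: n; exact: nbhs_infty_ge.
  have bN : (1 - s) ^+ 2 * b n <= (1 + s) * b (root_index s n).
    by near: n; exact: center_root_index.
  have bn : 0 < b n by near: n.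
  have L0 : 0 <= ln n%:R :> R by rewrite ln_ge0// ler1n.
  have [i1 iN'] := andP iN.
  have iL : ln i%:R <= s * ln n%:R :> R.
    apply: le_trans (ln_root_index_le n1 (leq_trans i1 iN')).
    by rewrite ler_ln ?posrE ?ltr0n ?(leq_trans i1)// ler_nat.
  have in' : (1 <= i <= n)%N.
    rewrite i1 -(ler_nat R) -ler_ln ?posrE ?ltr0n//.
    by apply: le_trans iL _; rewrite ler_piMl// ltW.
  exists i => //; have [l0 lE] := @ln_div_index R n i in'.
  have bW : (1 - 4 * s) * b n <= weight i w.
    apply: le_trans Wi; rewrite -(ler_pM2l (_ : 0 < 1 + s)); last by lra.
    rewrite [leRHS]mulrCA; apply: (@le_trans _ _ ((1 - s) * ((1 - s) ^+ 2 * b n))).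
      have k : (1 + s) * (1 - 4 * s) <= (1 - s) * ((1 - s) * (1 - s)) by nra.
      by have := ler_wpM2r (ltW bn) k; rewrite expr2; lra.
    by rewrite ler_wpM2l//; lra.
  apply: (@le_trans _ _ ((1 - 4 * s) * b n * ((1 - s) * ln n%:R))).
    rewrite /v; have : 0 <= b n * ln n%:R by rewrite mulr_ge0// ltW.
    by move=> ?; nra.
  apply: ler_pM => //; first by rewrite mulr_ge0 ?(ltW bn)//; lra.
    by rewrite mulr_ge0//; lra.
  by rewrite lE; lra.
- move=> e e0; exists (e / 2); first by rewrite divr_gt0.
  have e20 : 0 < e / 2 by rewrite divr_gt0.
  apply: (modeS (with_high_prob_mode P) _ (max_weight_le e20)).
  near=> n => w /= h i iN far; have [l0 lE] := @ln_div_index R n i iN.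
  have bn : 0 < b n by near: n.
  have i1 : (1 <= i)%N by case/andP: iN.
  have L0 : 0 < ln n%:R :> R.
    by apply: (@lt_le_trans _ _ 1) => //; near: n; exact: near_ln_ge.
  have li0 : 0 <= ln i%:R :> R by rewrite ln_ge0// ler1n.
  have li : e * ln n%:R <= ln i%:R.
    by move: far; rewrite subr0 ger0_norm ?divr_ge0 ?(ltW L0)// ler_pdivlMr.
  apply: le_trans (ler_wpM2r l0 (h i iN)) _.
  apply: (@le_trans _ _ ((1 + e / 2) * b n * ((1 - e) * ln n%:R))).
    rewrite ler_wpM2l//; first by rewrite mulr_ge0 ?(ltW bn)//; lra.
    by rewrite lE; lra.
  have : 0 <= b n * ln n%:R by rewrite mulr_ge0// ltW.
  rewrite /v => ?; nra.
Unshelve. all: by end_near. Qed.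

End slowly_varying_case.

(** * Asymptotic comparisons *)

Section asymptotics.
Context {R : realType}.
Implicit Types (A B e p k : R).

Lemma near_pinfty_ge A : \forall y \near +oo, A <= y.
Proof. by apply: nbhs_pinfty_ge; rewrite num_real. Qed.

Lemma near_log_le A B e : 0 < e -> \forall y \near +oo, A + B * ln y <= e * y.
Proof.
move=> e0; pose c := e / (2 * (`|B| + 1)).
have B1 : 0 < `|B| + 1 by rewrite ltr_pwDr.
have c0 : 0 < c by rewrite divr_gt0// mulr_gt0.
near=> y.
have y1 : 1 <= y by near: y; exact: near_pinfty_ge.
have y0 : 0 < y by apply: lt_le_trans y1.
have ly : ln y <= c * y - ln c.
  have : ln (c * y) < c * y by apply: ln_sublinear; exact: mulr_gt0.
  by rewrite lnM ?posrE//; lra.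
have Bl : B * ln y <= (`|B| + 1) * (c * y - ln c).
  apply: (@le_trans _ _ ((`|B| + 1) * ln y)).
    by rewrite ler_wpM2r ?ln_ge0// (le_trans (ler_norm _))// lerDl.
  by rewrite ler_wpM2l// ltW.
have yl : 2 / e * (A - (`|B| + 1) * ln c) <= y by near: y; exact: near_pinfty_ge.
have : e / 2 * (2 / e * (A - (`|B| + 1) * ln c)) <= e / 2 * y.
  by rewrite ler_wpM2l// divr_ge0// ltW.
rewrite [X in X <= _](_ : _ = A - (`|B| + 1) * ln c); last by field; rewrite gt_eqF.
have : (`|B| + 1) * (c * y) = e / 2 * y.
  by rewrite /c; field; rewrite gt_eqF.
lra.
Unshelve. all: by end_near. Qed.

Lemma near_log_abs A B e : 0 < e -> \forall y \near +oo, `|A + B * ln y| <= e * y.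
Proof.
move=> e0; near=> y; rewrite ler_norml; apply/andP; split.
  have : - A + - B * ln y <= e * y by near: y; exact: near_log_le.
  lra.
by near: y; exact: near_log_le.
Unshelve. all: by end_near. Qed.

Lemma near_powR_ge A p : 0 < p -> \forall y \near +oo, A <= y `^ p.
Proof.
move=> p0; near=> y.
have y1 : 1 <= y by near: y; exact: near_pinfty_ge.
have y0 : 0 < y by apply: lt_le_trans y1.
have Ay : (`|A| + 1) `^ p^-1 <= y by near: y; exact: near_pinfty_ge.
apply: (@le_trans _ _ (`|A| + 1)); first by rewrite (le_trans (ler_norm _))// lerDl.
have -> : `|A| + 1 = ((`|A| + 1) `^ p^-1) `^ p.
  by rewrite -powRrM mulVf ?gt_eqF// powRr1// addr_ge0.
by apply: ge0_ler_powR; rewrite ?nnegrE ?powR_ge0 ?ltW.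
Unshelve. all: by end_near. Qed.

Lemma near_mul_ln (Q : R -> Prop) k : 0 < k ->
  (\forall y \near +oo, Q y) -> \forall n \near \oo, Q (k * ln n%:R).
Proof.
move=> k0 [M [Mr HM]]; near=> n; apply: HM.
rewrite mulrC -ltr_pdivrMr//; apply: (@lt_le_trans _ _ (M / k + 1)).
  by rewrite ltrDl.
by near: n; exact: near_ln_ge.
Unshelve. all: by end_near. Qed.

Lemma near_ln (Q : R -> Prop) :
  (\forall y \near +oo, Q y) -> \forall n \near \oo, Q (ln n%:R).
Proof.
by move=> /(near_mul_ln ltr01); apply: filterS => n; rewrite mul1r.
Qed.

Lemma near_pinfty_comp (Q : R -> Prop) (f : R -> R) :
  (forall A, \forall y \near +oo, A <= f y) ->
  (\forall y \near +oo, Q y) -> \forall y \near +oo, Q (f y).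
Proof.
move=> foo [M [Mr HM]]; apply: filterS (foo (M + 1)) => y My; apply: HM.
by apply: lt_le_trans My; rewrite ltrDl.
Qed.

Lemma inv_ratio_near1 (z e : R) : 0 < e -> `|z| <= e / 2 -> `|z| <= 1 / 2 ->
  `|(1 + z)^-1 - 1| <= e.
Proof.
move=> e0 ze z2; have /andP[zl zr] : - (1 / 2) <= z <= 1 / 2 by rewrite -ler_norml.
have z1 : 0 < 1 + z by lra.
have -> : (1 + z)^-1 - 1 = - z / (1 + z) by field; rewrite gt_eqF.
rewrite normrM normrN normfV (gtr0_norm z1) ler_pdivrMr//.
apply: le_trans ze _; rewrite ler_pM2l//; lra.
Qed.

End asymptotics.

Section weight_tails.
Context {R : realType} {d : measure_display} {T : measurableType d}.
Variables (P : probability T R).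
Variables (weight : nat -> {RV P >-> R}) (W : {RV P >-> R}).
Hypothesis law : forall i, (1 <= i)%N -> equal_in_law (weight i) W.
Hypothesis indep : mutually_independent [set i | (1 <= i)%N] weight.

Lemma tailE x : tail W x = law_of W `[x, +oo[.
Proof.
rewrite /tail /law_of; congr (fine (P _)).
by apply/seteqP; split => w /=; rewrite in_itv /= andbT.
Qed.

Lemma tail_le1 x : tail W x <= 1.
Proof. by rewrite tailE; apply: law_of_le1; exact: measurable_itv. Qed.

Lemma weight_tail i x : (1 <= i)%N -> P [set w | x <= weight i w] = (tail W x)%:E.
Proof.
move=> i1; rewrite tailE -(weight_law_of law i1); last exact: measurable_itv.
by congr (P _); apply/seteqP; split => w /=; rewrite in_itv /= andbT.
Qed.

Lemma measurable_all_lt n x :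
  measurable [set w | forall i, (1 <= i <= n)%N -> weight i w < x].
Proof.
rewrite (_ : mkset _ = [set w | forall i, (1 <= i <= n)%N -> `]-oo, x[%classic (weight i w)]).
  by apply: measurable_all_weights; exact: measurable_itv.
by apply/seteqP; split => w /= H i iN; have := H i iN; rewrite in_itv.
Qed.

Lemma prob_all_lt n x :
  (P [set w | forall i, (1 <= i <= n)%N -> (weight i w < x)%R] <=
   (expR (- (n%:R * tail W x)))%:E)%E.
Proof.
rewrite (_ : mkset _ = [set w | forall i, (1 <= i <= n)%N -> `]-oo, x[%classic (weight i w)]); last first.
  by apply/seteqP; split => w /= H i iN; have := H i iN; rewrite in_itv.
rewrite (prob_all_weights law indep); last exact: measurable_itv.
have -> : law_of W `]-oo, x[ = 1 - tail W x.
  rewrite tailE -law_ofC; last exact: measurable_itv.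
  by rewrite setCitvr.
rewrite lee_fin -mulrN expRM_natl lerXn2r ?nnegrE ?expR_ge0 ?subr_ge0 ?tail_le1//.
exact: expR_ge1Dx.
Qed.

End weight_tails.

(** * Stretched exponential tails *)

Section stretched_exponential_profile.
Context {R : realType}.
Variable p : R.
Hypothesis p_gt0 : 0 < p.

(** Heuristically, vertices of index [n ^ s] have scores of order
    [(log n) ^ (1 + p) * profile s]. *)
Definition profile (s : R) : R := s `^ p * (1 - s).

Definition profile_max : R := p / (1 + p).

Lemma profile_max_bounds : 0 < profile_max /\ profile_max < 1.
Proof.
have p1 : 0 < 1 + p by rewrite addr_gt0.
rewrite /profile_max divr_gt0//; split => //.
by rewrite ltr_pdivrMr// mul1r ltrDr.
Qed.

Lemma profile_max_gt0 : 0 < profile profile_max.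
Proof.
have [g0 g1] := profile_max_bounds.
by rewrite mulr_gt0 ?powR_gt0// subr_gt0.
Qed.

(** The defect [(sqrt u - 1) ^ 2] measures how far the tangent line bound
    [ln u <= u - 1] is from being sharp. *)
Lemma ln_le_sqrt_defect (u : R) : 0 < u -> ln u <= u - 1 - (Num.sqrt u - 1) ^+ 2.
Proof.
move=> u0; have s0 : 0 < Num.sqrt u by rewrite sqrtr_gt0.
have uE : u = Num.sqrt u ^+ 2 by rewrite sqr_sqrtr// ltW.
have : ln (1 + (Num.sqrt u - 1)) <= Num.sqrt u - 1 by apply: le_ln1Dx; lra.
rewrite addrC subrK => h.
rewrite {1 2}uE lnXn// mulr2n; nra.
Qed.

(** At the maximiser the tangent lines of the two logarithms cancel, and only the
    defect remains. *)
Lemma profile_defect s : 0 < s -> s < 1 ->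
  profile s <= expR (- (Num.sqrt ((1 - s) / (1 - profile_max)) - 1) ^+ 2)
               * profile profile_max.
Proof.
move=> s0 s1; have [g0 g1] := profile_max_bounds.
have p1 : 0 < 1 + p by rewrite addr_gt0.
have g10 : 0 < 1 - profile_max by rewrite subr_gt0.
have s10 : 0 < 1 - s by rewrite subr_gt0.
have sp : 0 < s `^ p by exact: powR_gt0.
have gp : 0 < profile_max `^ p by exact: powR_gt0.
have ps : 0 < profile s by rewrite mulr_gt0 ?powR_gt0.
rewrite -ler_ln ?posrE ?mulr_gt0 ?expR_gt0 ?profile_max_gt0//.
rewrite lnM ?posrE ?expR_gt0 ?profile_max_gt0// expRK.
rewrite /profile !lnM ?posrE// !ln_powR.
have h1 : ln s <= ln profile_max + (s / profile_max - 1).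
  rewrite -lerBlDl -ln_div ?posrE//.
  have : ln (1 + (s / profile_max - 1)) <= s / profile_max - 1.
    by apply: le_ln1Dx; have : 0 < s / profile_max by [rewrite divr_gt0]; lra.
  by rewrite addrC subrK.
have := @ln_le_sqrt_defect ((1 - s) / (1 - profile_max)) (divr_gt0 s10 g10).
rewrite ln_div ?posrE// => h2.
have h3 := ler_wpM2l (ltW p_gt0) h1.
have e1 : p * (s / profile_max - 1) = (1 + p) * s - p.
  by rewrite /profile_max; field; rewrite !gt_eqF.
have e2 : (1 - s) / (1 - profile_max) = (1 + p) * (1 - s).
  rewrite /profile_max; field; rewrite (gt_eqF p1) /=.
  by rewrite (_ : 1 + p - p = 1) ?oner_eq0//; ring.
rewrite e2 in h2 *; lra.
Qed.

Lemma profile_le s : 0 <= s <= 1 -> profile s <= profile profile_max.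
Proof.
move=> /andP[]; rewrite le_eqVlt => /predU1P[<-|s0].
  by rewrite /profile powR0 ?gt_eqF// mul0r => _; exact: ltW profile_max_gt0.
rewrite le_eqVlt => /predU1P[->|s1].
  by rewrite {1}/profile subrr mulr0 ltW// profile_max_gt0.
apply: le_trans (profile_defect s0 s1) _.
apply: ler_piMl; first exact: ltW profile_max_gt0.
by rewrite expR_le1 oppr_le0 sqr_ge0.
Qed.

Lemma profile_far e : 0 < e -> exists2 eta : R, 0 < eta &
  forall s, 0 <= s <= 1 -> e <= `|s - profile_max| ->
    profile s <= (1 - eta) * profile profile_max.
Proof.
move=> e0; have [g0 g1] := profile_max_bounds.
have p1 : 0 < 1 + p by rewrite addr_gt0.
have M0 : 0 < Num.sqrt (1 + p) + 1 by rewrite ltr_wpDl// sqrtr_ge0.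
pose k := (e / (Num.sqrt (1 + p) + 1)) ^+ 2.
have k0 : 0 < k by rewrite exprn_gt0// divr_gt0.
exists (Num.min (1 - expR (- k)) 1); first by rewrite lt_min ltr01 subr_gt0 expR_lt1 oppr_lt0 k0.
move=> s /andP[]; have G0 := profile_max_gt0.
have triv : 0 <= (1 - Num.min (1 - expR (- k)) 1) * profile profile_max.
  by rewrite mulr_ge0 ?(ltW G0)// subr_ge0 ge_min lexx orbT.
rewrite le_eqVlt => /predU1P[<-|s0].
  by rewrite {1}/profile powR0 ?gt_eqF// mul0r.
rewrite le_eqVlt => /predU1P[->|s1]; first by rewrite {1}/profile subrr mulr0.
move=> far; apply: le_trans (profile_defect s0 s1) _.
apply: ler_wpM2r; first exact: ltW.
apply: (@le_trans _ _ (expR (- k))); last by rewrite lerBrDl addrC -lerBrDl ge_min lexx.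
rewrite ler_expR lerN2.
set u := (1 - s) / (1 - profile_max).
have e2 : u = (1 + p) * (1 - s).
  rewrite /u /profile_max; field; rewrite (gt_eqF p1) /=.
  by rewrite (_ : 1 + p - p = 1) ?oner_eq0//; ring.
have u0 : 0 <= u by rewrite e2 mulr_ge0// ?ltW// subr_gt0.
have su0 : 0 <= Num.sqrt u by exact: sqrtr_ge0.
have suM : Num.sqrt u + 1 <= Num.sqrt (1 + p) + 1.
  rewrite lerD2r ler_wsqrtr// e2 ler_piMr ?(ltW p1)//; lra.
have d1 : e <= `|u - 1|.
  apply: le_trans far _.
  have -> : u - 1 = - (1 + p) * (s - profile_max).
    by rewrite e2 /profile_max; field; rewrite gt_eqF.
  by rewrite normrM normrN (gtr0_norm p1) ler_peMl// lerDl ltW.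
have d2 : `|u - 1| = `|Num.sqrt u - 1| * (Num.sqrt u + 1).
  have -> : u - 1 = (Num.sqrt u - 1) * (Num.sqrt u + 1).
    by rewrite -{1}(sqr_sqrtr u0); ring.
  by rewrite normrM [X in _ * X]ger0_norm// addr_ge0.
rewrite /k -(real_normK (num_real (Num.sqrt u - 1))) lerXn2r ?nnegrE ?divr_ge0 ?(ltW e0) ?(ltW M0)//.
rewrite ler_pdivrMr//; apply: le_trans d1 _; rewrite d2.
by rewrite ler_wpM2l.
Qed.

End stretched_exponential_profile.

Section stretched_exponential_case.
Context {R : realType} {d : measure_display} {T : measurableType d}.
Variables (P : probability T R) (m : nat).
Variables (weight : nat -> {RV P >-> R}) (target : nat -> 'I_m -> {RV P >-> nat}).
Variable W : {RV P >-> R}.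
Hypothesis m_ge1 : (1 <= m)%N.
Hypothesis wrg : weighted_recursive_graph weight target W.
Hypothesis W_ge0 : forall w, 0 <= W w.
Hypothesis total_weight_law : {ae P, forall w, forall e : R, 0 < e ->
  \forall n \near \oo, `|total_weight weight n w - n%:R| <= e * n%:R}.
Variables (a c1 tau b : R).
Hypothesis RV : case_RV W a c1 tau b.

Let law := weight_law wrg.
Let indep := weight_indep wrg.
Let a_gt0 : 0 < a. Proof. by case: RV. Qed.
Let c1_gt0 : 0 < c1. Proof. by case: RV. Qed.
Let tau_gt0 : 0 < tau. Proof. by case: RV. Qed.
Let p := tau^-1.
Let p_gt0 : 0 < p. Proof. by rewrite invr_gt0. Qed.

(** The polynomial factor of the tail is absorbed by changing the exponent by any
    factor other than 1. *)
Lemma RV_tail_bounds e : 0 < e -> \forall y \near +oo,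
  expR (- ((1 + e) * y)) <= tail W (c1 * y `^ p) <= expR (- ((1 - e) * y)).
Proof.
move=> e0.
have foo A : \forall y \near +oo, A <= c1 * y `^ p.
  apply: filterS (near_powR_ge (A / c1) p_gt0) => y.
  by rewrite ler_pdivrMr// mulrC.
have RVt : \forall y \near +oo, `|1 - tail W (c1 * y `^ p) /
    (a * (c1 * y `^ p) `^ b * expR (- (c1 * y `^ p / c1) `^ tau))| <= 1 / 2.
  apply: (near_pinfty_comp (Q := fun x => `|1 - tail W x /
    (a * x `^ b * expR (- (x / c1) `^ tau))| <= 1 / 2) foo); case: RV => _ _ _ /cvgrPdist_le.
  by apply; rewrite divr_gt0.
near=> y.
have y1 : 1 <= y by near: y; exact: near_pinfty_ge.
have y0 : 0 < y by apply: lt_le_trans y1.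
have yp : 0 < y `^ p by rewrite powR_gt0.
have : `|1 - tail W (c1 * y `^ p) /
    (a * (c1 * y `^ p) `^ b * expR (- (c1 * y `^ p / c1) `^ tau))| <= 1 / 2.
  by near: y.
have -> : (c1 * y `^ p / c1) `^ tau = y.
  rewrite mulrC mulKf ?gt_eqF// -powRrM mulVf ?gt_eqF// powRr1// ltW//.
set t := tail W _; set q := a * _ `^ b.
have q0 : 0 < q by rewrite mulr_gt0// powR_gt0// mulr_gt0.
have lnq : ln q = ln a + b * ln c1 + b * p * ln y.
  rewrite /q lnM ?posrE ?powR_gt0 ?mulr_gt0// ln_powR lnM ?posrE// ln_powR.
  by ring.
have l1 : `|ln a + b * ln c1 + ln 2 + b * p * ln y| <= e * y.
  by near: y; exact: near_log_abs.
have l2 : `|ln a + b * ln c1 - ln 2 + b * p * ln y| <= e * y.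
  by near: y; exact: near_log_abs.
have D0 : 0 < q * expR (- y) by rewrite mulr_gt0 ?expR_gt0.
move=> /ler_normlP[h1 h2].
have t1 : 1 / 2 * (q * expR (- y)) <= t by rewrite -ler_pdivlMr//; lra.
have t2 : t <= 2 * (q * expR (- y)).
  by rewrite -ler_pdivrMr//; lra.
apply/andP; split.
  apply: le_trans t1; rewrite -[q]lnK ?posrE// -[1 / 2]lnK ?posrE ?divr_gt0//.
  rewrite -!expRD ler_expR lnq div1r lnV ?posrE//.
  by move/ler_normlP : l2 => [? ?]; lra.
apply: le_trans t2 _; rewrite -[q]lnK ?posrE// -[2 in X in X <= _]lnK ?posrE//.
rewrite -!expRD ler_expR lnq.
by move/ler_normlP : l1 => [? ?]; lra.
Unshelve. all: by end_near. Qed.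

Lemma RV_tail_bounds_ln e k : 0 < e -> 0 < k -> \forall n \near \oo,
  expR (- ((1 + e) * (k * ln n%:R))) <= tail W (c1 * (k * ln n%:R) `^ p)
    <= expR (- ((1 - e) * (k * ln n%:R))).
Proof. by move=> e0 k0; exact: (near_mul_ln k0 (RV_tail_bounds e0)). Qed.

(** At this level the tail is at most [i ^ (- (1 + alpha))] for some [alpha > 0],
    which is summable. *)
Lemma RV_weight_le e : 0 < e ->
  eventually_as P (fun i => [set w | weight i w <= (1 + e) * (c1 * ln i%:R `^ p)]).
Proof.
move=> e0.
pose q := (1 + e) `^ tau.
have q1 : 1 < q.
  rewrite /q /powR gt_eqF ?addr_gt0// expR_gt1 mulr_gt0// ln_gt0//; lra.
have q0 : 0 < q by lra.
pose e' := (q - 1) / (2 * q).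
have e'0 : 0 < e' by rewrite divr_gt0 ?mulr_gt0// subr_gt0.
pose alpha := (q - 1) / 2.
have al0 : 0 < alpha by rewrite divr_gt0// subr_gt0.
have eE : (1 - e') * q = 1 + alpha by rewrite /e' /alpha; field; rewrite gt_eqF.
apply: (@borel_cantelli_powR _ _ _ P _
  (fun i => [set w | (1 + e) * (c1 * ln i%:R `^ p) <= weight i w]) 1 alpha) => //.
- by move=> i; exact: measurable_ge_fun.
- by move=> i w /= /negP; rewrite -ltNge => /ltW.
near=> i.
have i1 : (1 <= i)%N by near: i; exact: nbhs_infty_ge.
have i0 : 0 < i%:R :> R by rewrite ltr0n.
have li0 : 0 <= ln i%:R :> R by rewrite ln_ge0// ler1n.
have := weight_tail law ((1 + e) * (c1 * ln i%:R `^ p)) i1 => ->.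
rewrite lee_fin mul1r.
have -> : (1 + e) * (c1 * ln i%:R `^ p) = c1 * (q * ln i%:R) `^ p.
  rewrite powRM// ?(ltW q0)// /q -powRrM mulfV ?gt_eqF// powRr1; first by ring.
  lra.
have /andP[_ h] : expR (- ((1 + e') * (q * ln i%:R))) <= tail W (c1 * (q * ln i%:R) `^ p)
    <= expR (- ((1 - e') * (q * ln i%:R))).
  by near: i; exact: RV_tail_bounds_ln.
apply: le_trans h _; rewrite mulrA eE /powR gt_eqF// mulNr.
exact: lexx.
Unshelve. all: by end_near. Qed.

(** The finitely many exceptional weights are absorbed by the additive term. *)
Lemma RV_all_weights_le e : 0 < e ->
  eventually_as P (fun n => [set w | forall i, (1 <= i <= n)%N ->
    weight i w <= (1 + e) * (c1 * ln i%:R `^ p) + e * ln n%:R `^ p]).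
Proof.
move=> e0; apply: filterS (RV_weight_le e0) => w [I0 _ HI].
pose M := \sum_(0 <= i < I0) `|weight i w|.
have [M' h] : exists M' : R, M' = M / e by eexists.
have near_M : \forall n \near \oo, M / e <= ln n%:R `^ p.
  by exact: (near_ln (near_powR_ge _ p_gt0)).
apply: filterS near_M => n; rewrite ler_pdivrMr// => Mn i iN.
have li0 : 0 <= ln i%:R `^ p :> R by exact: powR_ge0.
have [iI|Ii] := ltnP i I0.
  apply: (@le_trans _ _ M); last first.
    by rewrite mulrC in Mn; apply: le_trans Mn _; rewrite lerDr !mulr_ge0 ?(ltW c1_gt0)//; lra.
  rewrite (le_trans (ler_norm _))// /M (bigD1_seq i) ?mem_index_iota ?iota_uniq//=.
  by rewrite lerDl sumr_ge0.
by apply: le_trans (HI i Ii) _; rewrite lerDl mulr_ge0 ?powR_ge0// ltW.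
Qed.

Let gamma := 1 / (tau + 1).

Lemma gammaE : gamma = profile_max p.
Proof.
rewrite /gamma /profile_max /p; field.
by rewrite !gt_eqF// ?addr_gt0// invr_gt0.
Qed.

Let G := profile p gamma.
Let G_gt0 : 0 < G. Proof. by rewrite /G gammaE; exact: profile_max_gt0. Qed.
Let gamma_bounds : 0 < gamma < 1.
Proof. by rewrite gammaE; have [-> ->] := profile_max_bounds p_gt0. Qed.

Lemma ln_index_ratio (n i : nat) : 0 < ln (n%:R : R) -> (1 <= i <= n)%N ->
  0 <= ln (i%:R : R) / ln n%:R <= 1.
Proof.
move=> L0 iN; have [l0 lE] := @ln_div_index R n i iN; have /andP[i1 _] := iN.
rewrite divr_ge0 ?(ltW L0) ?ln_ge0 ?ler1n//= ler_pdivrMr// mul1r.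
by rewrite -subr_ge0 -lE.
Qed.

(** The scores are bounded by the profile, up to an error that is small compared
    to the maximal one. *)
Lemma RV_score_le e : 0 < e ->
  eventually_as P (fun n => [set w | forall i, (1 <= i <= n)%N ->
    degree_score weight n i w <= ((1 + e) * profile p (ln i%:R / ln n%:R) + e * G)
      * (c1 * ln n%:R `^ p * ln n%:R)]).
Proof.
move=> e0.
pose f := Num.min e (e * G * c1).
have f0 : 0 < f by rewrite lt_min e0 /= mulr_gt0// mulr_gt0.
have [fe fG] : f <= e /\ f <= e * G * c1 by rewrite !ge_min !lexx orbT.
apply: (modeS (eventually_as_mode P) _ (RV_all_weights_le f0)).
near=> n => w /= h i iN.
have [l0 lE] := @ln_div_index R n i iN.
have L0 : 0 < ln n%:R :> R.
  by apply: (@lt_le_trans _ _ 1) => //; near: n; exact: near_ln_ge.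
have := ln_index_ratio L0 iN; set s := _ / _ => /andP[s0 s1].
have liE : ln i%:R = s * ln n%:R :> R by rewrite /s divfK// gt_eqF.
have lsE : ln (n%:R / i%:R) = (1 - s) * ln n%:R :> R by rewrite lE liE; ring.
rewrite /degree_score; apply: le_trans (ler_wpM2r l0 (h i iN)) _.
rewrite lsE liE powRM// ?(ltW L0)// /profile.
have sp : 0 <= s `^ p by exact: powR_ge0.
have Lp : 0 <= ln n%:R `^ p by exact: powR_ge0.
set x := s `^ p in sp *; set L := ln n%:R in L0 *; set y := L `^ p in Lp *.
have yL : 0 <= y * L by rewrite mulr_ge0// ltW.
have -> : ((1 + f) * (c1 * (x * y)) + f * y) * ((1 - s) * L) =
   ((1 + f) * (c1 * x) * (1 - s) + f * (1 - s)) * (y * L) by ring.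
have -> : ((1 + e) * (x * (1 - s)) + e * G) * (c1 * y * L) =
   ((1 + e) * (c1 * x) * (1 - s) + e * G * c1) * (y * L) by ring.
apply: ler_wpM2r => //; apply: lerD.
  apply: ler_wpM2r; first by rewrite subr_ge0.
  by apply: ler_wpM2r; [rewrite mulr_ge0// ltW|rewrite lerD2l].
by apply: le_trans _ fG; rewrite ler_piMr ?(ltW f0)// lerBlDr lerDl.
Unshelve. all: by end_near. Qed.

(** Among the first [n ^ gamma] vertices, the mean number of weights above
    [(1 - e) * c1 * (gamma * log n) ^ p] is a positive power of [n]. *)
Lemma RV_score_ge e : 0 < e ->
  eventually_as P (fun n => [set w | exists2 i, (1 <= i <= n)%N &
    (1 - e) * (c1 * G * ln n%:R `^ p * ln n%:R) <= degree_score weight n i w]).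
Proof.
move=> e0'; have /andP[g0 g1] := gamma_bounds.
wlog e1 : e e0' / e < 1.
  move=> hw; have [/hw|e1] := ltP e 1; first exact.
  apply: (modeS (eventually_as_mode P) _ (hw (1 / 2) _ _)); [|by rewrite divr_gt0|lra].
  near=> n => w /= [i iN h]; exists i => //; apply: le_trans h.
  apply: ler_wpM2r; last lra.
  apply: mulr_ge0; last by rewrite ln_ge0// ler1n; near: n; exact: nbhs_infty_ge.
  by apply: mulr_ge0; [apply: ltW; exact: mulr_gt0|exact: powR_ge0].
have e10 : 0 < 1 - e by rewrite subr_gt0.
pose q := (1 - e) `^ tau.
have q0 : 0 < q by rewrite powR_gt0.
have q1 : q < 1.
  rewrite /q /powR gt_eqF// expR_lt1 pmulr_rlt0// ln_lt0// e10; lra.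
pose e' := (1 - q) / (2 * q).
have e'0 : 0 < e' by rewrite divr_gt0 ?mulr_gt0// subr_gt0.
pose alpha := (1 - q) / 2.
have al0 : 0 < alpha by rewrite divr_gt0// subr_gt0.
have eE : (1 + e') * q = 1 - alpha by rewrite /e' /alpha; field; rewrite gt_eqF.
pose N := root_index gamma.
have NN : \forall n \near \oo, (2 <= N n)%N.
  exact: (root_index_infty g0 (nbhs_infty_ge 2)).
pose x n := c1 * (q * (gamma * ln n%:R)) `^ p.
have xE n : (1 <= n)%N -> x n = (1 - e) * (c1 * (gamma * ln n%:R) `^ p).
  move=> n1; have L0 : 0 <= ln n%:R :> R by rewrite ln_ge0// ler1n.
  have gL : 0 <= gamma * ln n%:R by rewrite mulr_ge0// ltW.
  have qp : q `^ p = 1 - e.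
    by rewrite /q -powRrM mulfV ?gt_eqF// powRr1// ltW.
  by rewrite /x powRM ?(ltW q0)// qp; ring.
have ev : eventually_as P (fun n => [set w | exists2 i, (1 <= i <= N n)%N & x n <= weight i w]).
  apply: (@borel_cantelli_square _ _ _ P _
    (fun n => [set w | forall i, (1 <= i <= N n)%N -> weight i w < x n]) 1).
  - by move=> n; exact: measurable_all_lt.
  - move=> n w /= nA i iN; rewrite ltNge; apply/negP => h; apply: nA.
    by exists i.
  have qg0 : 0 < q * gamma by rewrite mulr_gt0.
  near=> n.
  have n1 : (1 <= n)%N by near: n; exact: nbhs_infty_ge.
  have n0 : 0 < n%:R :> R by rewrite ltr0n.
  apply: le_trans (prob_all_lt law indep (N n) (x n)) _.
  rewrite lee_fin div1r -[n%:R ^+ 2]lnK ?posrE ?exprn_gt0// -expRN ler_expR lerN2 lnXn//.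
  have /andP[h _] : expR (- ((1 + e') * (q * gamma * ln n%:R))) <= tail W (c1 * (q * gamma * ln n%:R) `^ p)
      <= expR (- ((1 - e') * (q * gamma * ln n%:R))).
    by near: n; exact: RV_tail_bounds_ln.
  have {h} h : expR (- ((1 - alpha) * (gamma * ln n%:R))) <= tail W (x n).
    by rewrite /x (mulrA q); apply: le_trans _ h; rewrite -eE !mulrA.
  have N2 : (2 <= N n)%N.
    by near: n; exact: NN.
  have N0 : 0 < (N n)%:R :> R by rewrite ltr0n (leq_trans _ N2)//.
  have Nge : 1 / 2 * expR (gamma * ln n%:R) <= (N n)%:R.
    have := root_index_gt gamma n; rewrite /powR gt_eqF// -/(N n) => lt.
    have : 1 <= (N n)%:R :> R by rewrite ler1n (leq_trans _ N2)//.
    lra.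
  have Lbig : 8 / (alpha * gamma) ^+ 2 <= ln n%:R by near: n; exact: near_ln_ge.
  set L := ln n%:R in h Nge Lbig *.
  have L0 : 0 <= L by rewrite ln_ge0// ler1n.
  have key : 1 / 2 * expR (alpha * gamma * L) <= (N n)%:R * tail W (x n).
    apply: (@le_trans _ _ ((1 / 2 * expR (gamma * L)) * expR (- ((1 - alpha) * (gamma * L))))).
      rewrite -[leRHS]mulrA -expRD ler_wpM2l ?divr_ge0// ler_expR le_eqVlt.
      by apply/orP; left; apply/eqP; ring.
    by apply: ler_pM => //; rewrite ?expR_ge0// mulr_ge0 ?expR_ge0// divr_ge0.
  apply: le_trans key.
  have z0 : 0 <= alpha * gamma * L by exact: (mulr_ge0 (mulr_ge0 (ltW al0) (ltW g0)) L0).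
  have := expR_ge1Dxn 1 z0; set z := alpha * gamma * L in z0 *.
  rewrite (_ : 2`! = 2%N)// => hz.
  have ag0 : 0 < alpha * gamma by rewrite mulr_gt0.
  have z2 : 8 * L <= z ^+ 2.
    rewrite /z exprMn [L ^+ 2]expr2 mulrA ler_wpM2r//.
    by rewrite mulrC -ler_pdivrMr// exprn_gt0.
  rewrite mulr2n; lra.
apply: (modeS (eventually_as_mode P) _ ev).
near=> n => w /= [i iN Wi].
have n1 : (1 <= n)%N by near: n; exact: nbhs_infty_ge.
have L0 : 0 < ln n%:R :> R.
  by apply: (@lt_le_trans _ _ 1) => //; near: n; exact: near_ln_ge.
have [i1 iN'] := andP iN.
have iL : ln i%:R <= gamma * ln n%:R :> R.
  apply: le_trans (ln_root_index_le n1 (leq_trans i1 iN')).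
  by rewrite ler_ln ?posrE ?ltr0n ?(leq_trans i1)// ler_nat.
have in' : (1 <= i <= n)%N.
  rewrite i1 -(ler_nat R) -ler_ln ?posrE ?ltr0n//.
  by apply: le_trans iL _; rewrite ler_piMl// ltW.
exists i => //; have [l0 lE] := @ln_div_index R n i in'.
rewrite xE// in Wi.
apply: (@le_trans _ _ ((1 - e) * (c1 * (gamma * ln n%:R) `^ p) * ((1 - gamma) * ln n%:R))).
  rewrite powRM ?(ltW g0) ?(ltW L0)// /G /profile le_eqVlt.
  by apply/orP; left; apply/eqP; ring.
apply: ler_pM => //.
- by rewrite !mulr_ge0 ?powR_ge0 ?(ltW e10) ?(ltW c1_gt0).
- by rewrite mulr_ge0 ?(ltW L0)// subr_ge0 ltW.
- by rewrite lE; lra.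
Unshelve. all: by end_near. Qed.

(** The correction term in [RV_center] is of relative order
    [log (log n) / log n]. *)
Lemma RV_center_equiv e : 0 < e -> \forall n \near \oo,
  `|c1 * (gamma * ln n%:R) `^ p / RV_center a c1 tau b (n%:R `^ gamma) - 1| <= e.
Proof.
move=> e0; have /andP[g0 g1] := gamma_bounds.
pose K := b * ln c1 + ln a.
pose e' := tau * Num.min (e / 2) (1 / 2).
have e'0 : 0 < e' by rewrite mulr_gt0// lt_min !divr_gt0.
near=> n.
have L1 : 1 <= gamma * ln n%:R.
  by near: n; exact: (near_mul_ln g0 (near_pinfty_ge 1)).
have hl : `|K + b / tau * ln (gamma * ln n%:R)| <= e' * (gamma * ln n%:R).
  by near: n; exact: (near_mul_ln g0 (near_log_abs _ _ e'0)).
rewrite /RV_center /RV_scale ln_powR -/p.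
set l := gamma * ln n%:R in L1 hl *.
have l0 : 0 < l by apply: lt_le_trans L1.
pose z := (K + b / tau * ln l) / (tau * l).
have lp : 0 < l `^ p by rewrite powR_gt0.
have -> : c1 * l `^ p / (c1 * l `^ p + c1 / tau * l `^ (p - 1) *
    (b / tau * ln l + b * ln c1 + ln a)) = (1 + z)^-1.
  have -> : l `^ (p - 1) = l `^ p / l.
    rewrite powRB; last by rewrite (gt_eqF l0) implybT.
    by rewrite powRr1 ?(ltW l0).
  have -> : c1 * l `^ p + c1 / tau * (l `^ p / l) * (b / tau * ln l + b * ln c1 + ln a)
      = c1 * l `^ p * (1 + z).
    by rewrite /z /K; field; rewrite !gt_eqF.
  have z0 : c1 * l `^ p != 0 by rewrite gt_eqF// mulr_gt0.
  by rewrite invfM mulrA divff// mul1r.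
have zb : `|z| <= Num.min (e / 2) (1 / 2).
  have tl0 : 0 < tau * l by exact: mulr_gt0.
  rewrite /z normrM normfV (gtr0_norm tl0) ler_pdivrMr//; apply: le_trans hl _.
  by rewrite /e' le_eqVlt; apply/orP; left; apply/eqP; ring.
move: zb; rewrite le_min => /andP[z1 z2].
exact: inv_ratio_near1.
Unshelve. all: by end_near. Qed.

(** The scores follow [profile], which is maximal at [gamma] only. *)
Theorem stretched_exponential_case :
  cvg_almost_surely P
    (fun n w =>
       (max_upto n (fun i =>
          (indegree target n i w)%:R /
          (m%:R * (1 - gamma) * RV_center a c1 tau b (n%:R `^ gamma) * ln n%:R)),
        ln (max_degree_label target n w)%:R / ln n%:R) : R * R)
    (1, gamma).
Proof.
have /andP[g0 g1] := gamma_bounds.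
pose v n : R := c1 * G * ln n%:R `^ p * ln n%:R.
have cG : 0 < c1 * G by rewrite mulr_gt0.
have Lge A : \forall n \near \oo, A <= ln n%:R `^ p :> R.
  by exact: (near_ln (near_powR_ge _ p_gt0)).
have v0 : \forall n \near \oo, 0 < v n.
  near=> n; have L0 : 0 < ln n%:R :> R.
    by apply: (@lt_le_trans _ _ 1) => //; near: n; exact: near_ln_ge.
  by apply: mulr_gt0 => //; apply: mulr_gt0 => //; exact: powR_gt0.
apply: eventually_as_cvg; apply: (@argmax_in_degree _ _ _ P m weight target W m_ge1 wrg W_ge0
  total_weight_law v (fun n => (2 * c1 + 1) * ln n%:R `^ p)).
- move=> A; near=> n; rewrite /v ler_wpM2r//.
    by rewrite ln_ge0// ler1n; near: n; exact: nbhs_infty_ge.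
  by rewrite -ler_pdivrMl//; near: n; exact: Lge.
- move=> e e0; near=> n; rewrite /v.
  have c21 : 0 < 2 * c1 + 1 by rewrite addr_gt0// mulr_gt0.
  have -> : e * (c1 * G * ln n%:R `^ p * ln n%:R) = e * (c1 * G) * ln n%:R * ln n%:R `^ p by ring.
  rewrite ler_wpM2r ?powR_ge0// -ler_pdivrMl; last exact: mulr_gt0.
  by near: n; exact: near_ln_ge.
- exact: eventually_as_mode.
- by [].
- exact: v0.
- move=> e e0; near=> n.
  have L0 : 0 < ln n%:R :> R.
    by apply: (@lt_le_trans _ _ 1) => //; near: n; exact: near_ln_ge.
  have m0 : m%:R != 0 :> R by rewrite pnatr_eq0 -lt0n.
  have [r0|r0] := eqVneq (RV_center a c1 tau b (n%:R `^ gamma)) 0.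
    have : `|c1 * (gamma * ln n%:R) `^ p / RV_center a c1 tau b (n%:R `^ gamma) - 1| <= Num.min e (1 / 2).
      by near: n; apply: RV_center_equiv; rewrite lt_min e0 divr_gt0.
    rewrite r0 invr0 mulr0 sub0r normrN normr1 le_min => /andP[_ h].
    by exfalso; lra.
  have -> : m%:R * v n / (m%:R * (1 - gamma) * RV_center a c1 tau b (n%:R `^ gamma) * ln n%:R) =
     c1 * (gamma * ln n%:R) `^ p / RV_center a c1 tau b (n%:R `^ gamma).
    have -> : (gamma * ln n%:R) `^ p = gamma `^ p * ln n%:R `^ p.
      exact: (powRM _ (ltW g0) (ltW L0)).
    rewrite /v /G /profile; field.
    by rewrite m0 r0 (gt_eqF L0) subr_eq0 eq_sym (lt_eqF g1).
  by near: n; exact: RV_center_equiv.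
- apply: (modeS (eventually_as_mode P) _ (RV_all_weights_le ltr01)).
  near=> n => w /= h i iN; apply: le_trans (h i iN) _.
  have L0 : 0 <= ln n%:R :> R by rewrite ln_ge0// ler1n; near: n; exact: nbhs_infty_ge.
  have [l0 lE] := @ln_div_index R n i iN; have /andP[i1 _] := iN.
  have : c1 * ln i%:R `^ p <= c1 * ln n%:R `^ p.
    rewrite ler_wpM2l ?(ltW c1_gt0)//; apply: ge0_ler_powR.
    - exact: ltW.
    - by rewrite nnegrE ln_ge0// ler1n.
    - by rewrite nnegrE.
    - by rewrite -subr_ge0 -lE.
  lra.
- move=> e e0; have e20 : 0 < e / 2 by rewrite divr_gt0.
  apply: (modeS (eventually_as_mode P) _ (RV_score_le e20)).
  near=> n => w /= h i iN; apply: le_trans (h i iN) _.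
  have L0 : 0 < ln n%:R :> R.
    by apply: (@lt_le_trans _ _ 1) => //; near: n; exact: near_ln_ge.
  have pr := profile_le p_gt0 (ln_index_ratio L0 iN).
  rewrite -gammaE -/G in pr.
  have x0 : 0 <= c1 * ln n%:R `^ p * ln n%:R.
    by rewrite !mulr_ge0 ?powR_ge0// ltW.
  rewrite (_ : (1 + e) * v n = (1 + e) * G * (c1 * ln n%:R `^ p * ln n%:R)); last by rewrite /v; ring.
  apply: ler_wpM2r => //.
  have := ler_wpM2l (_ : 0 <= 1 + e / 2) pr; move=> /(_ ltac:(lra)); lra.
- exact: RV_score_ge.
- move=> e e0; have [eta eta0 far] := profile_far p_gt0 e0.
  exists (Num.min eta 1 / 2); first by rewrite divr_gt0// lt_min eta0 ltr01.
  have e40 : 0 < Num.min eta 1 / 4 by rewrite divr_gt0// lt_min eta0 ltr01.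
  apply: (modeS (eventually_as_mode P) _ (RV_score_le e40)).
  near=> n => w /= h i iN farI; apply: le_trans (h i iN) _.
  have L0 : 0 < ln n%:R :> R.
    by apply: (@lt_le_trans _ _ 1) => //; near: n; exact: near_ln_ge.
  rewrite gammaE in farI.
  have pr := far _ (ln_index_ratio L0 iN) farI.
  rewrite -gammaE -/G in pr.
  have x0 : 0 <= c1 * ln n%:R `^ p * ln n%:R.
    by rewrite !mulr_ge0 ?powR_ge0// ltW.
  set f := Num.min eta 1 / 4 in e40 *.
  have [f1 f2] : 4 * f <= eta /\ 4 * f <= 1.
    by rewrite /f mulrC divfK//; rewrite !ge_min !lexx orbT.
  have -> : Num.min eta 1 / 2 = 2 * f by rewrite /f; field.
  rewrite (_ : (1 - 2 * f) * v n = (1 - 2 * f) * G * (c1 * ln n%:R `^ p * ln n%:R)); last by rewrite /v; ring.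
  apply: ler_wpM2r => //.
  have h1 : (1 + f) * profile p (ln i%:R / ln n%:R) <= (1 + f) * ((1 - 4 * f) * G).
    apply: ler_wpM2l; first by lra.
    apply: le_trans pr _; apply: ler_wpM2r; first exact: ltW.
    lra.
  have : 0 <= f * f * G by apply: mulr_ge0; [rewrite mulr_ge0// ltW|exact: ltW].
  lra.
Unshelve. all: by end_near. Qed.

End stretched_exponential_case.

(** * Log-normal-type tails *)

Section power_inequalities.
Context {R : realType}.
Implicit Types (A B e p u w tau : R).

(** Bernoulli's inequality for real exponents, from Young's inequality. *)
Lemma bernoulli_powR tau u : 1 < tau -> 0 <= 1 + u -> 1 + tau * u <= (1 + u) `^ tau.
Proof.
move=> t1 u1; have t0 : 0 < tau by apply: lt_trans t1.
have q0 : 0 < tau / (tau - 1) by rewrite divr_gt0// subr_gt0.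
have E : tau^-1 + (tau / (tau - 1))^-1 = 1.
  by field; rewrite (gt_eqF t0) subr_eq0 (gt_eqF t1).
have := conjugate_powR u1 ler01 t0 q0 E.
rewrite mulr1 powR1 => h.
have := ler_wpM2l (ltW t0) h.
set y := (1 + u) `^ tau.
have -> : tau * (y / tau + 1 / (tau / (tau - 1))) = y + (tau - 1).
  by field; rewrite (gt_eqF t0) subr_eq0 (gt_eqF t1).
lra.
Qed.

Lemma powR_le_tangent p w : 0 < p -> p < 1 -> 0 <= 1 + w -> (1 + w) `^ p <= 1 + p * w.
Proof.
move=> p0 p1 w1; set x := (1 + w) `^ p.
have x0 : 0 <= x by exact: powR_ge0.
have ip1 : 1 < p^-1 by rewrite invf_gt1.
have := @bernoulli_powR p^-1 (x - 1) ip1.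
rewrite addrC subrK => /(_ x0).
rewrite /x -powRrM mulfV ?gt_eqF// powRr1// -/x => h.
have := ler_wpM2l (ltW p0) h; rewrite mulrDr mulr1 mulrA mulfV ?gt_eqF// mul1r; lra.
Qed.

Lemma near_log_powR A B e p : 0 < e -> 0 < p ->
  \forall y \near +oo, A + B * ln y <= e * y `^ p.
Proof.
move=> e0 p0; have foo M : \forall y \near +oo, M <= y `^ p by exact: near_powR_ge.
have := near_pinfty_comp (Q := fun y => A + B / p * ln y <= e * y) foo (near_log_le _ _ e0).
apply: filterS => y; rewrite ln_powR mulrA divfK ?gt_eqF//.
Qed.

Lemma near_log_powR_abs A B e p : 0 < e -> 0 < p ->
  \forall y \near +oo, `|A + B * ln y| <= e * y `^ p.
Proof.
move=> e0 p0; near=> y; rewrite ler_norml; apply/andP; split.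
  have : - A + - B * ln y <= e * y `^ p by near: y; exact: near_log_powR.
  lra.
by near: y; exact: near_log_powR.
Unshelve. all: by end_near. Qed.

Lemma harmonic_sum_le (n : nat) : (1 <= n)%N ->
  \sum_(i < n) (i.+1%:R)^-1 <= 1 + ln n%:R :> R.
Proof.
case: n => // n _; elim: n => [|n IH].
  by rewrite big_ord_recr big_ord0 /= add0r invr1 ln1 addr0.
rewrite big_ord_recr /=; have /andP[h _] := @ln_succ_bounds R n.+1 isT.
rewrite natr1 in h; rewrite -(subrK (ln n.+1%:R) (ln n.+2%:R)) addrA (addrAC 1).
exact: lerD.
Qed.

End power_inequalities.

Section lognormal_tail.
Context {R : realType} {d : measure_display} {T : measurableType d}.
Variables (P : probability T R) (W : {RV P >-> R}).
Variables (a c1 tau b : R).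
Hypothesis RaV : case_RaV W a c1 tau b.

Let a_gt0 : 0 < a. Proof. by case: RaV. Qed.
Let c1_gt0 : 0 < c1. Proof. by case: RaV. Qed.
Let tau_gt1 : 1 < tau. Proof. by case: RaV. Qed.
Let tau_gt0 : 0 < tau. Proof. exact: lt_trans tau_gt1. Qed.
Let p := tau^-1.
Let p_gt0 : 0 < p. Proof. by rewrite invr_gt0. Qed.
Let p_lt1 : p < 1. Proof. by rewrite invf_lt1. Qed.

Lemma near_expR_ge (A : R) : \forall y \near +oo, A <= expR y.
Proof.
apply: filterS (near_pinfty_ge A) => y Ay; apply: le_trans Ay _.
by apply: le_trans (expR_ge1Dx y); rewrite lerDr.
Qed.

Lemma RaV_tail_bounds : exists2 Q : R, 0 < Q & \forall z \near +oo,
  expR (- (z / c1) `^ tau - Q * ln z) <= tail W (expR z) <=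
  expR (- (z / c1) `^ tau + Q * ln z).
Proof.
exists (`|b| + 1); first by rewrite ltr_pwDr.
have h : \forall z \near +oo, `|1 - tail W (expR z) /
    (a * ln (expR z) `^ b * expR (- (ln (expR z) / c1) `^ tau))| <= 1 / 2.
  apply: (near_pinfty_comp (Q := fun x => `|1 - tail W x /
    (a * ln x `^ b * expR (- (ln x / c1) `^ tau))| <= 1 / 2) near_expR_ge).
  by case: RaV => _ _ _ /cvgrPdist_le; apply; rewrite divr_gt0.
have lnoo : forall A : R, \forall z \near +oo, A <= ln z.
  move=> A; apply: filterS (near_pinfty_ge (expR A)) => z Az.
  have z0 : 0 < z by apply: lt_le_trans Az; exact: expR_gt0.
  by rewrite -ler_expR lnK// posrE.
near=> z.
have z1 : 1 <= z by near: z; exact: near_pinfty_ge.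
have z0 : 0 < z by apply: lt_le_trans z1.
have : `|1 - tail W (expR z) /
    (a * ln (expR z) `^ b * expR (- (ln (expR z) / c1) `^ tau))| <= 1 / 2 by near: z.
rewrite expRK; set t := tail W _; set y := (z / c1) `^ tau.
have q0 : 0 < a * z `^ b by rewrite mulr_gt0// powR_gt0.
have D0 : 0 < a * z `^ b * expR (- y) by rewrite mulr_gt0 ?expR_gt0.
move=> /ler_normlP[h1 h2].
have t1 : 1 / 2 * (a * z `^ b * expR (- y)) <= t by rewrite -ler_pdivlMr//; lra.
have t2 : t <= 2 * (a * z `^ b * expR (- y)) by rewrite -ler_pdivrMr//; lra.
have lz1 : `|ln a| + ln 2 <= ln z by near: z; exact: lnoo.
have ln2 : 0 <= ln 2 :> R by rewrite ln_ge0// ler1n.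
have lz0 : 0 <= ln z by rewrite ln_ge0.
have bl : `|b * ln z| <= `|b| * ln z by rewrite normrM (ger0_norm lz0).
move/ler_normlP : bl => [b1 b2].
have /ler_normlP[a1 a2] : `|ln a| <= `|ln a| by [].
have lq : ln (a * z `^ b) = ln a + b * ln z by rewrite lnM ?posrE ?powR_gt0// ln_powR.
apply/andP; split.
  apply: le_trans t1; rewrite -[a * _]lnK ?posrE// -[1 / 2]lnK ?posrE ?divr_gt0//.
  rewrite -!expRD ler_expR lq div1r lnV ?posrE//; lra.
apply: le_trans t2 _; rewrite -[a * _]lnK ?posrE// -[2 in X in X <= _]lnK ?posrE//.
rewrite -!expRD ler_expR lq; lra.
Unshelve. all: by end_near. Qed.

(** [scaleB n] is the order of the largest of [n] weights, and [scaleK n] that of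
    [log (n / i)] at the optimal index [i]. *)
Definition scaleB (n : nat) : R := expR (c1 * ln n%:R `^ p).
Definition scaleK (n : nat) : R := tau / c1 * ln n%:R `^ (1 - p).

Lemma near_ln_powR_ge (A q : R) : 0 < q -> \forall n \near \oo, A <= ln n%:R `^ q.
Proof. by move=> q0; exact: (near_ln (near_powR_ge A q0)). Qed.

Lemma near_ln_log (A B e q : R) : 0 < e -> 0 < q -> \forall n \near \oo,
  A + B * ln (ln n%:R) <= e * ln n%:R `^ q.
Proof. by move=> e0 q0; exact: (near_ln (near_log_powR A B e0 q0)). Qed.

Lemma scaleK_powR n : 0 < ln n%:R :> R -> scaleK n * ln n%:R `^ p = tau / c1 * ln n%:R.
Proof.
move=> L0; rewrite /scaleK -mulrA -powRD; last by rewrite (gt_eqF L0) implybT.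
by rewrite subrK powRr1// ltW.
Qed.

(** Shifting the logarithm of a weight by [l] changes the exponent of the tail by
    [scaleK n * l], with an error that only involves [log (log n)]. *)
Lemma RaV_tail_le : exists2 Q : R, 0 < Q & \forall n \near \oo, forall l : R,
  - (c1 / 2 * ln n%:R `^ p) <= l -> l <= c1 * ln n%:R `^ p ->
  tail W (scaleB n * expR l) <= expR (- ln n%:R - scaleK n * l + Q * ln (ln n%:R)).
Proof.
have [Q Q0 [M [Mr HM]]] := RaV_tail_bounds.
exists (Q + 1); first by rewrite addr_gt0.
near=> n => l l1 l2.
have L1 : 1 <= ln n%:R :> R by near: n; exact: near_ln_ge.
have L0 : 0 < ln n%:R :> R by apply: lt_le_trans L1.
have Lp : 2 / c1 * (`|M| + 1) <= ln n%:R `^ p by near: n; exact: near_ln_powR_ge.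
have Lp0 : 0 < ln n%:R `^ p by rewrite powR_gt0.
have LL : Q * ln (2 * c1) + Q * p * ln (ln n%:R) <= (Q + 1) * ln (ln n%:R).
  have l2c : Q * `|ln (2 * c1)| <= ln (ln n%:R).
    have : expR (Q * `|ln (2 * c1)|) <= ln n%:R by near: n; exact: near_ln_ge.
    by rewrite -[X in _ <= X -> _]lnK ?posrE// ler_expR.
  have : Q * ln (2 * c1) <= Q * `|ln (2 * c1)| by rewrite ler_wpM2l ?ler_norm// ltW.
  have : Q * p * ln (ln n%:R) <= Q * ln (ln n%:R).
    by rewrite ler_wpM2r ?ln_ge0// ler_piMr// ltW.
  lra.
set L := ln n%:R in L1 L0 Lp Lp0 LL l1 l2 *.
pose z := c1 * L `^ p + l.
have zlo : c1 / 2 * L `^ p <= z by rewrite /z; lra.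
have zhi : z <= 2 * c1 * L `^ p by rewrite /z; lra.
have Mz : `|M| + 1 <= z.
  have c20 : 0 <= c1 / 2 by rewrite divr_ge0// ltW.
  apply: le_trans zlo; have := ler_wpM2l c20 Lp.
  by rewrite [X in X <= _ -> _](_ : _ = `|M| + 1)//; field; rewrite gt_eqF.
have z0 : 0 < z by apply: lt_le_trans Mz; rewrite ltr_pwDr.
have /HM/andP[_ h] : M < z.
  by apply: lt_le_trans Mz; rewrite ltr_pwDr// ler_norm.
rewrite /scaleB -expRD -/L -/z; apply: le_trans h _; rewrite ler_expR.
have lz : ln z <= ln (2 * c1) + p * ln L.
  by rewrite -ln_powR -lnM ?posrE ?mulr_gt0// ler_ln ?posrE ?mulr_gt0.
have Qlz := ler_wpM2l (ltW Q0) lz.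
have zE : z / c1 = L `^ p * (1 + l / (c1 * L `^ p)).
  by rewrite /z; field; rewrite !gt_eqF.
have u0 : 0 <= 1 + l / (c1 * L `^ p).
  have cL : 0 < c1 * L `^ p by rewrite mulr_gt0.
  have uE : c1 * L `^ p * (1 + l / (c1 * L `^ p)) = z.
    by rewrite /z; field; rewrite !gt_eqF.
  by rewrite -(pmulr_rge0 _ cL) uE ltW.
have Bern := bernoulli_powR tau_gt1 u0.
have yE : (z / c1) `^ tau = L * (1 + l / (c1 * L `^ p)) `^ tau.
  by rewrite zE powRM ?powR_ge0// -powRrM mulVf ?gt_eqF// powRr1// ltW.
have Bern' : L + scaleK n * l <= (z / c1) `^ tau.
  rewrite yE; apply: le_trans (ler_wpM2l (ltW L0) Bern).
  rewrite le_eqVlt; apply/orP; left; apply/eqP.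
  have -> : L * (1 + tau * (l / (c1 * L `^ p))) = L + (tau / c1 * L) / L `^ p * l.
    by field; rewrite !gt_eqF.
  by rewrite -scaleK_powR// mulfK// gt_eqF.
lra.
Unshelve. all: by end_near. Qed.

(** The gap between [k] and [l] absorbs the second order of the exponent. *)
Lemma RaV_tail_ge (l k : R) : 0 < k -> k < l -> exists2 Q : R, 0 < Q &
  \forall n \near \oo,
  expR (- ln n%:R + scaleK n * k - Q * ln (ln n%:R)) <= tail W (scaleB n * expR (- l)).
Proof.
move=> k0 kl; have l0 : 0 < l by apply: lt_trans kl.
have [Q Q0 [M [Mr HM]]] := RaV_tail_bounds.
exists (Q + 1); first by rewrite addr_gt0.
near=> n.
have L1 : 1 <= ln n%:R :> R by near: n; exact: near_ln_ge.
have L0 : 0 < ln n%:R :> R by apply: lt_le_trans L1.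
have Lp : c1^-1 * (`|M| + 1 + l) <= ln n%:R `^ p by near: n; exact: near_ln_powR_ge.
have Lp2 : tau * l * k / (c1 * (l - k)) <= ln n%:R `^ p by near: n; exact: near_ln_powR_ge.
have Lp0 : 0 < ln n%:R `^ p by rewrite powR_gt0.
have LL : Q * ln c1 + Q * p * ln (ln n%:R) <= (Q + 1) * ln (ln n%:R).
  have l2c : Q * `|ln c1| <= ln (ln n%:R).
    have : expR (Q * `|ln c1|) <= ln n%:R by near: n; exact: near_ln_ge.
    by rewrite -[X in _ <= X -> _]lnK ?posrE// ler_expR.
  have : Q * ln c1 <= Q * `|ln c1| by rewrite ler_wpM2l ?ler_norm// ltW.
  have : Q * p * ln (ln n%:R) <= Q * ln (ln n%:R).
    by rewrite ler_wpM2r ?ln_ge0// ler_piMr// ltW.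
  lra.
have K0 : 0 <= scaleK n by rewrite /scaleK mulr_ge0 ?powR_ge0// divr_ge0// ltW.
have KL := scaleK_powR L0.
set L := ln n%:R in L1 L0 Lp Lp2 Lp0 LL KL *.
pose z := c1 * L `^ p - l.
have Mz : `|M| + 1 <= z.
  by move: Lp; rewrite mulrC ler_pdivrMr// /z; lra.
have z0 : 0 < z by apply: lt_le_trans Mz; rewrite ltr_pwDr.
have /HM/andP[h _] : M < z.
  by apply: lt_le_trans Mz; rewrite ltr_pwDr// ler_norm.
rewrite /scaleB -expRD -/L -/z; apply: le_trans h; rewrite ler_expR.
have lz : ln z <= ln c1 + p * ln L.
  rewrite -ln_powR -lnM ?posrE// ler_ln ?posrE ?mulr_gt0// /z; lra.
have Qlz := ler_wpM2l (ltW Q0) lz.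
pose u := l / (c1 * L `^ p).
have cL : 0 < c1 * L `^ p by rewrite mulr_gt0.
have u0 : 0 < u by rewrite divr_gt0.
have u1 : 0 < 1 - u by rewrite subr_gt0 /u ltr_pdivrMr// mul1r -subr_gt0.
have zE : z / c1 = L `^ p * (1 - u).
  by rewrite /z /u; field; rewrite !gt_eqF.
have yE : (z / c1) `^ tau = L * (1 - u) `^ tau.
  by rewrite zE powRM ?powR_ge0 ?(ltW u1)// -powRrM mulVf ?gt_eqF// powRr1// ltW.
(* (1 - u) ^ tau <= exp (- tau u) <= 1 / (1 + tau u) *)
have tu0 : 0 < tau * u by rewrite mulr_gt0.
have pw : (1 - u) `^ tau <= (1 + tau * u)^-1.
  rewrite /powR gt_eqF//; apply: (@le_trans _ _ (expR (- (tau * u)))).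
    by rewrite ler_expR -[- (tau * u)]mulrN ler_wpM2l ?(ltW tau_gt0)//; apply: le_ln1Dx; lra.
  rewrite expRN lef_pV2 ?posrE ?expR_gt0//; last by lra.
  exact: expR_ge1Dx.
have Ku : L * (tau * u) = scaleK n * l.
  have -> : L * (tau * u) = (tau / c1 * L) / L `^ p * l.
    by rewrite /u; field; rewrite !gt_eqF.
  by rewrite -KL mulfK// gt_eqF.
have kk : k * (1 + tau * u) <= l.
  have lk : 0 < l - k by rewrite subr_gt0.
  move: Lp2; rewrite ler_pdivrMr ?mulr_gt0// => Lp2.
  have : k * (tau * u) <= l - k.
    rewrite /u (_ : k * (tau * (l / (c1 * L `^ p))) = tau * l * k / (c1 * L `^ p)); last by ring.
    by rewrite ler_pdivrMr//; apply: le_trans Lp2 _; rewrite le_eqVlt; apply/orP; left; apply/eqP; ring.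
  lra.
have fin : (z / c1) `^ tau <= L - scaleK n * k.
  rewrite yE; apply: le_trans (ler_wpM2l (ltW L0) pw) _.
  have t1 : 0 < 1 + tau * u by lra.
  rewrite ler_pdivrMr// mulrDr mulr1 mulrBl Ku.
  have := ler_wpM2l K0 kk; lra.
lra.
Unshelve. all: by end_near. Qed.

End lognormal_tail.

Section perturbation.
Context {R : realType}.

Lemma powR_increment_bounds (p x : R) : 0 < p -> p < 1 -> 0 < x -> 0 < 1 - x ->
  p * x <= 1 - (1 - x) `^ p /\ 1 - (1 - x) `^ p <= p * (x / (1 - x)).
Proof.
move=> p0 p1 x0 x1; split.
  have h : (1 + - x) `^ p <= 1 + p * - x by apply: powR_le_tangent => //; exact: ltW.
  by lra.
have xx0 : 0 <= x / (1 - x) by rewrite divr_ge0 ?(ltW x0) ?(ltW x1).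
have xx1 : 0 <= 1 + x / (1 - x) by rewrite addr_ge0.
have h : (1 + x / (1 - x)) `^ p <= 1 + p * (x / (1 - x)) by exact: powR_le_tangent.
have E1 : (1 - x) `^ p * (1 + x / (1 - x)) `^ p = 1.
  rewrite -powRM ?(ltW x1)//.
  have -> : (1 - x) * (1 + x / (1 - x)) = 1 by field; rewrite gt_eqF.
  by rewrite powR1.
have z0 : 0 <= (1 - x) `^ p by exact: powR_ge0.
have z1 : (1 - x) `^ p <= 1.
  rewrite /powR gt_eqF// expR_le1 mulr_ge0_le0 ?(ltW p0)//.
  by apply: ln_le0; rewrite lerBlDr lerDl ltW.
have h2 := ler_wpM2l z0 h; rewrite E1 in h2.
have px0 : 0 <= p * (x / (1 - x)) by rewrite mulr_ge0 ?(ltW p0).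
have : (1 - x) `^ p * (p * (x / (1 - x))) <= p * (x / (1 - x)) by rewrite ler_piMl.
lra.
Qed.

(** The estimate behind [log_center_lag]: [rho] stands for the ratio of the two
    centerings, [x] for the relative size of the lag, [S] for the decrease of
    [c1 * y ^ p] and [z] for the lower order term. *)
Lemma expR_perturbation (f rho x S z : R) : 0 < f -> 40 * f <= 1 ->
  1 - f <= rho -> rho <= 1 + f -> 0 < x -> x <= f ->
  rho^-1 <= S -> S <= rho^-1 / (1 - x) -> `|z| <= f ->
  `|rho * expR (S - 1 - z) - 1| <= 40 * f.
Proof.
move=> f0 f1 r1 r2 x0 xf S1 S2 zf.
have rho0 : 0 < rho by lra.
have x1 : 0 < 1 - x by lra.
have T1 : 1 - f <= rho^-1.
  rewrite -[leRHS]div1r ler_pdivlMr//.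
  by clear -f0 f1 r1 r2; nra.
have T2 : rho^-1 / (1 - x) <= 1 + 8 * f.
  rewrite ler_pdivrMr// -[leLHS]div1r ler_pdivrMr//.
  have h1 : (1 - f) * (1 - f) <= (1 - x) * rho by apply: ler_pM => //; lra.
  have h3 : 1 <= (1 + 8 * f) * ((1 - f) * (1 - f)) by clear -f0 f1; nra.
  have f80 : 0 <= 1 + 8 * f by lra.
  by apply: le_trans h3 _; rewrite -mulrA ler_wpM2l.
move: zf; rewrite ler_norml => /andP[z1 z2].
set E := S - 1 - z.
have E1 : - (9 * f) <= E by rewrite /E; lra.
have E2 : E <= 9 * f by rewrite /E; lra.
clearbody E; clear S1 S2 T1 T2 z1 z2 S z x0 x1 xf x.
have e1 : 1 - 9 * f <= expR E by apply: le_trans (expR_ge1Dx E); lra.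
have e2 : expR E * (1 - 9 * f) <= 1.
  rewrite -[leRHS](expRxMexpNx_1 E) ler_wpM2l ?expR_ge0//.
  apply: le_trans (expR_ge1Dx _); lra.
have e3 : expR E <= 1 + 18 * f.
  have f9 : 0 < 1 - 9 * f by lra.
  by rewrite -(ler_pM2r f9); apply: le_trans e2 _; clear -f0 f1; nra.
have g0 := expR_ge0 E; set g := expR E in e1 e2 e3 g0 *; clearbody g.
clear e2 E1 E2; rewrite ler_norml; apply/andP; split; nra.
Qed.

End perturbation.

Section lognormal_norming.
Context {R : realType}.
Variables (a c1 tau b : R).
Hypotheses (c1_gt0 : 0 < c1) (tau_gt1 : 1 < tau).

Let tau_gt0 : 0 < tau. Proof. exact: lt_trans tau_gt1. Qed.
Let p := tau^-1.
Let p_gt0 : 0 < p. Proof. by rewrite invr_gt0. Qed.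
Let p_lt1 : p < 1. Proof. by rewrite invf_lt1. Qed.

(** [RaV_center] at [r] is the exponential of [log_center] at [ln r]. *)
Definition log_center (y : R) : R :=
  c1 * y `^ p + c1 / tau * y `^ (p - 1) * (b / tau * ln y + b * ln c1 + ln a).

(** With [y = log n], the quantity [log (1 / t_n)]. *)
Definition log_lag (y : R) : R := tau * y / log_center y.

(** Lowering [y] by [log_lag y] lowers [c1 * y ^ p] by about 1, which is where the
    maximum of [u * exp (- u)] sits; the other term of [log_center] tends to 0. *)
Lemma log_center_lag e : 0 < e -> \forall y \near +oo,
  `|tau / c1 * y `^ (1 - p) / log_lag y
    * expR (c1 * y `^ p - 1 - log_center (y - log_lag y)) - 1| <= e.
Proof.
move=> e0; pose f := Num.min e 1 / 40.
have f0 : 0 < f by rewrite divr_gt0// lt_min e0 ltr01.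
have [fe f1] : 40 * f <= e /\ 40 * f <= 1.
  by rewrite /f mulrC divfK//; rewrite !ge_min !lexx orbT.
pose K := b * ln c1 + ln a.
have tf0 : 0 < tau * f by rewrite mulr_gt0.
have hA := near_log_abs K (b / tau) tf0.
have cf0 : 0 < tau * f / c1 by rewrite divr_gt0.
have p10 : 0 < 1 - p by rewrite subr_gt0.
have [M [Mr HM]] := near_log_powR_abs K (b / tau) cf0 p10.
near=> y.
have y1 : 1 <= y by near: y; exact: near_pinfty_ge.
have y0 : 0 < y by apply: lt_le_trans y1.
have yM : 2 * (`|M| + 1) <= y by near: y; exact: near_pinfty_ge.
have yp0 : 0 < y `^ p by rewrite powR_gt0.
have ypbig : 2 * tau / (c1 * f) <= y `^ p by near: y; exact: near_powR_ge.
have hAy : `|K + b / tau * ln y| <= tau * f * y by near: y.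
have pw x : 0 < x -> x `^ (p - 1) = x `^ p / x.
  move=> x0; rewrite powRB; last by rewrite (gt_eqF x0) implybT.
  by rewrite powRr1 ?(ltW x0).
have cy0 : 0 < c1 * y `^ p by rewrite mulr_gt0.
pose rho := log_center y / (c1 * y `^ p).
have rhoE : rho = 1 + (K + b / tau * ln y) / (tau * y).
  by rewrite /rho /log_center pw// /K; field; rewrite !gt_eqF.
have ty0 : 0 < tau * y by rewrite mulr_gt0.
have rho1 : 1 - f <= rho <= 1 + f.
  have : `|(K + b / tau * ln y) / (tau * y)| <= f.
    rewrite normrM normfV (gtr0_norm ty0) ler_pdivrMr//.
    by apply: le_trans hAy _; rewrite le_eqVlt; apply/orP; left; apply/eqP; ring.
  by rewrite ler_norml rhoE => /andP[? ?]; apply/andP; split; lra.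
have /andP[rlo rhi] := rho1.
have rho0 : 0 < rho by lra.
have bE : log_center y = rho * (c1 * y `^ p) by rewrite /rho divfK// gt_eqF.
have b0 : 0 < log_center y by rewrite bE mulr_gt0.
set t := log_lag y.
have tE : t = tau * y / (rho * (c1 * y `^ p)) by rewrite /t /log_lag bE.
have t0 : 0 < t by rewrite divr_gt0.
pose x := t / y.
have x0 : 0 < x by rewrite divr_gt0.
have xf : x <= f.
  have -> : x = tau / (rho * (c1 * y `^ p)).
    by rewrite /x tE; field; rewrite !gt_eqF.
  have rc : 0 < rho * (c1 * y `^ p) by exact: mulr_gt0.
  rewrite ler_pdivrMr//.
  have c1f : 0 < c1 * f by exact: mulr_gt0.
  have : 2 * tau <= y `^ p * (c1 * f) by rewrite -ler_pdivrMr.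
  have : 0 < f * (c1 * y `^ p) by rewrite mulr_gt0.
  nra.
have txE : t = x * y by rewrite /x divfK// gt_eqF.
pose l := y - t.
have lE : l = y * (1 - x) by rewrite /l txE; ring.
have x1 : 0 < 1 - x by lra.
have l0 : 0 < l by rewrite lE mulr_gt0.
have lM : M < l.
  apply: (@lt_le_trans _ _ (`|M| + 1)); first by rewrite ltr_pwDr// ler_norm.
  have yx : y * x <= y * (1 / 2) by rewrite ler_wpM2l ?(ltW y0)//; lra.
  by rewrite lE; lra.
have hl := HM l lM.
have lp0 : 0 < l `^ p by rewrite powR_gt0.
have small : `|c1 / tau * l `^ (p - 1) * (b / tau * ln l + b * ln c1 + ln a)| <= f.
  have -> : c1 / tau * l `^ (p - 1) * (b / tau * ln l + b * ln c1 + ln a) =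
    c1 / tau * l `^ (p - 1) * (K + b / tau * ln l) by rewrite /K; ring.
  have q0 : 0 < c1 / tau * l `^ (p - 1) by rewrite mulr_gt0 ?divr_gt0 ?powR_gt0.
  rewrite normrM (gtr0_norm q0); apply: le_trans (ler_wpM2l (ltW q0) hl) _.
  have -> : c1 / tau * l `^ (p - 1) * (tau * f / c1 * l `^ (1 - p)) =
            f * (l `^ (p - 1) * l `^ (1 - p)) by field; rewrite !gt_eqF.
  rewrite -powRD; last by rewrite (gt_eqF l0) implybT.
  by rewrite addrC subrKA subrr powRr0 mulr1.
have Kt : tau / c1 * y `^ (1 - p) / t = rho.
  have -> : y `^ (1 - p) = y / y `^ p.
    by rewrite powRB ?powRr1 ?(ltW y0)// (gt_eqF y0) implybT.
  by rewrite tE; field; rewrite !gt_eqF.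
have lpE : l `^ p = y `^ p * (1 - x) `^ p by rewrite lE powRM// ltW.
have cyx : c1 * y `^ p * (p * x) = rho^-1.
  by rewrite /x tE /p; field; rewrite !gt_eqF.
have [inc1 inc2] := powR_increment_bounds p_gt0 p_lt1 x0 x1.
have SE : c1 * y `^ p - c1 * l `^ p = c1 * y `^ p * (1 - (1 - x) `^ p).
  by rewrite lpE; ring.
have Slo : rho^-1 <= c1 * y `^ p - c1 * l `^ p.
  by rewrite SE -cyx ler_wpM2l// ltW.
have Shi : c1 * y `^ p - c1 * l `^ p <= rho^-1 / (1 - x).
  rewrite SE -cyx [leRHS](_ : _ = c1 * y `^ p * (p * (x / (1 - x)))); last by ring.
  by rewrite ler_wpM2l// ltW.
have E : c1 * y `^ p - 1 - log_center l = (c1 * y `^ p - c1 * l `^ p) - 1 -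
    (c1 / tau * l `^ (p - 1) * (b / tau * ln l + b * ln c1 + ln a)).
  by rewrite /log_center; ring.
rewrite Kt E; apply: le_trans fe.
exact: (expR_perturbation f0 f1 rlo rhi x0 xf Slo Shi small).
Unshelve. all: by end_near. Qed.

End lognormal_norming.

Section lognormal_case.
Context {R : realType} {d : measure_display} {T : measurableType d}.
Variables (P : probability T R) (m : nat).
Variables (weight : nat -> {RV P >-> R}) (target : nat -> 'I_m -> {RV P >-> nat}).
Variable W : {RV P >-> R}.
Hypothesis m_ge1 : (1 <= m)%N.
Hypothesis wrg : weighted_recursive_graph weight target W.
Hypothesis W_ge0 : forall w, 0 <= W w.
Hypothesis total_weight_law : {ae P, forall w, forall e : R, 0 < e ->
  \forall n \near \oo, `|total_weight weight n w - n%:R| <= e * n%:R}.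
Variables (a c1 tau b : R).
Hypothesis RaV : case_RaV W a c1 tau b.

Let law := weight_law wrg.
Let indep := weight_indep wrg.
Let c1_gt0 : 0 < c1. Proof. by case: RaV. Qed.
Let tau_gt1 : 1 < tau. Proof. by case: RaV. Qed.
Let tau_gt0 : 0 < tau. Proof. exact: lt_trans tau_gt1. Qed.
Let p := tau^-1.
Let p_gt0 : 0 < p. Proof. by rewrite invr_gt0. Qed.
Let p1_gt0 : 0 < 1 - p. Proof. by rewrite subr_gt0 invf_lt1. Qed.

Local Notation B := (scaleB c1 tau).
Local Notation K := (scaleK c1 tau).

Lemma near_ln_log_scaleK (A C k : R) : 0 < k ->
  \forall n \near \oo, A + C * ln (ln n%:R) <= k * K n.
Proof.
move=> k0; have q0 : 0 < k * (tau / c1) by rewrite mulr_gt0// divr_gt0.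
apply: filterS (near_ln_log A C q0 p1_gt0) => n h.
by apply: le_trans h _; rewrite /scaleK -mulrA.
Qed.

Lemma near_ln_log_ln (A C k : R) : 0 < k ->
  \forall n \near \oo, A + C * ln (ln n%:R) <= k * ln n%:R.
Proof. by move=> k0; exact: (near_ln (near_log_le A C k0)). Qed.

Lemma scaleK_ge (A : R) : \forall n \near \oo, A <= K n.
Proof.
by apply: filterS (near_ln_log_scaleK A 0 ltr01) => n; rewrite mul0r addr0 mul1r.
Qed.

Lemma scaleK_le (k : R) : 0 < k -> \forall n \near \oo, K n <= k * ln n%:R.
Proof.
move=> k0; near=> n.
have L0 : 0 < ln n%:R :> R.
  by apply: (@lt_le_trans _ _ 1) => //; near: n; exact: near_ln_ge.
have Lp : tau / (c1 * k) <= ln n%:R `^ p by near: n; exact: near_ln_powR_ge.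
have Lp0 : 0 < ln n%:R `^ p by rewrite powR_gt0.
have ck : 0 < c1 * k by exact: mulr_gt0.
rewrite -(ler_pM2r Lp0) scaleK_powR//.
move: Lp; rewrite ler_pdivrMr// => Lp.
rewrite [leRHS]mulrAC; apply: ler_wpM2r; first exact: ltW.
by rewrite ler_pdivrMr//; apply: le_trans Lp _; rewrite le_eqVlt; apply/orP; left; apply/eqP; ring.
Unshelve. all: by end_near. Qed.

(** Summing [1 / i] over the vertices costs a factor [1 + log n]. *)
Lemma harmonic_union_bound (A : nat -> nat -> set T) (g : nat -> R) :
  (forall n i, measurable (A n i)) ->
  (\forall n \near \oo, forall i, (i < n)%N -> (P (A n i) <= (expR (g n) * i.+1%:R^-1)%:E)%E) ->
  (forall M : R, \forall n \near \oo, g n + ln (ln n%:R) <= M) ->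
  with_high_prob P (fun n => ~` \big[setU/set0]_(i < n) A n i).
Proof.
move=> mA PA gM.
apply: (@with_high_prob_eps _ _ _ P _ (fun n => \big[setU/set0]_(i < n) A n i)).
- by move=> n; apply: bigsetU_measurable => i _.
- by move=> n; rewrite setCK.
move=> e e0; near=> n.
have PAn : forall i, (i < n)%N -> (P (A n i) <= (expR (g n) * i.+1%:R^-1)%:E)%E by near: n.
have n1 : (1 <= n)%N by near: n; exact: nbhs_infty_ge.
apply: le_trans (union_bound (mA n) PAn) _; rewrite lee_fin -mulr_sumr.
have L1 : 1 <= ln n%:R :> R by near: n; exact: near_ln_ge.
have L0 : 0 < ln n%:R :> R by apply: lt_le_trans L1.
apply: (@le_trans _ _ (expR (g n) * (2 * ln n%:R))).
  rewrite ler_wpM2l ?expR_ge0//; apply: le_trans (harmonic_sum_le n1) _; lra.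
have gn : g n + ln (ln n%:R) <= ln e - ln 2 by near: n; exact: gM.
rewrite -[2 in X in X <= _]lnK ?posrE// -[ln n%:R]lnK ?posrE// -[e]lnK ?posrE//.
by rewrite -!expRD ler_expR; lra.
Unshelve. all: by end_near. Qed.

Definition scaled_lag (n i : nat) : R := ln (n%:R / i%:R) / K n.
(** A weight below [B n / lag_factor u] at scaled lag [u] is at most [B n], and its
    product with [u] is at most [B n / e], the maximum of [B n * u * exp (- u)]. *)
Definition lag_factor (u : R) : R := Num.max (expR 1 * u) 1.

Lemma lag_factor_ge1 u : 1 <= lag_factor u.
Proof. by rewrite /lag_factor le_max lexx orbT. Qed.

Lemma lag_factor_le_expR u : 0 <= u -> lag_factor u <= expR u.
Proof.
move=> u0; rewrite /lag_factor ge_max; apply/andP; split.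
  have -> : expR u = expR 1 * expR (u - 1) by rewrite -expRD addrC subrK.
  rewrite ler_wpM2l ?expR_ge0//; apply: le_trans (expR_ge1Dx _).
  by rewrite addrC subrK.
by apply: le_trans (expR_ge1Dx u); rewrite lerDl.
Qed.

Lemma lag_factor_ge u : expR 1 * u <= lag_factor u.
Proof. by rewrite /lag_factor le_max lexx. Qed.

(** Lowering the level by [lag_factor u <= exp u] raises the tail by at most
    [exp (K n * u) = n / i], so the union bound is a harmonic sum, and the factor
    [1 + e] gains [exp (- ln (1 + e) * K n)]. *)
Lemma RaV_weights_lt (e : R) : 0 < e -> with_high_prob P (fun n => [set w |
  forall i, (1 <= i <= n)%N ->
    weight i w * lag_factor (scaled_lag n i) < (1 + e) * B n]).
Proof.
move=> e0; have [Q Q0 HQ] := RaV_tail_le RaV.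
pose h := ln (1 + e).
have h0 : 0 < h by rewrite ln_gt0// ltrDl.
have e10 : 0 < 1 + e by rewrite addr_gt0.
pose A n i := [set w | (1 + e) * B n / lag_factor (scaled_lag n i.+1) <= weight i.+1 w].
have W1 : with_high_prob P (fun n => ~` \big[setU/set0]_(i < n) A n i).
  apply: (@harmonic_union_bound A (fun n => - (h * K n) + Q * ln (ln n%:R))).
  - by move=> n i; exact: measurable_ge_fun.
  - near=> n => i iN.
    have tl : forall l : R, - (c1 / 2 * ln n%:R `^ p) <= l -> l <= c1 * ln n%:R `^ p ->
        tail W (B n * expR l) <= expR (- ln n%:R - K n * l + Q * ln (ln n%:R)).
      by near: n.
    have L1 : 1 <= ln n%:R :> R by near: n; exact: near_ln_ge.
    have L0 : 0 < ln n%:R :> R by apply: lt_le_trans L1.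
    have K1 : 1 <= K n by near: n; exact: scaleK_ge.
    have K0 : 0 < K n by apply: lt_le_trans K1.
    have i1N : (1 <= i.+1 <= n)%N by rewrite iN.
    have [l0 lE] := @ln_div_index R n i.+1 i1N.
    have li0 : 0 <= ln i.+1%:R :> R by rewrite ln_ge0// ler1n.
    have hLp : h / c1 <= ln n%:R `^ p by near: n; exact: near_ln_powR_ge.
    have lnLp : 1 + 1 * ln (ln n%:R) <= c1 / 2 * ln n%:R `^ p.
      by near: n; apply: near_ln_log; rewrite ?divr_gt0.
    rewrite /A (weight_tail law) //.
    set u := scaled_lag n i.+1.
    have u0 : 0 <= u by rewrite divr_ge0// ltW.
    have uL : u <= ln n%:R.
      rewrite /u /scaled_lag ler_pdivrMr// lE.
      apply: (@le_trans _ _ (ln n%:R)); first by rewrite gerBl.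
      by rewrite ler_peMr// ltW.
    have M1 := lag_factor_ge1 u; set M := lag_factor u in M1 *.
    have M0 : 0 < M by apply: lt_le_trans M1.
    have lM0 : 0 <= ln M by rewrite ln_ge0.
    have lMu : ln M <= u.
      by rewrite -[leRHS]expRK ler_ln ?posrE ?expR_gt0//; exact: lag_factor_le_expR.
    have lML : ln M <= 1 + ln (ln n%:R).
      have -> : 1 + ln (ln n%:R) = ln (expR 1 * ln n%:R) :> R.
        by rewrite lnM ?posrE ?expR_gt0// expRK.
      have eL : 0 < expR 1 * ln n%:R :> R by rewrite mulr_gt0 ?expR_gt0.
      rewrite ler_ln ?posrE// /M /lag_factor ge_max ler_wpM2l ?expR_ge0//=.
      by rewrite mulr_ege1// -expR0 ler_expR.
    have -> : (1 + e) * B n / M = B n * expR (h - ln M).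
      rewrite expRD expRN !lnK ?posrE//; field; exact: lt0r_neq0.
    have hc : h <= c1 * ln n%:R `^ p.
      by move: hLp; rewrite ler_pdivrMr// mulrC.
    rewrite lee_fin; apply: le_trans (tl _ _ _) _; [lra|lra|].
    have i0 : 0 < i.+1%:R :> R by rewrite ltr0n.
    rewrite -[i.+1%:R^-1]lnK ?posrE ?invr_gt0// lnV ?posrE// -expRD ler_expR.
    have Ku : K n * ln M <= ln n%:R - ln i.+1%:R.
      apply: (@le_trans _ _ (K n * u)); first by rewrite ler_wpM2l// ltW.
      by rewrite /u /scaled_lag mulrC divfK ?gt_eqF// lE.
    lra.
  - move=> M; have := near_ln_log_scaleK (- M) (Q + 1) h0.
    by apply: filterS => n; lra.
apply: (modeS (with_high_prob_mode P) _ W1).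
near=> n => w /= nA i iN; rewrite ltNge; apply/negP => hi; apply: nA.
have i0 : (i.-1 < n)%N by case/andP: iN => i1; rewrite -{1}(prednK i1).
have iE : i.-1.+1 = i by rewrite prednK//; case/andP: iN.
rewrite (bigD1 (Ordinal i0))//=; left; rewrite /A /= iE ler_pdivrMr//.
exact: lt_le_trans (lag_factor_ge1 _).
Unshelve. all: by end_near. Qed.

(** The largest of the first [n ^ (1 - e)] weights is smaller than [B n] by more than
    any power of [log n], while no lag exceeds [log n]. *)
Lemma RaV_weights_far (e : R) : 0 < e -> with_high_prob P (fun n => [set w |
  forall i, (1 <= i <= n)%N -> ln i%:R <= (1 - e) * ln n%:R ->
    weight i w * (2 * expR 1 * ln n%:R) < B n * K n]).
Proof.
move=> e0; have [Q Q0 HQ] := RaV_tail_le RaV.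
pose A n i := [set w | ln i.+1%:R <= (1 - e) * ln n%:R /\
  B n * K n / (2 * expR 1 * ln n%:R) <= weight i.+1 w].
have mA n i : measurable (A n i).
  rewrite /A; have [c|c] := boolP (ln i.+1%:R <= (1 - e) * ln n%:R).
    rewrite (_ : mkset _ = [set w | B n * K n / (2 * expR 1 * ln n%:R) <= weight i.+1 w]).
      exact: measurable_ge_fun.
    by apply/seteqP; split => w /= => [[]|h]//.
  by rewrite (_ : mkset _ = set0)//; apply/seteqP; split => w //= [].
have W1 : with_high_prob P (fun n => ~` \big[setU/set0]_(i < n) A n i).
  apply: (@harmonic_union_bound A (fun n => - (e / 2 * ln n%:R) + Q * ln (ln n%:R))) => //.
  - near=> n => i iN.
    have tl : forall l : R, - (c1 / 2 * ln n%:R `^ p) <= l -> l <= c1 * ln n%:R `^ p ->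
        tail W (B n * expR l) <= expR (- ln n%:R - K n * l + Q * ln (ln n%:R)).
      by near: n.
    have L1 : 1 <= ln n%:R :> R by near: n; exact: near_ln_ge.
    have L0 : 0 < ln n%:R :> R by apply: lt_le_trans L1.
    have K1 : 1 <= K n by near: n; exact: scaleK_ge.
    have K0 : 0 < K n by apply: lt_le_trans K1.
    have KL : K n <= 1 * ln n%:R by near: n; exact: scaleK_le.
    have [c|c] := boolP (ln i.+1%:R <= (1 - e) * ln n%:R); last first.
      rewrite /A (_ : mkset _ = set0) ?measure0.
        by rewrite lee_fin mulr_ge0 ?expR_ge0.
      by apply/seteqP; split => w //= [ci]; rewrite ci in c.
    apply: (@le_trans _ _ (P [set w | (B n * K n / (2 * expR 1 * ln n%:R) <= weight i.+1 w)%R])).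
      by apply: le_measure; rewrite ?inE//; [exact: measurable_ge_fun|move=> w []].
    rewrite (weight_tail law)//.
    pose l := ln 2 + 1 + ln (ln n%:R) - ln (K n).
    have x0 : 0 < 2 * expR 1 * ln n%:R :> R by rewrite !mulr_gt0 ?expR_gt0.
    have -> : B n * K n / (2 * expR 1 * ln n%:R) = B n * expR (- l).
      by rewrite /l opprB expRB !expRD !lnK ?posrE// mulrA.
    have lK0 : 0 <= ln (K n) by rewrite ln_ge0.
    have lKL : ln (K n) <= ln (ln n%:R).
      by rewrite ler_ln ?posrE//; move: KL; rewrite mul1r.
    have ln2 : 0 <= ln 2 :> R by rewrite ln_ge0// ler1n.
    have lup : ln 2 + 1 + 1 * ln (ln n%:R) <= c1 / 2 * ln n%:R `^ p.
      by near: n; apply: near_ln_log; rewrite ?divr_gt0.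
    have Lp0 : 0 <= c1 * ln n%:R `^ p by rewrite mulr_ge0 ?powR_ge0// ltW.
    rewrite lee_fin; apply: le_trans (tl _ _ _) _.
    + by rewrite lerN2; apply: le_trans lup; rewrite /l; lra.
    + by apply: le_trans Lp0; rewrite /l; lra.
    have i0 : 0 < i.+1%:R :> R by rewrite ltr0n.
    rewrite -[i.+1%:R^-1]lnK ?posrE ?invr_gt0// lnV ?posrE// -expRD ler_expR.
    have Kl : K n * l <= e / 2 * ln n%:R.
      have k0 : 0 < e * c1 / (2 * tau) by rewrite divr_gt0 ?mulr_gt0.
      have lb : ln 2 + 1 + 1 * ln (ln n%:R) <= e * c1 / (2 * tau) * ln n%:R `^ p.
        by near: n; apply: near_ln_log; rewrite ?divr_gt0 ?mulr_gt0.
      apply: (@le_trans _ _ (K n * (e * c1 / (2 * tau) * ln n%:R `^ p))).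
        by rewrite ler_wpM2l ?(ltW K0)//; apply: le_trans lb; rewrite /l; lra.
      have -> : K n * (e * c1 / (2 * tau) * ln n%:R `^ p) =
        e * c1 / (2 * tau) * (K n * ln n%:R `^ p) by ring.
      rewrite scaleK_powR// le_eqVlt; apply/orP; left; apply/eqP.
      by field; rewrite !gt_eqF.
    lra.
  - move=> M; have e20 : 0 < e / 2 by rewrite divr_gt0.
    have := near_ln_log_ln (- M) (Q + 1) e20.
    by apply: filterS => n; lra.
apply: (modeS (with_high_prob_mode P) _ W1).
near=> n => w /= nA i iN ci; rewrite ltNge; apply/negP => hi; apply: nA.
have L0 : 0 < ln n%:R :> R.
  by apply: (@lt_le_trans _ _ 1) => //; near: n; exact: near_ln_ge.
have i0 : (i.-1 < n)%N by case/andP: iN => i1; rewrite -{1}(prednK i1).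
have iE : i.-1.+1 = i by rewrite prednK//; case/andP: iN.
rewrite (bigD1 (Ordinal i0))//=; left; rewrite /A /= iE; split => //.
by rewrite ler_pdivrMr// !mulr_gt0 ?expR_gt0.
Unshelve. all: by end_near. Qed.

Let v n : R := expR (- 1) * B n * K n.

(** The [n * exp (- K n)] first vertices all have a lag of at least [K n], and are
    numerous enough for one of their weights to be close to [B n / e]. *)
Lemma RaV_score_ge (e : R) : 0 < e -> with_high_prob P (fun n => [set w |
  exists2 i, (1 <= i <= n)%N & (1 - e) * v n <= degree_score weight n i w]).
Proof.
move=> e0.
have v_ge0 : \forall n \near \oo, 0 <= v n.
  near=> n; have K0 : 0 <= K n by near: n; exact: scaleK_ge.
  by apply: mulr_ge0 => //; apply: mulr_ge0; exact: expR_ge0.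
wlog e1 : e e0 / e < 1.
  move=> hw; have [/hw|e1] := ltP e 1; first exact.
  apply: (modeS (with_high_prob_mode P) _ (hw (1 / 2) _ _)); [|by rewrite divr_gt0|lra].
  near=> n => w /= [i iN h]; exists i => //; apply: le_trans h.
  have : 0 <= v n by near: n.
  by move=> v0; apply: ler_wpM2r => //; lra.
have e10 : 0 < 1 - e by rewrite subr_gt0.
pose h := - ln (1 - e) / 2.
have le0 : ln (1 - e) < 0 by rewrite ln_lt0// e10 gtrBl.
have h0 : 0 < h by rewrite divr_gt0// oppr_gt0.
have k0 : 0 < 1 + h by rewrite addr_gt0.
have kl : 1 + h < 1 - ln (1 - e) by rewrite /h; lra.
have [Q Q0 HQ] := RaV_tail_ge RaV k0 kl.
pose x n := B n * expR (- (1 - ln (1 - e))).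
have xE n : x n = (1 - e) * (expR (- 1) * B n).
  by rewrite /x opprB expRD lnK ?posrE//; ring.
pose N n := Num.truncn (expR (ln n%:R - K n)).
have ev : with_high_prob P (fun n => [set w | exists2 i, (1 <= i <= N n)%N & x n <= weight i w]).
  apply: (@with_high_prob_eps _ _ _ P _
    (fun n => [set w | forall i, (1 <= i <= N n)%N -> weight i w < x n])).
  - by move=> n; exact: measurable_all_lt.
  - move=> n w /= nA i iN; rewrite ltNge; apply/negP => hi; apply: nA.
    by exists i.
  move=> eta eta0; near=> n.
  apply: le_trans (prob_all_lt law indep (N n) (x n)) _.
  rewrite lee_fin -[eta]lnK ?posrE// ler_expR lerNl.
  have L2 : 2 <= ln n%:R :> R by near: n; exact: near_ln_ge.
  have tl : expR (- ln n%:R + K n * (1 + h) - Q * ln (ln n%:R)) <= tail W (x n).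
    by near: n.
  have KL : K n <= 1 / 2 * ln n%:R by near: n; apply: scaleK_le; rewrite divr_gt0.
  have E2 : 2 <= expR (ln n%:R - K n).
    by apply: le_trans (expR_ge1Dx _); lra.
  have NE : 1 / 2 * expR (ln n%:R - K n) <= (N n)%:R.
    have : expR (ln n%:R - K n) < (N n)%:R + 1.
      by rewrite natr1; apply: real_truncnS_gt; exact: num_real.
    lra.
  apply: (@le_trans _ _ ((1 / 2 * expR (ln n%:R - K n)) *
      expR (- ln n%:R + K n * (1 + h) - Q * ln (ln n%:R)))); last first.
    by apply: ler_pM => //; rewrite ?expR_ge0// mulr_ge0 ?expR_ge0// divr_ge0.
  rewrite -[leRHS]mulrA -expRD.
  have -> : ln n%:R - K n + (- ln n%:R + K n * (1 + h) - Q * ln (ln n%:R)) =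
      h * K n - Q * ln (ln n%:R) by ring.
  have hk : - 2 * ln eta + Q * ln (ln n%:R) <= h * K n.
    by near: n; exact: near_ln_log_scaleK.
  have := expR_ge1Dx (h * K n - Q * ln (ln n%:R)); lra.
apply: (modeS (with_high_prob_mode P) _ ev).
near=> n => w /= [i iN Wi].
have n1 : (1 <= n)%N by near: n; exact: nbhs_infty_ge.
have K0 : 0 <= K n by near: n; exact: scaleK_ge.
have [i1 iN'] := andP iN.
have iL : ln i%:R <= ln n%:R - K n :> R.
  rewrite -[leRHS]expRK ler_ln ?posrE ?ltr0n ?expR_gt0//.
  apply: (@le_trans _ _ (N n)%:R); first by rewrite ler_nat.
  by rewrite /N truncn_le expR_ge0.
have in' : (1 <= i <= n)%N.
  rewrite i1 -(ler_nat R) -ler_ln ?posrE ?ltr0n//.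
  by apply: le_trans iL _; rewrite gerBl.
exists i => //; have [l0 lE] := @ln_div_index R n i in'.
rewrite xE in Wi.
have -> : (1 - e) * v n = (1 - e) * (expR (- 1) * B n) * K n by rewrite /v; ring.
apply: ler_pM => //.
- by rewrite !mulr_ge0 ?expR_ge0// ltW.
- by rewrite lE; lra.
Unshelve. all: by end_near. Qed.

Let t (n : nat) : R := expR (- tau * ln n%:R / ln (RaV_center a c1 tau b n%:R)).

Lemma RaV_norm_equiv (e : R) : 0 < e -> \forall n \near \oo,
  `|m%:R * v n / (m%:R * RaV_center a c1 tau b (t n * n%:R) * ln (1 / t n)) - 1| <= e.
Proof.
move=> e0; have H := near_ln (log_center_lag a b c1_gt0 tau_gt1 e0).
near=> n.
have n1 : (1 <= n)%N by near: n; exact: nbhs_infty_ge.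
have n0 : 0 < n%:R :> R by rewrite ltr0n.
have m0 : m%:R != 0 :> R by rewrite pnatr_eq0 -lt0n.
have rE (r : R) : RaV_center a c1 tau b r = expR (log_center a c1 tau b (ln r)) by [].
have tE : t n = expR (- log_lag a c1 tau b (ln n%:R)).
  by rewrite /t rE expRK /log_lag !mulNr.
rewrite tE div1r -expRN opprK expRK rE lnM ?posrE ?expR_gt0// expRK (addrC (- _)).
have -> : m%:R * v n / (m%:R *
    expR (log_center a c1 tau b (ln n%:R - log_lag a c1 tau b (ln n%:R))) *
    log_lag a c1 tau b (ln n%:R)) =
  tau / c1 * ln n%:R `^ (1 - p) / log_lag a c1 tau b (ln n%:R) *
  expR (c1 * ln n%:R `^ p - 1 - log_center a c1 tau b (ln n%:R - log_lag a c1 tau b (ln n%:R))).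
  set x := log_lag _ _ _ _ _; set l := log_center _ _ _ _ _.
  have -> : expR (c1 * ln n%:R `^ p - 1 - l) = B n * expR (- 1) / expR l.
    by rewrite expRB expRD.
  rewrite /v -/(K n); set y := expR l.
  have [->|x0] := eqVneq x 0; first by rewrite !mulr0 !invr0 !mulr0 mul0r.
  have y0 : y != 0 by rewrite /y gt_eqF ?expR_gt0.
  by field; rewrite m0 x0 y0.
by near: n; exact: H.
Unshelve. all: by end_near. Qed.

(** The scale [v] is [B n * K n * u * exp (- u)] at its maximum [u = 1]; as [K n] is
    negligible with respect to [log n], the optimal index is [n ^ (1 - o(1))]. *)
Theorem lognormal_case :
  cvg_in_probability P
    (fun n w =>
       (max_upto n (fun i =>
          (indegree target n i w)%:R /
          (m%:R * RaV_center a c1 tau b (t n * n%:R) * ln (1 / t n))),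
        ln (max_degree_label target n w)%:R / ln n%:R) : R * R)
    (1, 1).
Proof.
have v0 : \forall n \near \oo, 0 < v n.
  near=> n; have K1 : 1 <= K n by near: n; exact: scaleK_ge.
  apply: mulr_gt0; last exact: lt_le_trans K1.
  by rewrite mulr_gt0 ?expR_gt0.
have mode := with_high_prob_mode P.
apply: with_high_prob_cvg; apply: (@argmax_in_degree _ _ _ P m weight target W m_ge1 wrg W_ge0
  total_weight_law v (fun n => 2 * B n)).
- move=> A; near=> n.
  have K1 : 1 <= K n by near: n; exact: scaleK_ge.
  have L0 : 0 < ln n%:R :> R.
    by apply: (@lt_le_trans _ _ 1) => //; near: n; exact: near_ln_ge.
  have lA : ln (`|A| + 1) + 1 + 1 * ln (ln n%:R) <= c1 * ln n%:R `^ p.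
    by near: n; exact: near_ln_log.
  have A1 : 0 < `|A| + 1 by rewrite ltr_pwDr.
  apply: (@le_trans _ _ ((`|A| + 1) * ln n%:R)).
    by rewrite ler_wpM2r ?(ltW L0)// (le_trans (ler_norm A))// lerDl.
  apply: (@le_trans _ _ (expR (- 1) * B n)); last first.
    by rewrite /v ler_peMr// mulr_ge0 ?expR_ge0.
  rewrite -[_ + 1]lnK ?posrE// -[ln n%:R in X in X <= _]lnK ?posrE// -!expRD ler_expR; lra.
- move=> e e0; near=> n.
  have : 2 * expR 1 / e <= K n by near: n; exact: scaleK_ge.
  rewrite ler_pdivrMr// => KE.
  have := ler_wpM2l (mulr_ge0 (expR_ge0 (- 1)) (expR_ge0 (c1 * ln n%:R `^ p))) KE.
  rewrite -/(B n) /v (_ : expR (-1) * B n * (2 * expR 1) = (expR 1 * expR (- 1)) * (2 * B n)); last by ring.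
  by rewrite expRxMexpNx_1; lra.
- exact: mode.
- exact: eventually_as_with_high_prob.
- exact: v0.
- exact: RaV_norm_equiv.
- apply: (modeS mode _ (RaV_weights_lt ltr01)).
  apply: nearW => n w /= h i iN.
  have M1 := lag_factor_ge1 (scaled_lag n i); have hi := ltW (h i iN).
  have [W0|W0] := leP 0 (weight i w).
    apply: (@le_trans _ _ (weight i w * lag_factor (scaled_lag n i))).
      by rewrite ler_peMr.
    by apply: le_trans hi _; lra.
  by rewrite (le_trans (ltW W0))// mulr_ge0// expR_ge0.
- move=> e e0; apply: (modeS mode _ (RaV_weights_lt e0)).
  near=> n => w /= h i iN; have hi := ltW (h i iN).
  have [l0 lE] := @ln_div_index R n i iN.
  have K1 : 1 <= K n by near: n; exact: scaleK_ge.
  have K0 : 0 < K n by apply: lt_le_trans K1.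
  have vn : 0 < v n by near: n.
  have [W0|W0] := leP 0 (weight i w); last first.
    apply: (@le_trans _ _ 0); first by rewrite /degree_score mulr_le0_ge0// ltW.
    by rewrite mulr_ge0 ?(ltW vn)// addr_ge0// ltW.
  have uE : ln (n%:R / i%:R) = K n * scaled_lag n i.
    by rewrite /scaled_lag [RHS]mulrC divfK// gt_eqF.
  rewrite /degree_score uE.
  have := ler_wpM2l W0 (lag_factor_ge (scaled_lag n i)) => g.
  have g' : weight i w * (expR 1 * scaled_lag n i) <= (1 + e) * B n by exact: le_trans g hi.
  have := ler_wpM2l (mulr_ge0 (expR_ge0 (- 1)) (ltW K0)) g'.
  rewrite /v (_ : expR (-1) * K n * (weight i w * (expR 1 * scaled_lag n i)) =
    (expR 1 * expR (- 1)) * (weight i w * (K n * scaled_lag n i))); last by ring.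
  by rewrite expRxMexpNx_1; lra.
- exact: RaV_score_ge.
- move=> e e0; exists (1 / 2); first by rewrite divr_gt0.
  apply: (modeS mode _ (RaV_weights_far e0)).
  near=> n => w /= h i iN far.
  have [l0 lE] := @ln_div_index R n i iN; have /andP[i1 _] := iN.
  have K1 : 1 <= K n by near: n; exact: scaleK_ge.
  have L0 : 0 < ln n%:R :> R.
    by apply: (@lt_le_trans _ _ 1) => //; near: n; exact: near_ln_ge.
  have vn : 0 < v n by near: n.
  have li0 : 0 <= ln i%:R :> R by rewrite ln_ge0// ler1n.
  have liL : ln i%:R <= ln n%:R :> R by rewrite -subr_ge0 -lE.
  have ci : ln i%:R <= (1 - e) * ln n%:R.
    move: far; rewrite distrC ger0_norm.
      by rewrite lerBrDr -lerBrDl ler_pdivrMr.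
    by rewrite subr_ge0 ler_pdivrMr// mul1r.
  have hi := ltW (h i iN ci).
  have [W0|W0] := leP 0 (weight i w); last first.
    apply: (@le_trans _ _ 0); first by rewrite /degree_score mulr_le0_ge0// ltW.
    by rewrite mulr_ge0 ?(ltW vn)//; lra.
  have ll : weight i w * ln (n%:R / i%:R) <= weight i w * ln n%:R.
    by rewrite ler_wpM2l// lE gerBl.
  apply: le_trans ll _; rewrite /v.
  have := ler_wpM2l (expR_ge0 (- 1)) hi.
  rewrite (_ : expR (-1) * (weight i w * (2 * expR 1 * ln n%:R)) =
    (expR 1 * expR (- 1)) * (2 * (weight i w * ln n%:R))); last by ring.
  by rewrite expRxMexpNx_1; lra.
Unshelve. all: by end_near. Qed.

End lognormal_case.

Unset Implicit Arguments.

Theorem theorem2p13 (R : realType) (d : measure_display) (T : measurableType d)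
    (P : probability T R) (m : nat) (W : {RV P >-> R})
    (weight : nat -> {RV P >-> R}) (target : nat -> 'I_m -> {RV P >-> nat})
    (m_ge1 : (1 <= m)%N)
    (W_ge0 : forall w, 0 <= W w)
    (W_gt0 : P [set w | 0 < W w] = 1%E)
    (wrg : weighted_recursive_graph weight target W)
    (W_unbounded : ~ bounded_set (law_support W))
    (W_gumbel : in_gumbel_mda weight)
    (W_mean : ('E_P[W] = 1)%E) :
  [/\ (forall a b : nat -> R, gumbel_norming weight a b -> case_SV b ->
        cvg_in_probability P
          (fun n w =>
             (max_upto n (fun i =>
                (indegree target n i w)%:R / (m%:R * b n * ln n%:R)),
              ln (max_degree_label target n w)%:R / ln n%:R) : R * R)
          (1, 0)),
      (forall a c1 tau b : R, case_RV W a c1 tau b ->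
        let gamma := 1 / (tau + 1) in
        cvg_almost_surely P
          (fun n w =>
             (max_upto n (fun i =>
                (indegree target n i w)%:R /
                (m%:R * (1 - gamma) * RV_center a c1 tau b (n%:R `^ gamma)
                 * ln n%:R)),
              ln (max_degree_label target n w)%:R / ln n%:R) : R * R)
          (1, gamma)) &
      (forall a c1 tau b : R, case_RaV W a c1 tau b ->
        let t (n : nat) : R :=
          expR (- tau * ln n%:R / ln (RaV_center a c1 tau b n%:R)) in
        cvg_in_probability P
          (fun n w =>
             (max_upto n (fun i =>
                (indegree target n i w)%:R /
                (m%:R * RaV_center a c1 tau b (t n * n%:R) * ln (1 / t n))),
              ln (max_degree_label target n w)%:R / ln n%:R) : R * R)
          (1, 1))].
Proof.
have [a0 [b0 norming0]] := W_gumbel.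
have tw := total_weight_equiv (weight_law wrg) (weight_indep wrg) W_ge0
  W_unbounded norming0 W_mean.
split.
- by move=> a b norming SV; exact: (slowly_varying_case m_ge1 wrg W_ge0 W_unbounded W_mean norming SV).
- by move=> a c1 tau b RV; exact: (stretched_exponential_case m_ge1 wrg W_ge0 tw RV).
- by move=> a c1 tau b RaV; exact: (lognormal_case m_ge1 wrg W_ge0 tw RaV).
Qed.
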